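(* Let $S=(0,1)^2$. For every fixed $\sigma>0$, $$K_\sigma^{\square}:=\sup_{\Lambda\in\operatorname{Spec}(-\Delta_{\sigma,S})}\kappa_\sigma^{\square}(\Lambda)<\infty .$$ Consequently, for every measurable $V\subset S$ with $|V|>0$ there exists $c_{V,\sigma}^{\square}>0$ such that $$\|u\|_{L^2(V)}^2\ \geq\ c_{V,\sigma}^{\square}\,\|u\|_{L^2(S)}^2$$ for every eigenvalue $\Lambda$ of $-\Delta_{\sigma,S}$ and every $u\in\ker(-\Delta_{\sigma,S}-\Lambda)$.
   Context: $-\Delta_{\sigma,S}$ is the Laplacian on $L^2(S)$ with Robin boundary condition $\partial_\nu u+\sigma u=0$ on $\partial S$ ($\nu$ outward unit normal), i.e. the self-adjoint operator of the form $\int_S|\nabla u|^2+\sigma\int_{\partial S}|u|^2\,ds$ on $H^1(S)$. For $n\in\mathbb{Z}_{\geq0}$ let $k_n(\sigma)\ge0$ be the one-dimensional Robin frequency on $(0,1)$ associated with the Neumann branch $n$: $k_n(\sigma)^2$ is the $(n+1)$-st eigenvalue, in increasing order, of $-\varphi''=k^2\varphi$ on $(0,1)$ with $-\varphi'(0)+\sigma\varphi(0)=0$, $\varphi'(1)+\sigma\varphi(1)=0$. By separation of variables the eigenvalues of $-\Delta_{\sigma,S}$ are $\Lambda_{n,m}^{\square}(\sigma)=k_n(\sigma)^2+k_m(\sigma)^2$, $0\le n\le m$. Each unordered pair $\{n,m\}$ is one modal class, and $\kappa_\sigma^{\square}(\Lambda)$ is the number of unordered pairs $\{n,m\}$ with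 $\Lambda_{n,m}^{\square}(\sigma)=\Lambda$. *)

(* Defs.v *)
From HB Require Import structures.
From mathcomp Require Import all_boot all_order all_algebra.
From mathcomp Require Import complex.
From mathcomp Require Import all_classical all_reals all_analysis measurable_realfun.

Set Implicit Arguments.
Unset Strict Implicit.
Unset Printing Implicit Defensive.

Import Order.TTheory GRing.Theory Num.Theory.
Import numFieldNormedType.Exports.

Local Open Scope classical_set_scope.
Local Open Scope ring_scope.

Section one_dimensional_robin.
Context {R : realType}.
Implicit Types (sigma lambda : R) (n : nat).

(* phi is C^1 on the closed interval with derivative dphi there (at the end
   points dphi is the one-sided derivative, by continuity). *)
Definition robin1_eigenvalue sigma : set R := [set lambda : R |
  exists phi dphi : R -> R,
    [/\ {within `[0, 1], continuous phi} /\ {within `[0, 1], continuous dphi},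
        forall x : R, x \in `]0, 1[%R ->
          is_derive x 1 phi (dphi x) /\ is_derive x 1 dphi (- (lambda * phi x)),
        - dphi 0 + sigma * phi 0 = 0,
        dphi 1 + sigma * phi 1 = 0
      & exists2 x : R, x \in `[0, 1]%R & phi x != 0]].

(* The (n+1)-st eigenvalue is the one with exactly n eigenvalues strictly below
   it.  No multiplicity has to be recorded: the condition at 0 fixes the
   solution up to a factor, so all eigenvalues are simple. *)
Definition robin1_nth_eigenvalue sigma n : R :=
  xget 0 [set lambda : R | robin1_eigenvalue sigma lambda /\
    ([set l : R | robin1_eigenvalue sigma l /\ l < lambda] #= `I_n)%card].

Definition robin_freq sigma n : R := Num.sqrt (robin1_nth_eigenvalue sigma n).

Definition square_eigenvalue sigma n m : R :=
  robin_freq sigma n ^+ 2 + robin_freq sigma m ^+ 2.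

(* Unordered pairs {n, m} (n = m allowed) are represented by n <= m; the count
   is +oo if there are infinitely many. *)
Definition kappa_square sigma (Lambda : R) : \bar R :=
  counting [set p : nat * nat |
    (p.1 <= p.2)%N /\ square_eigenvalue sigma p.1 p.2 = Lambda].

End one_dimensional_robin.

Section functions_on_the_square.
Context {R : realType}.
Local Notation C := R[i].
Local Notation plane := (R * R)%type.
Implicit Types (u v f g t : plane -> C) (D : set plane).

Definition plane_measure :
    set (measurableTypeR R * measurableTypeR R)%type -> \bar R :=
  (@lebesgue_measure R \x @lebesgue_measure R)%E.

HB.instance Definition _ := Measure.on plane_measure.

(* Measurability for the completion of the Borel sigma-algebra. *)
Definition lebesgue_measurable D : Prop := completed_algebra_gen plane_measure D.

Definition unit_square : set plane := `]0, 1[ `*` `]0, 1[.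

Definition sqnorm (z : C) : R := complex.Re z ^+ 2 + complex.Im z ^+ 2.

Definition measurable_complex_fun D u : Prop :=
  measurable_fun (D : set (measurableTypeR R * measurableTypeR R)%type)
    (fun x => complex.Re (u x)) /\
  measurable_fun (D : set (measurableTypeR R * measurableTypeR R)%type)
    (fun x => complex.Im (u x)).

(* The squared norm of u in L^2(D).  The integral of a nonnegative function is
   a supremum over measurable simple functions below it, so this is also the
   Lebesgue value when D is only measurable for the completion. *)
Definition L2sq D u : \bar R :=
  (\int[plane_measure]_(x in D) (sqnorm (u x))%:E)%E.

Definition in_L2 u : Prop :=
  measurable_complex_fun unit_square u /\ (L2sq unit_square u < +oo)%E.

Definition integralC f : C :=
  Complex (Rintegral plane_measure unit_square (fun x => complex.Re (f x)))
          (Rintegral plane_measure unit_square (fun x => complex.Im (f x))).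

Definition L2dot u v : C := integralC (fun x => u x * (v x)^*%C).

(* The i-th side of the square, parametrized by arc length on [0, 1]. *)
Definition side (i : 'I_4) (s : R) : plane :=
  nth (0, s) [:: (0, s); (1, s); (s, 0); (s, 1)] i.

Definition boundary_L2sq t : \bar R :=
  (\sum_(i < 4) \int[lebesgue_measure]_(s in (`[0%R, 1%R] : set R))
     (sqnorm (t (side i s)))%:E)%E.

Definition boundary_in_L2 t : Prop :=
  (forall i,
    measurable_fun (`[0, 1] : set R) (fun s : R => complex.Re (t (side i s))) /\
    measurable_fun (`[0, 1] : set R) (fun s : R => complex.Im (t (side i s)))) /\
  (boundary_L2sq t < +oo)%E.

Definition boundary_integralC t : C :=
  \sum_(i < 4)
    Complex (Rintegral lebesgue_measure (`[0, 1] : set R)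
               (fun s : R => complex.Re (t (side i s))))
            (Rintegral lebesgue_measure (`[0, 1] : set R)
               (fun s : R => complex.Im (t (side i s)))).

Definition dir_x : plane := (1, 0).
Definition dir_y : plane := (0, 1).

(* All iterated directional derivatives exist and are continuous. *)
Definition smooth (psi : plane -> R) : Prop :=
  forall s : seq plane,
    let g := foldr (fun (e : plane) (h : plane -> R) => 'D_e h) psi s in
    continuous g /\ forall x e, derivable g x e.

Definition test_function (psi : plane -> R) : Prop :=
  [/\ smooth psi, compact (closure [set x | psi x != 0])
    & closure [set x | psi x != 0] `<=` unit_square].

Definition smoothC u : Prop :=
  smooth (fun x => complex.Re (u x)) /\ smooth (fun x => complex.Im (u x)).

Definition partialC (e : plane) u : plane -> C := fun x =>
  Complex ('D_e (fun y => complex.Re (u y)) x)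
          ('D_e (fun y => complex.Im (u y)) x).

Definition weak_partial (e : plane) u g : Prop :=
  forall psi, test_function psi ->
    integralC (fun x => u x * (('D_e psi x)%:C)%C) =
    - integralC (fun x => g x * ((psi x)%:C)%C).

(* t is the trace of u on the boundary: the continuous extension to H^1(S) of
   the restriction of functions smooth up to the boundary. *)
Definition is_trace u gx gy t : Prop :=
  exists2 w : nat -> plane -> C, forall j, smoothC (w j) &
    [/\ L2sq unit_square (fun x => w j x - u x) @[j --> \oo] --> 0%E,
        L2sq unit_square (fun x => partialC dir_x (w j) x - gx x) @[j --> \oo]
          --> 0%E,
        L2sq unit_square (fun x => partialC dir_y (w j) x - gy x) @[j --> \oo]
          --> 0%E
      & boundary_L2sq (fun x => w j x - t x) @[j --> \oo] --> 0%E].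

(* An element of H^1(S) bundled with its weak gradient and its trace, which are
   unique up to null sets; only the values of [H1_trace] on the boundary
   matter. *)
Record sobolevH1 := SobolevH1 {
  H1_fun :> plane -> C;
  H1_dx : plane -> C;
  H1_dy : plane -> C;
  H1_trace : plane -> C;
  _ : in_L2 H1_fun;
  _ : in_L2 H1_dx;
  _ : in_L2 H1_dy;
  _ : weak_partial dir_x H1_fun H1_dx;
  _ : weak_partial dir_y H1_fun H1_dy;
  _ : boundary_in_L2 H1_trace;
  _ : is_trace H1_fun H1_dx H1_dy H1_trace
}.

Definition robin_form (sigma : R) (u v : sobolevH1) : C :=
  L2dot (H1_dx u) (H1_dx v) + L2dot (H1_dy u) (H1_dy v) +
  (sigma%:C)%C *
    boundary_integralC (fun x => H1_trace u x * (H1_trace v x)^*%C).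

(* The graph of the self-adjoint operator associated with the form: u is in the
   domain and is mapped to f. *)
Definition robin_laplacian (sigma : R) u f : Prop :=
  in_L2 f /\
  exists2 U : sobolevH1, H1_fun U = u &
    forall V : sobolevH1, robin_form sigma U V = L2dot f V.

Definition robin_kernel (sigma Lambda : R) u : Prop :=
  robin_laplacian sigma u (fun x => (Lambda%:C)%C * u x).

Definition robin_eigenvalue (sigma Lambda : R) : Prop :=
  exists2 u, robin_kernel sigma Lambda u & L2sq unit_square u != 0%E.

(* Lambda is in the resolvent set: the operator minus Lambda is injective, onto
   L^2(S), with bounded inverse. *)
Definition robin_resolvent_set (sigma : R) : set R := [set Lambda |
  (forall u, robin_kernel sigma Lambda u -> L2sq unit_square u = 0%E) /\
  exists M : R, forall f, in_L2 f ->
    exists2 u, robin_laplacian sigma u (fun x => (Lambda%:C)%C * u x + f x) &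
      (L2sq unit_square u <= M%:E * L2sq unit_square f)%E].

(* The operator is self-adjoint, so only real points need to be considered. *)
Definition robin_spectrum (sigma : R) : set R := ~` robin_resolvent_set sigma.

Definition K_square (sigma : R) : \bar R :=
  ereal_sup [set kappa_square sigma Lambda | Lambda in robin_spectrum sigma].

End functions_on_the_square.

(* Main.v *)
Require Import Defs.
From HB Require Import structures.
From mathcomp Require Import all_boot all_order all_algebra.
From mathcomp Require Import finmap complex ring lra zify.
From mathcomp Require Import all_classical all_reals all_analysis measurable_realfun.

Import Order.TTheory GRing.Theory Num.Theory.
Import numFieldNormedType.Exports.

Local Open Scope classical_set_scope.
Local Open Scope ring_scope.

(* The modes are cos (k_n x) + (sigma / k_n) sin (k_n x), where k_n is the root
   of h(k) = n pi for the phase h(k) = k - 2 atan (sigma / k).  On the one hand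
   0 <= k_n^2 - (n pi)^2 <= 4 sigma, so the pairs with k_n^2 + k_m^2 = Lambda have
   n^2 + m^2 in a window of length independent of Lambda; on the other hand h^2 is
   a strictly convex function of k^2, so two such pairs cannot have the same
   n^2 + m^2.  This bounds the multiplicities.

   Testing the eigenvalue equation against products of modes, which are complete,
   shows that an eigenfunction is a combination of boundedly many products, with
   coefficients a_m and distinct factors phi_m in the second variable.  The
   frequencies k_m and - k_m are uniformly separated, and for exponential sums
   with boundedly many separated frequencies the integral of the squared modulus
   over any set of measure at least delta controls the coefficients.  This is
   applied on the sections of a Borel subset of V, and then in the first
   variable. *)

(** For sigma = 0 the multiplicities count representations of an integer as n^2 + m^2, and these are
    unbounded. A window for n^2 + m^2 is therefore worth nothing by itself: it is the strict
    convexity, an effect of sigma > 0, that makes n^2 + m^2 injective on the pairs of one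
    eigenvalue. Positivity of sigma also gives k_0 > 0, hence a gap between k_m and - k_m.

    The lower bound on V must not depend on Lambda. The constant for exponential sums depends only
    on the number of frequencies, their gap and the measure of the set. The number is uniform by the
    multiplicity bound, the gap because the phase is Lipschitz, and the measure is fixed by V.

    Lambda and m determine k_n, so an eigenfunction can be indexed by its second factors alone. On a
    section its coefficients are a_m times the value of the first factor, and the squares of these
    values are then integrated one mode at a time. *)

(** * Derivatives and monotonicity in one variable *)

Section one_variable_calculus.
Context {R : realType}.
Implicit Types (f g F G : R -> R) (x y a b : R).

Lemma is_derive_fcst a x : is_derive x 1 (fun=> a) 0.
Proof. exact: is_derive_cst. Qed.

Lemma is_derive_fid x : is_derive x 1 (fun y => y) 1.
Proof. exact: is_derive_id. Qed.

Lemma is_derive_fadd f g x a b : is_derive x 1 f a -> is_derive x 1 g b ->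
  is_derive x 1 (fun y => f y + g y) (a + b).
Proof. by move=> fa gb; exact: is_deriveD. Qed.

Lemma is_derive_fopp f x a : is_derive x 1 f a ->
  is_derive x 1 (fun y => - f y) (- a).
Proof. by move=> fa; exact: is_deriveN. Qed.

Lemma is_derive_fmul f g x a b : is_derive x 1 f a -> is_derive x 1 g b ->
  is_derive x 1 (fun y => f y * g y) (a * g x + f x * b).
Proof.
move=> fa gb; have := is_deriveM fa gb.
by move=> h; apply: (is_derive_eq h); rewrite /GRing.scale/= addrC mulrC.
Qed.

Lemma is_derive_fexp2 f x a : is_derive x 1 f a ->
  is_derive x 1 (fun y => f y ^+ 2) (2 * f x * a).
Proof.
move=> fa; rewrite (_ : (fun y => f y ^+ 2) = (fun y => f y * f y)); last first.
  by apply/funext => y; rewrite expr2.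
by apply: (is_derive_eq (is_derive_fmul _ _ _ _ _ fa fa)); ring.
Qed.

Lemma is_derive_fcomp f g x a b : is_derive (g x) 1 f a -> is_derive x 1 g b ->
  is_derive x 1 (fun y => f (g y)) (b * a).
Proof. by move=> fa gb; apply: (is_derive_eq (is_derive1_comp fa gb)); rewrite mulrC. Qed.

Lemma is_derive_fcos g x b : is_derive x 1 g b ->
  is_derive x 1 (fun y => cos (g y)) (- (b * sin (g x))).
Proof.
move=> gb; apply: (is_derive_eq (is_derive_fcomp _ _ _ _ _ (is_derive_cos _) gb)).
by rewrite mulrN.
Qed.

Lemma is_derive_fsin g x b : is_derive x 1 g b ->
  is_derive x 1 (fun y => sin (g y)) (b * cos (g x)).
Proof. by move=> gb; exact: (is_derive_fcomp _ _ _ _ _ (is_derive_sin _) gb). Qed.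

Lemma is_derive_continuous f x a : is_derive x 1 f a -> {for x, continuous f}.
Proof.
by move=> fa; apply: differentiable_continuous; apply/derivable1_diffP; exact: ex_derive.
Qed.

Lemma is_derive_within_continuous f g a b :
  (forall x, is_derive x 1 f (g x)) -> {within `[a, b], continuous f}.
Proof. by move=> fg; apply: continuous_subspaceT => x; exact: is_derive_continuous (fg x). Qed.

Lemma is_derive_nondecreasing f g a b :
  (forall x, x \in `]a, b[ -> is_derive x 1 f (g x)) ->
  {within `[a, b], continuous f} ->
  (forall x, x \in `]a, b[ -> 0 <= g x) ->
  a <= b -> f a <= f b.
Proof.
move=> fg cf g0 ab.
apply: (@ger0_derive1_le_cc _ f a b) => //.
- by move=> x xab; have ? := fg _ xab; exact: ex_derive.
- by move=> x xab; have ? := fg _ xab; rewrite derive1E derive_val; exact: g0.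
- by rewrite in_itv/= lexx.
- by rewrite in_itv/= lexx andbT.
Qed.

Lemma is_derive_eq0_constant f g a b :
  (forall x, x \in `]a, b[ -> is_derive x 1 f (g x)) ->
  {within `[a, b], continuous f} ->
  (forall x, x \in `]a, b[ -> g x = 0) ->
  a <= b -> f a = f b.
Proof.
move=> fg cf g0 ab; apply/eqP; rewrite eq_le; apply/andP; split.
  by apply: is_derive_nondecreasing fg _ _ ab => // x /g0 ->.
rewrite -lerN2.
apply: (@is_derive_nondecreasing (fun x => - f x) (fun x => - g x) a b) => //.
- by move=> x /fg ?; exact: is_derive_fopp.
- by move=> x; apply: cvgN; exact: cf.
- by move=> x /g0 ->; rewrite oppr0.
Qed.

End one_variable_calculus.

(* Type class resolution is switched off: the instances of the library would
   close the subgoals with derivatives in an uncontrolled form. *)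
Ltac dstep :=
  first [ eassumption
        | match goal with
          | |- is_derive _ _ (fun=> ?a) _ => notypeclasses refine (is_derive_fcst _ _)
          | |- is_derive _ _ (fun y => y) _ => notypeclasses refine (is_derive_fid _)
          | |- is_derive ?x ?v ( *%R ?a) ?d => change (is_derive x v (fun y => a * y) d)
          | |- is_derive ?x ?v ( +%R ?a) ?d => change (is_derive x v (fun y => a + y) d)
          | |- is_derive _ _ (fun y => _ + _) _ => notypeclasses refine (is_derive_fadd _ _ _ _ _ _ _)
          | |- is_derive _ _ (fun y => - _) _ => notypeclasses refine (is_derive_fopp _ _ _ _)
          | |- is_derive _ _ (fun y => _ * _) _ => notypeclasses refine (is_derive_fmul _ _ _ _ _ _ _)
          | |- is_derive _ _ (fun y => _ ^+ 2) _ => notypeclasses refine (is_derive_fexp2 _ _ _ _)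
          | |- is_derive _ _ (fun y => cos _) _ => notypeclasses refine (is_derive_fcos _ _ _ _)
          | |- is_derive _ _ (fun y => sin _) _ => notypeclasses refine (is_derive_fsin _ _ _ _)
          | H : forall x, is_derive x 1 ?f _ |- is_derive _ _ ?f _ => notypeclasses refine (H _)
          | H : forall x, is_derive x 1 ?f _ |- is_derive _ _ (fun y => ?f y) _ => notypeclasses refine (H _)
          end ].
Ltac dsolve := notypeclasses refine (is_derive_eq _ _); [ repeat dstep | rewrite ?/id /= ].

(** * Primitives and integrals over the unit interval *)

Section integral_on_unit_interval.
Context {R : realType}.
Implicit Types (f g F G : R -> R) (x y a b : R).
Local Notation mu := (@lebesgue_measure R).

Definition int01 f : R := \int[mu]_(x in `[0, 1]) f x.

Lemma continuous_integrable_itv f a b : continuous f ->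
  mu.-integrable `[a, b] (EFin \o f).
Proof.
move=> cf; apply: continuous_compact_integrable; first exact: segment_compact.
exact: continuous_subspaceT.
Qed.

(** An integral over []0, x]] vanishes for negative x, so the primitive subtracts the integral over
    []x, 0]] and is then differentiable on the whole line. Near a given x both integrals are
    rewritten with a base point to the left of x and 0, where the fundamental theorem of calculus
    applies. *)
Lemma primitive_exists f : continuous f ->
  exists F, forall x, is_derive x 1 F (f x).
Proof.
move=> cf; pose G a x := \int[mu]_(t in `[a, x]) f t.
pose F x := \int[mu]_(t in `]0, x]) f t - \int[mu]_(t in `]x, 0]) f t.
have FE a x : a <= x -> a <= 0 -> F x = G a x - G a 0.
  move=> ax a0; rewrite /F /G.
  have [x0|x0] := leP 0 x.
    rewrite -(@Rintegral_itvB _ f (BLeft a) (BRight x) 0)//; last first.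
      exact: continuous_integrable_itv.
    by rewrite [X in _ - X](_ : _ = 0) ?subr0// set_itv_ge ?Rintegral_set0// bnd_simp ltNge x0.
  rewrite [X in X - _](_ : _ = 0); last first.
    by rewrite set_itv_ge ?Rintegral_set0// bnd_simp ltNge (ltW x0).
  rewrite sub0r -(@Rintegral_itvB _ f (BLeft a) (BRight 0) x)//; last 2 first.
      exact: continuous_integrable_itv.
    by rewrite bnd_simp ltW.
  by rewrite opprB.
exists F => x.
pose a := Num.min x 0 - 1.
have ax : a < x by rewrite /a ltrBlDr (le_lt_trans (_ : _ <= x)) ?ge_min ?lexx// ltrDl.
have a0 : a <= 0 by rewrite /a ltW// ltrBlDr (le_lt_trans (_ : _ <= 0)) ?ge_min ?lexx ?orbT// ltrDl.
have [dG G'] : derivable (G a) x 1 /\ derive1 (G a) x = f x.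
  apply: (@continuous_FTC1_closed _ f a x (x + 1)) => //; first by rewrite ltrDl.
    exact: continuous_integrable_itv.
  exact: cf.
have Gx : is_derive x 1 (fun y => G a y - G a 0) (f x).
  have GE : 'D_1 (G a) x = f x by rewrite -derive1E.
  have ? := DeriveDef dG GE.
  by dsolve; rewrite addr0.
apply: near_eq_is_derive Gx; near=> y; rewrite (FE a)//; near: y.
exact: lt_le_nbhsr.
Unshelve. all: by end_near. Qed.

Implicit Types h : R -> R.

Lemma int01_derive f F : continuous f ->
  (forall x, is_derive x 1 F (f x)) -> int01 f = F 1 - F 0.
Proof.
move=> cf Ff; rewrite /int01 /Rintegral.
have cF : continuous F by move=> x; exact: is_derive_continuous (Ff x).
rewrite (@continuous_FTC2 _ f F 0 1)//.
- exact: continuous_subspaceT.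
- split; first by move=> x _; have ? := Ff x; exact: ex_derive.
  + by apply: cvg_at_right_filter; exact: cF.
  + by apply: cvg_at_left_filter; exact: cF.
- by move=> x _; have ? := Ff x; rewrite derive1E derive_val.
Qed.

Lemma int01_add f g : continuous f -> continuous g ->
  int01 (fun x => f x + g x) = int01 f + int01 g.
Proof.
by move=> cf cg; rewrite /int01 RintegralD//; exact: continuous_integrable_itv.
Qed.

Lemma int01_scale a f : continuous f ->
  int01 (fun x => a * f x) = a * int01 f.
Proof.
by move=> cf; rewrite /int01 RintegralZl//; exact: continuous_integrable_itv.
Qed.

Lemma int01_ge0 f : (forall x, 0 <= f x) -> 0 <= int01 f.
Proof. by move=> f0; apply: Rintegral_ge0. Qed.

Lemma eq_int01 f g : (forall x, 0 <= x <= 1 -> f x = g x) -> int01 f = int01 g.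
Proof.
by move=> fg; apply: eq_Rintegral => x; rewrite inE/= in_itv/=; exact: fg.
Qed.

Lemma le_int01 f g : continuous f -> continuous g ->
  (forall x, 0 <= x <= 1 -> f x <= g x) -> int01 f <= int01 g.
Proof.
move=> cf cg fg; apply: le_Rintegral => //; exact: continuous_integrable_itv.
Qed.

Lemma eq0_itvoo_itvcc f : continuous f -> (forall x, 0 < x < 1 -> f x = 0) ->
  forall x, 0 <= x <= 1 -> f x = 0.
Proof.
move=> cf f00.
have cvg0 (F' : set_system R) y : ProperFilter F' -> F' --> y ->
    (\forall z \near F', f z = 0) -> f y = 0.
  move=> PF Fy fz; apply: (@cvg_unique _ (@Rhausdorff R) (f @ F')).
    exact: cvg_trans (cvg_app f Fy) (cf y).
  apply: (@cvg_trans _ ((fun=> 0) @ F')); last exact: cvg_cst.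
  by apply: near_eq_cvg; apply: filterS fz => z ->.
move=> x /andP[]; rewrite le_eqVlt => /predU1P[<- _|x0].
  apply: (cvg0 0^'+) => //.
    exact: cvg_within.
  by near=> z; apply: f00; apply/andP; split.
rewrite le_eqVlt => /predU1P[->|x1]; last by apply: f00; rewrite x0.
apply: (cvg0 1^'-) => //.
  exact: cvg_within.
by near=> z; apply: f00; apply/andP; split.
Unshelve. all: by end_near. Qed.

Lemma is_derive_eq0_itv f g a :
  (forall x, is_derive x 1 f (g x)) -> continuous g ->
  (forall x, 0 <= x <= 1 -> f x = a) -> forall x, 0 <= x <= 1 -> g x = 0.
Proof.
move=> fg cg fa; apply: (eq0_itvoo_itvcc _ cg) => x /andP[x0 x1].
have cst : is_derive x 1 (fun=> a) (g x).
  apply: near_eq_is_derive (fg x); near=> y; apply: fa; apply/andP; split; near: y.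
    exact: lt_le_nbhsr.
  exact: lt_le_nbhsl.
by rewrite -(@derive_val _ _ _ _ _ _ _ cst) derive_cst.
Unshelve. all: by end_near. Qed.

(** A primitive of the square is nondecreasing with equal values at 0 and 1, hence constant on the
    interval. *)
Lemma int01_sqr_eq0 f : continuous f -> int01 (fun x => f x ^+ 2) = 0 ->
  forall x, 0 <= x <= 1 -> f x = 0.
Proof.
move=> cf f0 x x01.
have cf2 : continuous (fun x => f x ^+ 2).
  by move=> y; apply: (@continuous_comp _ _ _ f (fun y => y ^+ 2)); [exact: cf|exact: exprn_continuous].
have [F Ff] := primitive_exists _ cf2.
have F10 : F 1 = F 0 by apply/eqP; rewrite -subr_eq0 -(int01_derive _ _ cf2 Ff) f0.
have Fle y z : y <= z -> F y <= F z.
  apply: (@is_derive_nondecreasing _ F (fun x => f x ^+ 2)) => //.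
    exact: is_derive_within_continuous Ff.
  by move=> ? _; exact: sqr_ge0.
apply/eqP; rewrite -sqrf_eq0; apply/eqP.
apply: (is_derive_eq0_itv _ _ (F 0) Ff cf2 _ x x01) => y /andP[y0 y1].
by apply/eqP; rewrite eq_le -{1}F10 !Fle.
Qed.

(** Cauchy-Schwarz for the increment of F. The majorant g allows trigonometric factors in f to be
    dropped. *)
Lemma sqr_increment_le f F g : continuous g -> (forall x, is_derive x 1 F (f x)) ->
  (forall x, f x ^+ 2 <= g x ^+ 2) ->
  forall x, 0 <= x <= 1 -> (F x - F 0) ^+ 2 <= int01 (fun x => g x ^+ 2).
Proof.
move=> cg Ff fg x /andP[x0 x1].
have cg2 : continuous (fun x => g x ^+ 2).
  by move=> y; apply: (@continuous_comp _ _ _ g (fun y => y ^+ 2)); [exact: cg|exact: exprn_continuous].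
have [G Gg] := primitive_exists _ cg2.
rewrite (int01_derive _ _ cg2 Gg).
have Gle y z : y <= z -> G y <= G z.
  apply: (@is_derive_nondecreasing _ G (fun x => g x ^+ 2)) => //.
    exact: is_derive_within_continuous Gg.
  by move=> ? _; exact: sqr_ge0.
(* The function [e ^+ 2 * y + G y - 2 * e * s * F y] has derivative at least [(e - s * f y) ^+ 2].
   The inequality is later used with e the modulus and s the sign of the increment. *)
have key (s e : R) : s ^+ 2 = 1 -> 0 < e ->
    2 * e * (s * (F x - F 0)) <= e ^+ 2 * x + (G x - G 0).
  move=> s1 e0.
  have Hd y : is_derive y 1 (fun y => e ^+ 2 * y + G y - 2 * e * s * F y)
      (e ^+ 2 + g y ^+ 2 - 2 * e * s * f y) by dsolve; ring.
  have := @is_derive_nondecreasing _ _ _ 0 x (fun y _ => Hd y)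
    (is_derive_within_continuous _ _ _ _ Hd) _ x0.
  have H1 : forall y, y \in `]0, x[%R -> 0 <= e ^+ 2 + g y ^+ 2 - 2 * e * s * f y.
    move=> y _; have := fg y; have := sqr_ge0 (e - s * f y).
    rewrite sqrrB exprMn s1 mul1r; nra.
  move=> /(_ H1); nra.
have G10 : G x - G 0 <= G 1 - G 0 by rewrite lerD2r Gle.
have [->|d0] := eqVneq (F x - F 0) 0.
  by rewrite expr0n subr_ge0 Gle.
have [d1|d1] := leP 0 (F x - F 0).
  have := key 1 (F x - F 0) (expr1n _ _); rewrite lt_def d0 d1 => /(_ isT).
  by have := sqr_ge0 (F x - F 0); nra.
have := key (-1) (- (F x - F 0)); rewrite sqrrN expr1n oppr_gt0 d1 => /(_ erefl isT).
have := sqr_ge0 (F x - F 0); rewrite sqrrN; nra.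
Qed.

End integral_on_unit_interval.

(** * Closure properties of continuous functions *)

Section continuity.
Context {R : realType}.
Implicit Types f g : R -> R.

Lemma continuous_fcst (a : R) : continuous (fun _ : R => a).
Proof. by move=> x; exact: cvg_cst. Qed.

Lemma continuous_fid : continuous (fun x : R => x).
Proof. by move=> x; exact: cvg_id. Qed.

Lemma continuous_fadd f g : continuous f -> continuous g ->
  continuous (fun x => f x + g x).
Proof. by move=> cf cg x; exact: cvgD (cf x) (cg x). Qed.

Lemma continuous_fopp f : continuous f -> continuous (fun x => - f x).
Proof. by move=> cf x; exact: cvgN (cf x). Qed.

Lemma continuous_fmul f g : continuous f -> continuous g ->
  continuous (fun x => f x * g x).
Proof. by move=> cf cg x; exact: cvgM (cf x) (cg x). Qed.

Lemma continuous_fexp f n : continuous f -> continuous (fun x => f x ^+ n).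
Proof.
move=> cf x; apply: (@continuous_comp _ _ _ f (fun y => y ^+ n)); first exact: cf.
exact: exprn_continuous.
Qed.

Lemma continuous_fcos f : continuous f -> continuous (fun x => cos (f x)).
Proof.
move=> cf x; apply: (@continuous_comp _ _ _ f cos); first exact: cf.
exact: continuous_cos.
Qed.

Lemma continuous_fsin f : continuous f -> continuous (fun x => sin (f x)).
Proof.
move=> cf x; apply: (@continuous_comp _ _ _ f sin); first exact: cf.
exact: continuous_sin.
Qed.

Lemma is_derive_fcontinuous f g : (forall x : R, is_derive x 1 f (g x)) -> continuous f.
Proof. by move=> fg x; exact: is_derive_continuous (fg x). Qed.

End continuity.

Ltac csolve := repeat first [ eassumption
        | match goal with
          | |- continuous (fun=> ?a) => exact: continuous_fcst
          | |- continuous (fun y => y) => exact: continuous_fid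
          | |- continuous ( *%R ?a) => change (continuous (fun y => a * y))
          | |- continuous ( +%R ?a) => change (continuous (fun y => a + y))
          | |- continuous (fun y => _ + _) => apply: continuous_fadd
          | |- continuous (fun y => - _) => apply: continuous_fopp
          | |- continuous (fun y => _ * _) => apply: continuous_fmul
          | |- continuous (fun y => _ ^+ _) => apply: continuous_fexp
          | |- continuous (fun y => cos _) => apply: continuous_fcos
          | |- continuous (fun y => sin _) => apply: continuous_fsin
          | H : forall x, is_derive x 1 ?f _ |- continuous ?f => exact: (is_derive_fcontinuous _ _ H)
          | H : forall x, is_derive x 1 ?f _ |- continuous (fun y => ?f y) => exact: (is_derive_fcontinuous _ _ H)
          end ].

(** * Translation invariance of Lebesgue measure *)

Section translation.
Context {R : realType}.
Local Notation mu := (@lebesgue_measure R).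

Definition translate (h : R) : measurableTypeR R -> measurableTypeR R := fun x => x + h.

Lemma measurable_translate h : measurable_fun setT (translate h).
Proof. by apply: continuous_measurable_fun; rewrite /translate; csolve. Qed.

Lemma measurable_preimage_translate h (A : set R) : measurable A ->
  measurable (translate h @^-1` A : set R).
Proof. by move=> mA; rewrite -[X in measurable X]setTI; exact: measurable_translate. Qed.

(** The pushforward by a translation agrees with Lebesgue measure on half-open intervals, which
    determine it. *)
Lemma lebesgue_measure_translate h (A : set R) : measurable A ->
  mu (translate h @^-1` A) = mu A.
Proof.
move=> mA; have mh := measurable_translate h.
pose mh_mixin := isMeasurableFun.Build _ _ _ _ _ mh.
apply/esym; rewrite -/(pushforward mu (translate h) A).
apply: lebesgue_measure_unique => //= _ [[a b]] _ <-.
rewrite /pushforward.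
have -> : translate h @^-1` `]a, b]%classic = `]a - h, b - h]%classic.
  by apply/seteqP; split => x /=; rewrite /translate !in_itv/= ltrBlDr lerBrDr.
rewrite /= !lebesgue_measure_itv/= !lte_fin ltrD2r; congr (if _ then _ else _).
by rewrite -!EFinB; congr (_%:E); ring.
Qed.

Lemma ge0_integral_translate h (A : set R) (f : R -> \bar R) : measurable A ->
  measurable_fun A f -> (forall x, A x -> (0 <= f x)%E) ->
  (\int[mu]_(x in translate h @^-1` A) f (translate h x) = \int[mu]_(x in A) f x)%E.
Proof.
move=> mA mf f0; rewrite -(ge0_integral_pushforward (measurable_translate h))//; last first.
  by move=> x; rewrite inE => /f0.
apply: eq_measure_integral; first exact: measurable_translate.
by move=> mh B mB _; exact: lebesgue_measure_translate.
Qed.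

End translation.

(** * Sets that overlap their translates *)

Section overlap.
Context {R : realType}.
Local Notation mu := (@lebesgue_measure R).

Lemma lee_half_of_lee_add (d : R) (y : \bar R) :
  (d%:E <= (d / 2)%:E + y)%E -> ((d / 2)%:E <= y)%E.
Proof.
case: y => [r||].
- by rewrite -EFinD !lee_fin; lra.
- by move=> _; exact: leey.
- by rewrite addeNy leeNy_eq.
Qed.

(* The translates of E by the multiples of a step much smaller than the period
   of the exponential, but which sweep about half of it, all lie in a bounded
   interval, so two of them overlap. *)
Lemma translate_overlap (delta gam : R) : 0 < delta -> 0 < gam ->
  exists2 delta' : R, 0 < delta' & exists2 eps : R, 0 < eps &
  forall E : set R, measurable E -> E `<=` `[0, 1] -> (delta%:E <= mu E)%E ->
  forall xi : R, gam <= `|xi| -> exists2 h : R,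
    eps <= 2 - 2 * cos (xi * h) &
    (delta'%:E <= mu (E `&` translate h @^-1` E))%E.
Proof.
move=> d0 g0.
pose L := 1 + pi / gam.
have L0 : 0 < L by rewrite addr_gt0// divr_gt0// pi_gt0.
(* Chosen so that [J.+1] translates, each adding at least [delta / 2] to the union, do not fit into
   an interval of length [L]. *)
pose J := Num.bound (2 * L / delta).
have J0 : 0 <= J%:R :> R by [].
have J1 : 0 < J.+1%:R :> R by [].
have LJ : L < J.+1%:R * (delta / 2).
  have : 2 * L / delta < J%:R by apply: archi_boundP; rewrite divr_ge0 ?mulr_ge0// ltW.
  rewrite ltr_pdivrMr// -(natr1 J) => h1.
  by nra.
pose delta' := delta / 2 / J.+1%:R.
have d'0 : 0 < delta' by rewrite divr_gt0// divr_gt0.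
pose eps := 2 - 2 * cos (pi / J.+2%:R : R).
have pJ : 0 < (pi : R) / J.+2%:R by rewrite divr_gt0// pi_gt0.
have pJpi : (pi : R) / J.+2%:R <= pi by rewrite ler_pdivrMr// ler_peMr ?pi_ge0// ler1n.
have eps0 : 0 < eps.
  rewrite /eps subr_gt0 -[ltRHS]mulr1 ltr_pM2l// -[ltRHS]cos0 ltr_cos ?in_itv/= ?lexx ?pi_ge0//.
  by rewrite (ltW pJ).
exists delta' => //; exists eps => // E mE E01 dE xi gxi; apply: contrapT => noh.
have xi0 : 0 < `|xi| by exact: lt_le_trans gxi.
(* For 1 <= j <= J the angle |xi| j s = j pi / (J + 2) lies between pi / (J + 2) and pi, where cos
   decreases; so one [eps] serves all j and all xi. *)
pose s := pi / (`|xi| * J.+2%:R).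
have s0 : 0 < s by rewrite divr_gt0 ?pi_gt0// mulr_gt0.
have small j : (0 < j <= J)%N -> (mu (E `&` translate (j%:R * s) @^-1` E) <= delta'%:E)%E.
  move=> /andP[j0 jJ]; rewrite leNgt; apply/negP => hj; apply: noh.
  exists (j%:R * s); last exact: ltW.
  rewrite /eps lerD2l lerN2 ler_pM2l//.
  have -> : cos (xi * (j%:R * s)) = cos (j%:R * (pi / J.+2%:R)).
    rewrite -[LHS]cos_norm normrM (ger0_norm (_ : 0 <= j%:R * s)); last first.
      by rewrite mulr_ge0// ltW.
    by congr cos; rewrite /s; field; rewrite gt_eqF//= gt_eqF.
  have j1 : pi / J.+2%:R <= j%:R * ((pi : R) / J.+2%:R).
    by rewrite ler_peMl ?(ltW pJ)// ler1n.
  have j2 : j%:R * ((pi : R) / J.+2%:R) <= pi.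
    rewrite mulrA mulrAC -[leRHS]mul1r ler_pM2r ?pi_gt0// ler_pdivrMr// mul1r ler_nat.
    by rewrite (leq_trans jJ)// (leq_trans (leqnSn _)).
  have j3 := le_trans (ltW pJ) j1.
  by case: ltgtP j1 => // [lt _|<- //]; apply/ltW;
    rewrite ltr_cos// in_itv/= ?j2 ?j3 ?pJpi ?(ltW pJ).
pose F j := translate (j%:R * s) @^-1` E : set R.
have mF j : measurable (F j) by exact: measurable_preimage_translate.
have muF j : (delta%:E <= mu (F j))%E by rewrite lebesgue_measure_translate.
have muFF i j : (i < j <= J)%N -> (mu (F j `&` F i) <= delta'%:E)%E.
  move=> /andP[ij jJ].
  have -> : F j `&` F i = translate (i%:R * s) @^-1` (E `&` translate ((j - i)%:R * s) @^-1` E).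
    have eqx (x : R) : x + i%:R * s + (j - i)%:R * s = x + j%:R * s.
      by rewrite natrB ?(ltnW ij)//; ring.
    apply/seteqP; split => x [] /=; rewrite /F/= /translate/= ?eqx.
      by move=> Fj Fi; split => //=; rewrite eqx.
    by move=> Fi ?; split.
  rewrite lebesgue_measure_translate; first by apply: small; rewrite subn_gt0 ij (leq_trans (leq_subr _ _)).
  by apply: measurableI => //; exact: measurable_preimage_translate.
pose U n := \big[setU/set0]_(j < n) F j.
have mU n : measurable (U n) by apply: bigsetU_measurable.
have inter n k : (k <= n <= J)%N -> (mu (F n `&` U k) <= (k%:R * delta')%:E)%E.
  elim: k => [|k IH] /andP[kn nJ].
    by rewrite /U big_ord0 setI0 measure0 mul0r.
  rewrite /U big_ord_recr/= setIUr -(natr1 k) mulrDl mul1r EFinD.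
  apply: (@le_trans _ _ (mu (F n `&` U k) + mu (F n `&` F k))%E).
    by apply: measureU2; [exact: (measurableI _ _ (mF n) (mU k))|exact: (measurableI _ _ (mF n) (mF k))].
  by apply: leeD; [apply: IH; rewrite (ltnW kn)|apply: muFF; rewrite kn].
(* The earlier translates, at most J in number, cover at most J delta' <= delta / 2 of the next one,
   so at least delta / 2 of it is new. *)
have grow n : (n <= J.+1)%N -> ((n%:R * (delta / 2))%:E <= mu (U n))%E.
  elim: n => [|n IH] nJ; first by rewrite mul0r.
  have -> : U n.+1 = U n `|` (F n `\` U n).
    rewrite /U big_ord_recr/= -/(U n); apply/seteqP; split => x [Ux|Fx]; try by left.
      by have [?|?] := pselect (U n x); [left|right].
    by right; case: Fx.
  rewrite measureU ?setDIK//; [|exact: mU|exact: (measurableD (mF n) (mU n))].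
  rewrite -(natr1 n) mulrDl mul1r EFinD; apply: leeD; first by rewrite IH// ltnW.
  have h1 : (mu (F n `&` U n) <= (delta / 2)%:E)%E.
    apply: (le_trans (inter n n _)); first by rewrite leqnn.
    rewrite lee_fin /delta' mulrCA ler_piMr ?divr_ge0 ?(ltW d0)//.
    by rewrite ler_pdivrMr// mul1r ler_nat ltnW.
  have := muF n; rewrite -[X in mu X](setDUK (@subIsetl _ (F n) (U n))).
  have mFU : measurable (F n `&` U n : set R) by exact: (measurableI _ _ (mF n) (mU n)).
  rewrite measureU ?setDIK//; last exact: (measurableD (mF n) mFU).
  rewrite setDIr setDv set0U => h2.
  have : (delta%:E <= (delta / 2)%:E + mu (F n `\` U n))%E.
    by apply: (le_trans h2); exact: leeD2r.
  exact: lee_half_of_lee_add.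
have UL : U J.+1 `<=` `[- (pi / gam), 1].
  rewrite /U -bigcup_mkord; apply: bigcup_sub => j /= jJ x Fx.
  have : 0 <= x + j%:R * s <= 1 by have := E01 _ Fx; rewrite /= in_itv.
  have js0 : 0 <= j%:R * s by rewrite mulr_ge0// ltW.
  have js : j%:R * s <= pi / gam.
    apply: (@le_trans _ _ (pi / `|xi|)); last first.
      by rewrite ler_pM2l ?pi_gt0// lef_pV2.
    have -> : j%:R * s = pi / `|xi| * (j%:R / J.+2%:R).
      by rewrite /s; field; rewrite gt_eqF//= gt_eqF.
    rewrite ler_piMr ?divr_ge0 ?pi_ge0//.
    by rewrite ler_pdivrMr// mul1r ler_nat; exact: leq_trans (ltnW jJ) (leqnSn _).
  move=> /andP[h1 h2]; rewrite /= in_itv/=; apply/andP; split.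
    by rewrite lerNl (le_trans _ js)// lerNl; move: h1; rewrite addrC -lerBlDl sub0r.
  by rewrite (le_trans _ h2)// lerDl.
pose B : set R := `[- (pi / gam), 1]%classic.
have h1 : (mu (U J.+1) <= mu B)%E.
  apply: le_measure; rewrite ?inE; [exact: mU|exact: measurable_itv|exact: UL].
move: h1; rewrite /B lebesgue_measure_itv/= lte_fin => h1.
have h2 := le_trans (grow _ (leqnn _)) h1.
have : J.+1%:R * (delta / 2) <= L.
  rewrite -lee_fin (le_trans h2)// -EFinB opprK; case: ifP => // _.
  by rewrite lee_fin ltW.
by rewrite leNgt LJ.
Qed.

End overlap.

(** * A lower bound for exponential sums with separated frequencies *)

Section trigonometric_sums.
Context {R : realType}.
Local Notation C := R[i].
Local Notation mu := (@lebesgue_measure R).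
Implicit Types (z w : C) (t h x : R) (s : seq (R * C)).

Definition cexp t : C := Complex (cos t) (sin t).

Lemma ReD z w : complex.Re (z + w) = complex.Re z + complex.Re w.
Proof. by case: z; case: w. Qed.

Lemma ImD z w : complex.Im (z + w) = complex.Im z + complex.Im w.
Proof. by case: z; case: w. Qed.

Lemma ReM z w : complex.Re (z * w) =
  complex.Re z * complex.Re w - complex.Im z * complex.Im w.
Proof. by case: z; case: w. Qed.

Lemma ImM z w : complex.Im (z * w) =
  complex.Re z * complex.Im w + complex.Im z * complex.Re w.
Proof. by case: z => a b; case: w => c d. Qed.

Lemma cexpD t h : cexp (t + h) = cexp t * cexp h.
Proof.
apply/eqP; rewrite eq_complex ReM ImM /= cosD sinD eqxx/=; apply/eqP; ring.
Qed.

Lemma sqnorm_ge0 z : 0 <= sqnorm z.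
Proof. by rewrite addr_ge0 ?sqr_ge0. Qed.

Lemma sqnormM z w : sqnorm (z * w) = sqnorm z * sqnorm w.
Proof. by rewrite /sqnorm ReM ImM; ring. Qed.

Lemma sqnorm_cexp t : sqnorm (cexp t) = 1.
Proof. exact: cos2Dsin2. Qed.

Lemma sqnormD_le z w : sqnorm (z + w) <= 2 * sqnorm z + 2 * sqnorm w.
Proof.
rewrite /sqnorm ReD ImD.
have := sqr_ge0 (complex.Re z - complex.Re w).
have := sqr_ge0 (complex.Im z - complex.Im w).
by move=> h1 h2; nra.
Qed.

Lemma sqnormN z : sqnorm (- z) = sqnorm z.
Proof. by case: z => a b; rewrite /sqnorm /= !sqrrN. Qed.

Lemma sqnorm0 : sqnorm (0 : C) = 0.
Proof. by rewrite /sqnorm /= expr0n addr0. Qed.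

Lemma sqnorm_cexpB t h : sqnorm (cexp t - cexp h) = 2 - 2 * cos (t - h).
Proof.
rewrite /sqnorm /cexp /= cosB.
have := cos2Dsin2 t; have := cos2Dsin2 h; nra.
Qed.

Definition trig_sum s x : C := \sum_(q <- s) q.2 * cexp (q.1 * x).

Definition sqnorm_coefs s : R := \sum_(q <- s) sqnorm q.2.

Lemma sqnorm_coefs_ge0 s : 0 <= sqnorm_coefs s.
Proof. by apply: sumr_ge0 => q _; exact: sqnorm_ge0. Qed.

Lemma continuous_trig_sum s : continuous (fun x => complex.Re (trig_sum s x)) /\
  continuous (fun x => complex.Im (trig_sum s x)).
Proof.
elim: s => [|q s [IH1 IH2]].
  have -> : trig_sum [::] = fun=> 0 by apply/funext => x; rewrite /trig_sum big_nil.
  by split; exact: continuous_fcst.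
have E x : trig_sum (q :: s) x = q.2 * cexp (q.1 * x) + trig_sum s x.
  by rewrite /trig_sum big_cons.
split.
- rewrite (_ : (fun x => _) = (fun x => complex.Re q.2 * cos (q.1 * x) -
    complex.Im q.2 * sin (q.1 * x) + complex.Re (trig_sum s x))); first by csolve.
  by apply/funext => x; rewrite E ReD ReM.
- rewrite (_ : (fun x => _) = (fun x => complex.Re q.2 * sin (q.1 * x) +
    complex.Im q.2 * cos (q.1 * x) + complex.Im (trig_sum s x))); first by csolve.
  by apply/funext => x; rewrite E ImD ImM.
Qed.

Lemma continuous_sqnorm_trig_sum s : continuous (fun x => sqnorm (trig_sum s x)).
Proof. by have [? ?] := continuous_trig_sum s; rewrite /sqnorm; csolve. Qed.

Lemma continuous_measurable_EFin (f : R -> R) (E : set R) : continuous f ->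
  measurable_fun E (EFin \o f).
Proof.
by move=> cf; apply/measurable_EFinP; apply: measurable_funTS; exact: continuous_measurable_fun.
Qed.

Lemma measurable_sqnorm_trig_sum s (E : set R) :
  measurable_fun E (fun x => (sqnorm (trig_sum s x))%:E).
Proof.
apply/measurable_EFinP; apply: measurable_funTS.
by apply: continuous_measurable_fun; exact: continuous_sqnorm_trig_sum.
Qed.

(** Splitting off one term at a time by [sqnormD_le] costs a factor 2 each. Only the dependence on
    the number of terms matters. *)
Lemma sqnorm_trig_sum_le s x : sqnorm (trig_sum s x) <= 2 ^+ size s * sqnorm_coefs s.
Proof.
elim: s => [|q s IH].
  by rewrite /trig_sum /sqnorm_coefs !big_nil sqnorm0 mulr0.
rewrite /trig_sum /sqnorm_coefs !big_cons -/(trig_sum s x) -/(sqnorm_coefs s).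
apply: (le_trans (sqnormD_le _ _)); rewrite sqnormM sqnorm_cexp mulr1 /= exprS.
have h1 : 1 <= 2 ^+ size s :> R by rewrite exprn_ege1// ler1n.
have := sqnorm_ge0 q.2; have := sqnorm_coefs_ge0 s; nra.
Qed.

Definition shift_coef h l0 (q : R * C) : R * C :=
  (q.1, q.2 * (cexp (q.1 * h) - cexp (l0 * h))).

Lemma trig_sum_shift h q0 s x :
  trig_sum (q0 :: s) (x + h) - cexp (q0.1 * h) * trig_sum (q0 :: s) x =
  trig_sum [seq shift_coef h q0.1 q | q <- s] x.
Proof.
have E (q : R * C) : q.2 * cexp (q.1 * (x + h)) =
    q.2 * cexp (q.1 * h) * cexp (q.1 * x) by rewrite mulrDr cexpD; ring.
rewrite /trig_sum !big_cons E (eq_bigr _ (fun q _ => E q)).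
set S1 := \sum_(j <- s) _; set S2 := \sum_(j <- s) _.
transitivity (S1 - cexp (q0.1 * h) * S2); first by ring.
rewrite mulr_sumr -sumrB big_map; apply: eq_bigr => q _ /=; ring.
Qed.

Definition gapped (gam : R) s :=
  pairwise (fun q q' : R * C => gam <= `|q.1 - q'.1|) s.

(* A Turan-type inequality.  Replacing p by p(x + h) - e(l0 h) p(x) removes the
   frequency l0 and multiplies the coefficient of l by e(l h) - e(l0 h); for
   each l the step h is chosen so that this factor is not small. *)
Lemma turan (gam : R) (N : nat) : 0 < gam -> forall delta : R, 0 < delta ->
  exists2 c : R, 0 < c & forall E : set R, measurable E -> E `<=` `[0, 1] ->
  (delta%:E <= mu E)%E -> forall s, (size s <= N)%N -> gapped gam s ->
  ((c * sqnorm_coefs s)%:E <= \int[mu]_(x in E) (sqnorm (trig_sum s x))%:E)%E.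
Proof.
move=> g0; elim: N => [|N IH] delta d0.
  exists 1 => // E mE E01 dE [|//] _ _.
  rewrite /sqnorm_coefs big_nil mulr0; apply: integral_ge0 => x _.
  by rewrite lee_fin sqnorm_ge0.
have [d' d'0 [eps eps0 overlap]] := translate_overlap _ _ d0 g0.
have [c' c'0 Hc'] := IH _ d'0.
(* Relative to the integral over E, [K] bounds the square of a single coefficient other than the
   first, [A] the sum of at most N of these, and [B] includes the first one. *)
pose K := 4 / (c' * eps).
have K0 : 0 < K by rewrite divr_gt0// mulr_gt0.
pose A := N%:R * K.
have A0 : 0 <= A by rewrite mulr_ge0// ltW.
pose B := (2 + 2 * 2 ^+ N * A) / delta + A.
have B0 : 0 < B.
  apply: ltr_wpDr => //; apply: divr_gt0 => //; apply: ltr_wpDr => //.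
  by apply: mulr_ge0 => //; apply: mulr_ge0 => //; exact: exprn_ge0.
exists B^-1; first by rewrite invr_gt0.
move=> E mE E01 dE [|q0 s] /= sN sep.
  rewrite /sqnorm_coefs big_nil mulr0; apply: integral_ge0 => x _.
  by rewrite lee_fin sqnorm_ge0.
have [seps sep0] : gapped gam s /\ forall q, q \in s -> gam <= `|q0.1 - q.1|.
  by move: sep; rewrite /gapped/= => /andP[/allP].
set p := trig_sum (q0 :: s).
pose I := (\int[mu]_(x in E) (sqnorm (p x))%:E)%E.
have I0 : (0 <= I)%E by apply: integral_ge0 => x _; rewrite lee_fin sqnorm_ge0.
rewrite -/I; case E_I : I => [r||]; last 2 first.
- by rewrite leey.
- by move: I0; rewrite E_I.
have r0 : 0 <= r by move: I0; rewrite E_I lee_fin.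
(* The step h is adapted to the single frequency of q. The shifted combination has at most N terms
   with unchanged frequencies, and it is integrated over those points of E that h moves into E, so
   both of its summands are controlled by the integral over E. *)
have each q : q \in s -> sqnorm q.2 <= K * r.
  move=> qs; have [h epsh muh] := overlap E mE E01 dE _ (sep0 q qs).
  pose E' : set R := E `&` translate h @^-1` E.
  have mEh : measurable (translate h @^-1` E : set R) by exact: measurable_preimage_translate.
  have mE' : measurable E' by exact: measurableI.
  have mp (D : set R) : measurable_fun D (fun x => (sqnorm (p x))%:E).
    exact: measurable_sqnorm_trig_sum.
  have cph : continuous (fun x => sqnorm (p (translate h x))).
    move=> x; apply: (@continuous_comp _ _ _ (translate h) (fun y => sqnorm (p y))).
      by move: x; rewrite -/(continuous _) /translate; csolve.
    exact: continuous_sqnorm_trig_sum.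
  have mph (D : set R) : measurable_fun D (fun x => (sqnorm (p (translate h x)))%:E).
    exact: continuous_measurable_EFin.
  have m2p (D : set R) : measurable_fun D (fun x => (2 * sqnorm (p x))%:E).
    apply: continuous_measurable_EFin; apply: continuous_fmul; first exact: continuous_fcst.
    exact: continuous_sqnorm_trig_sum.
  have m2ph (D : set R) : measurable_fun D (fun x => (2 * sqnorm (p (translate h x)))%:E).
    apply: continuous_measurable_EFin; apply: continuous_fmul => //.
    exact: continuous_fcst.
  pose s' := [seq shift_coef h q0.1 q | q <- s].
  have s's : gapped gam s' by rewrite /gapped pairwise_map.
  have := Hc' E' mE' (subset_trans (@subIsetl _ _ _) E01) muh s' _ s's.
  rewrite size_map => /(_ sN) h1.
  have h2 : (\int[mu]_(x in E') (sqnorm (trig_sum s' x))%:E <= (4 * r)%:E)%E.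
    apply: (@le_trans _ _ (\int[mu]_(x in E')
        ((2 * sqnorm (p (translate h x)))%:E + (2 * sqnorm (p x))%:E))%E).
      apply: ge0_le_integral => //.
      - by move=> x _; rewrite lee_fin sqnorm_ge0.
      - exact: measurable_sqnorm_trig_sum.
      - by apply: emeasurable_funD; [exact: m2ph|exact: m2p].
      - move=> x _; rewrite -EFinD lee_fin -trig_sum_shift.
        apply: (le_trans (sqnormD_le _ _)).
        by rewrite sqnormN sqnormM sqnorm_cexp mul1r.
    have ge0p x : (0 <= (sqnorm (p x))%:E)%E by rewrite lee_fin sqnorm_ge0.
    have ge01 (f : R -> C) x : E' x -> (0 <= (sqnorm (f x))%:E)%E.
      by move=> _; rewrite lee_fin sqnorm_ge0.
    have ge02 (f : R -> C) x : E' x -> (0 <= (2 * sqnorm (f x))%:E)%E.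
      by move=> _; rewrite lee_fin mulr_ge0// sqnorm_ge0.
    rewrite (ge0_integralD mu mE' (ge02 (p \o translate h)) (m2ph E') (ge02 p) (m2p E')).
    under eq_integral do rewrite EFinM.
    under [X in (_ + X)%E]eq_integral do rewrite EFinM.
    rewrite (ge0_integralZl mu mE' (mph E') (ge01 (p \o translate h)))//.
    rewrite (ge0_integralZl mu mE' (mp E') (ge01 p))//.
    have le1 : (\int[mu]_(x in E') (sqnorm (p (translate h x)))%:E <= r%:E)%E.
      rewrite -E_I /I -(ge0_integral_translate h E _ mE (mp E) (fun x _ => ge0p x)).
      apply: ge0_subset_integral; [exact: mE'|exact: mEh|exact: mph| |by move=> ? []].
      by move=> ? _; rewrite lee_fin sqnorm_ge0.
    have le2 : (\int[mu]_(x in E') (sqnorm (p x))%:E <= r%:E)%E.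
      rewrite -E_I /I.
      by apply: ge0_subset_integral; [exact: mE'|exact: mE|exact: mp|by []|by move=> ? []].
    have -> : (4 * r)%:E = (2%:E * r%:E + 2%:E * r%:E)%E.
      by rewrite -!EFinM -EFinD; congr (_%:E); ring.
    by apply: leeD; apply: lee_wpmul2l.
  have h3 : eps * sqnorm q.2 <= sqnorm_coefs s'.
    rewrite /sqnorm_coefs big_map (perm_big _ (perm_to_rem qs)) big_cons /=.
    rewrite sqnormM sqnorm_cexpB mulrC.
    have -> : cos (q.1 * h - q0.1 * h) = cos ((q0.1 - q.1) * h).
      by rewrite -cosN; congr cos; ring.
    apply: (@le_trans _ _ (sqnorm q.2 * (2 - 2 * cos ((q0.1 - q.1) * h)))).
      by rewrite ler_wpM2l// sqnorm_ge0.
    by rewrite lerDl; apply: sumr_ge0 => ? _; exact: sqnorm_ge0.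
  have := le_trans h1 h2; rewrite lee_fin => h4.
  rewrite /K mulrAC ler_pdivlMr ?mulr_gt0//.
  by have := sqnorm_ge0 q.2; nra.
have coefs : sqnorm_coefs s <= A * r.
  apply: (@le_trans _ _ (\sum_(q <- s) K * r)).
    by rewrite /sqnorm_coefs big_seq [leRHS]big_seq; exact: ler_sum.
  rewrite big_const_seq count_predT iter_addr addr0 -mulr_natl /A -mulrA.
  by rewrite ler_wpM2r ?ler_nat// mulr_ge0// ltW.
(* The coefficient that every shift removes is recovered as p minus the remaining terms, whose
   coefficients are already bounded. *)
have c0 : delta * sqnorm q0.2 <= 2 * r + 2 * (2 ^+ N * sqnorm_coefs s).
  pose M := 2 * (2 ^+ N * sqnorm_coefs s).
  have M0 : 0 <= M by rewrite !mulr_ge0// ?exprn_ge0// sqnorm_coefs_ge0.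
  rewrite -/M -lee_fin EFinM muleC.
  apply: (@le_trans _ _ ((sqnorm q0.2)%:E * mu E)%E).
    by apply: lee_wpmul2l => //; rewrite lee_fin sqnorm_ge0.
  rewrite -integral_cst//.
  have muE1 : (mu E <= 1)%E.
    pose U01 : set R := `[0, 1]%classic.
    apply: (@le_trans _ _ (mu U01)); first by apply: le_measure; rewrite ?inE; [exact: mE|exact: measurable_itv|exact: E01].
    by rewrite /U01 lebesgue_measure_itv/= lte_fin ltr01 -EFinB subr0.
  apply: (@le_trans _ _ (\int[mu]_(x in E) ((2 * sqnorm (p x))%:E + M%:E))%E).
    apply: ge0_le_integral => //.
    - by move=> x _; rewrite lee_fin sqnorm_ge0.
    - apply: emeasurable_funD => //; apply: continuous_measurable_EFin.
      apply: continuous_fmul; first exact: continuous_fcst.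
      exact: continuous_sqnorm_trig_sum.
    - move=> x _; rewrite -EFinD lee_fin.
      have -> : sqnorm q0.2 = sqnorm (p x + - trig_sum s x).
        have -> : p x + - trig_sum s x = q0.2 * cexp (q0.1 * x).
          by rewrite /p /trig_sum big_cons addrK.
        by rewrite sqnormM sqnorm_cexp mulr1.
      apply: (le_trans (sqnormD_le _ _)); rewrite sqnormN lerD2l ler_wpM2l//.
      apply: (le_trans (sqnorm_trig_sum_le _ _)).
      by rewrite ler_wpM2r ?sqnorm_coefs_ge0// ler_eXn2l// ltr1n.
  have m2p : measurable_fun E (fun x => (2 * sqnorm (p x))%:E).
    apply: continuous_measurable_EFin.
    apply: continuous_fmul; first exact: continuous_fcst.
    exact: continuous_sqnorm_trig_sum.
  have ge01 x : E x -> (0 <= (sqnorm (p x))%:E)%E.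
    by move=> _; rewrite lee_fin sqnorm_ge0.
  have ge02 x : E x -> (0 <= (2 * sqnorm (p x))%:E)%E.
    by move=> _; rewrite lee_fin mulr_ge0// sqnorm_ge0.
  rewrite (ge0_integralD mu mE ge02 m2p (f2 := fun=> M%:E))//.
  under eq_integral do rewrite EFinM.
  rewrite (ge0_integralZl mu mE (measurable_sqnorm_trig_sum _ _) ge01)//.
  rewrite integral_cst// -/I E_I.
  apply: (@le_trans _ _ (2%:E * r%:E + M%:E)%E); last by rewrite -EFinM -EFinD.
  by apply: leeD2l; rewrite -[leRHS]mule1; apply: lee_wpmul2l.
rewrite lee_fin ler_pdivrMl// /sqnorm_coefs big_cons -/(sqnorm_coefs s).
apply: (@le_trans _ _ ((2 + 2 * 2 ^+ N * A) / delta * r + A * r)); last by rewrite -mulrDl.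
apply: lerD => //; rewrite mulrAC ler_pdivlMr// mulrC (le_trans c0)//.
have : 2 ^+ N * sqnorm_coefs s <= 2 ^+ N * (A * r) by rewrite ler_wpM2l ?exprn_ge0.
lra.
Qed.

End trigonometric_sums.

(** * Robin modes on the interval and their completeness among continuous functions *)

Section robin_modes.
Context {R : realType}.
Variable sigma : R.
Hypothesis sigma_gt0 : 0 < sigma.
Implicit Types (f g w v : R -> R) (k x : R).

(** The solution of - f'' = k^2 f with f(0) = 1 and f'(0) = sigma. The Robin condition at 0 holds
    for every k, so that the condition at 1 alone selects the frequencies. *)
Definition mode k x := cos (k * x) + sigma / k * sin (k * x).
Definition dmode k x := sigma * cos (k * x) - k * sin (k * x).

Definition robin_frequency k : Prop := 0 < k /\ dmode k 1 + sigma * mode k 1 = 0.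

Lemma is_derive_mode k x : k != 0 -> is_derive x 1 (mode k) (dmode k x).
Proof. by move=> k0; rewrite /mode /dmode; dsolve; field. Qed.

Lemma is_derive_dmode k x : k != 0 ->
  is_derive x 1 (dmode k) (- (k ^+ 2 * mode k x)).
Proof. by move=> k0; rewrite /mode /dmode; dsolve; field. Qed.

Lemma mode0 k : mode k 0 = 1.
Proof. by rewrite /mode mulr0 cos0 sin0 mulr0 addr0. Qed.

Lemma dmode0 k : dmode k 0 = sigma.
Proof. by rewrite /dmode mulr0 cos0 sin0 mulr0 subr0 mulr1. Qed.

Lemma continuous_mode k : continuous (mode k).
Proof. by rewrite /mode; csolve. Qed.

Lemma continuous_dmode k : continuous (dmode k).
Proof. by rewrite /dmode; csolve. Qed.

Lemma mode_sqr_le k x : mode k x ^+ 2 <= 1 + (sigma / k) ^+ 2.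
Proof.
rewrite /mode; set c := cos _; set s := sin _.
have cs : c ^+ 2 + s ^+ 2 = 1 by exact: cos2Dsin2.
by have := sqr_ge0 (sigma / k * c - s); nra.
Qed.

(* [w] solves [- w'' = f] with Robin boundary conditions, and [v = w']. *)
Definition green f w v : Prop :=
  [/\ forall x, is_derive x 1 w (v x), forall x, is_derive x 1 v (- f x),
      v 0 = sigma * w 0 & v 1 = - (sigma * w 1)].

Lemma green_mode k : robin_frequency k ->
  green (fun x => k ^+ 2 * mode k x) (mode k) (dmode k).
Proof.
move=> [k0 kE]; have kn0 : k != 0 by rewrite gt_eqF.
split => [x|x||].
- exact: is_derive_mode.
- exact: is_derive_dmode.
- by rewrite dmode0 mode0 mulr1.
- by apply/eqP; rewrite -addr_eq0 kE.
Qed.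

(** Integrate f twice and impose the condition at 0. The condition at 1 is then a linear equation
    for [al], the value of w at 0, with coefficient sigma (2 + sigma) > 0. *)
Lemma green_exists f : continuous f -> exists w v, green f w v.
Proof.
move=> cf; have [F HF] := primitive_exists f cf.
have cF : continuous F by csolve.
have [W HW] := primitive_exists F cF.
pose s2 := sigma * (2 + sigma).
have s20 : s2 != 0 by rewrite gt_eqF// mulr_gt0// addr_gt0.
pose al := (F 1 - F 0 + sigma * (W 1 - W 0 - F 0)) / s2.
exists (fun x => al + (sigma * al + F 0) * x - (W x - W 0)).
exists (fun x => (sigma * al + F 0) - F x).
split => [x|x||].
- by dsolve; ring.
- by dsolve; ring.
- by ring.
- rewrite /al /s2; field; have s3 : 2 + sigma != 0 by rewrite gt_eqF// addr_gt0.
  by rewrite ?s3 ?gt_eqF.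
Qed.

Lemma green_linear f1 w1 v1 f2 w2 v2 a : green f1 w1 v1 -> green f2 w2 v2 ->
  green (fun x => f1 x + a * f2 x) (fun x => w1 x + a * w2 x)
    (fun x => v1 x + a * v2 x).
Proof.
move=> [w1E v1E b10 b11] [w2E v2E b20 b21]; split => [x|x||].
- by dsolve; ring.
- by dsolve; ring.
- by rewrite b10 b20; ring.
- by rewrite b11 b21; ring.
Qed.

Lemma green_continuous f w v : green f w v -> continuous w /\ continuous v.
Proof. by move=> [wE vE _ _]; split; csolve. Qed.

(** The difference of the integrands is the derivative of the Wronskian [v1 * w2 - w1 * v2], which
    the Robin conditions make vanish at both ends. *)
Lemma green_sym f1 w1 v1 f2 w2 v2 : continuous f1 -> continuous f2 ->
  green f1 w1 v1 -> green f2 w2 v2 ->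
  int01 (fun x => w1 x * f2 x) = int01 (fun x => f1 x * w2 x).
Proof.
move=> cf1 cf2 g1 g2.
have [cw1 cv1] := green_continuous _ _ _ g1.
have [cw2 cv2] := green_continuous _ _ _ g2.
have [w1E v1E b10 b11] := g1; have [w2E v2E b20 b21] := g2.
apply/eqP; rewrite -subr_eq0; apply/eqP.
have -> : int01 (fun x => w1 x * f2 x) - int01 (fun x => f1 x * w2 x) =
    int01 (fun x => w1 x * f2 x + (-1) * (f1 x * w2 x)).
  by rewrite int01_add ?int01_scale ?mulN1r//; csolve.
have HF x : is_derive x 1 (fun x => v1 x * w2 x - w1 x * v2 x)
    (w1 x * f2 x + (-1) * (f1 x * w2 x)) by dsolve; ring.
rewrite (int01_derive _ _ _ HF); last by csolve.
by rewrite b10 b11 b20 b21; ring.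
Qed.

Lemma green_energy f w v : continuous f -> green f w v ->
  int01 (fun x => f x * w x) =
  int01 (fun x => v x ^+ 2) + sigma * (w 0 ^+ 2 + w 1 ^+ 2).
Proof.
move=> cf g; have [cw cv] := green_continuous _ _ _ g.
have [wE vE b0 b1] := g.
apply/eqP; rewrite -subr_eq0 opprD addrA subr_eq0; apply/eqP.
have -> : int01 (fun x => f x * w x) - int01 (fun x => v x ^+ 2) =
    int01 (fun x => f x * w x + (-1) * v x ^+ 2).
  by rewrite int01_add ?int01_scale ?mulN1r//; csolve.
have HF x : is_derive x 1 (fun x => - (v x * w x))
    (f x * w x + (-1) * v x ^+ 2) by dsolve; ring.
rewrite (int01_derive _ _ _ HF); last by csolve.
by rewrite b0 b1; ring.
Qed.

Lemma green_energy_ge0 f w v : continuous f -> green f w v ->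
  0 <= int01 (fun x => f x * w x).
Proof.
move=> cf g; rewrite (green_energy _ _ _ cf g) addr_ge0//.
  by apply: int01_ge0 => x; exact: sqr_ge0.
by rewrite mulr_ge0 ?(ltW sigma_gt0)// addr_ge0 ?sqr_ge0.
Qed.

Lemma int01_cst (a : R) : int01 (fun=> a) = a.
Proof.
have HF (x : R) : is_derive x 1 (fun x => a * x) a by dsolve; ring.
rewrite (int01_derive _ _ _ HF); last by csolve.
by ring.
Qed.

(** By [sqr_increment_le], w(x) differs from w(0) by at most the square root of the integral of v^2.
    The energy dominates both this integral and w(0)^2. *)
Lemma green_bound f w v : continuous f -> green f w v ->
  int01 (fun x => w x ^+ 2) <= (2 + 2 / sigma) * int01 (fun x => f x * w x).
Proof.
move=> cf g; have [cw cv] := green_continuous _ _ _ g.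
have [wE vE b0 b1] := g.
rewrite -[leRHS]int01_cst; apply: le_int01; [by csolve|by csolve|move=> x x01].
have := @sqr_increment_le _ _ _ v cv wE (fun=> lexx _) x x01.
have := green_energy _ _ _ cf g.
set E := int01 _; set Q := int01 _ => -> h.
have Q0 : 0 <= Q by apply: int01_ge0 => ?; exact: sqr_ge0.
have -> : (2 + 2 / sigma) * (Q + sigma * (w 0 ^+ 2 + w 1 ^+ 2)) =
  2 * Q + 2 / sigma * Q + (2 * sigma + 2) * (w 0 ^+ 2 + w 1 ^+ 2).
  by field; rewrite gt_eqF.
have h1 : 0 <= 2 / sigma * Q by rewrite mulr_ge0// divr_ge0 ?(ltW sigma_gt0).
have := sqr_ge0 (w x - 2 * w 0); have := sqr_ge0 (w 0); have := sqr_ge0 (w 1).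
have : 0 <= sigma * (w 0 ^+ 2 + w 1 ^+ 2).
  by rewrite mulr_ge0 ?(ltW sigma_gt0)// addr_ge0 ?sqr_ge0.
nra.
Qed.

Definition mode_orthogonal f : Prop :=
  forall k, robin_frequency k -> int01 (fun x => f x * mode k x) = 0.

Lemma green_orthogonal f w v : continuous f -> green f w v ->
  mode_orthogonal f -> mode_orthogonal w.
Proof.
move=> cf g fo k rk; have [k0 _] := rk; have [cw cv] := green_continuous _ _ _ g.
have cm := continuous_mode k.
have := green_sym _ _ _ _ _ _ cf _ g (green_mode _ rk).
rewrite (fo k rk) => /(_ _)/wrap[]; first by csolve.
have -> : (fun x => w x * (k ^+ 2 * mode k x)) = (fun x => k ^+ 2 * (w x * mode k x)).
  by apply/funext => x; ring.
rewrite int01_scale; last by csolve.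
by move/eqP; rewrite mulf_eq0 expf_eq0/= gt_eqF//= => /eqP.
Qed.

Lemma sqr_rotation_le (a b x : R) : (a * cos x + b * sin x) ^+ 2 <= a ^+ 2 + b ^+ 2.
Proof.
have := cos2Dsin2 x; set c := cos _; set s := sin _ => cs.
by have := sqr_ge0 (a * s - b * c); nra.
Qed.

(* Variation of constants.  When k is not a Robin frequency the condition at 1
   determines w 0; when it is one, orthogonality to the mode does. *)
Lemma green_resolvent_bound k : 0 < k -> exists2 C : R, 0 < C &
  forall f w v, continuous f -> green f w v -> mode_orthogonal f ->
    int01 (fun x => f x ^+ 2) <= C * int01 (fun x => (f x - k ^+ 2 * w x) ^+ 2).
Proof.
move=> k0; have kn0 : k != 0 by rewrite gt_eqF.
pose D := dmode k 1 + sigma * mode k 1.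
(* [C1] is the constant in w(0)^2 <= C1 Q, with Q the integral of (f - k^2 w)^2. The case D = 0 is
   that of a Robin frequency. *)
pose C1 : R := if D == 0 then 2 / k ^+ 2 / int01 (fun x => mode k x ^+ 2)
  else (4 + 4 * (sigma / k) ^+ 2) / D ^+ 2.
have cm := continuous_mode k.
have M0 : 0 <= int01 (fun x => mode k x ^+ 2).
  by apply: int01_ge0 => x; exact: sqr_ge0.
have Mn0 : int01 (fun x => mode k x ^+ 2) != 0.
  apply/negP => /eqP /(int01_sqr_eq0 _ cm)/(_ 0); rewrite mode0 lexx ler01.
  by move=> /(_ isT)/eqP; rewrite oner_eq0.
have C10 : 0 <= C1.
  rewrite /C1; case: ifP => _; first by rewrite !divr_ge0 ?sqr_ge0.
  by rewrite divr_ge0 ?sqr_ge0// addr_ge0// mulr_ge0// sqr_ge0.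
pose M := 1 + (sigma / k) ^+ 2.
pose C := 2 + 2 * k ^+ 4 * (2 * C1 * M + 4 / k ^+ 2).
have k40 : 0 <= k ^+ 4 by rewrite exprn_ge0// ltW.
have M1 : 0 <= M by rewrite addr_ge0// sqr_ge0.
have C0 : 0 < C.
  rewrite ltr_wpDr//; apply: mulr_ge0; first by rewrite mulr_ge0.
  by rewrite addr_ge0 ?divr_ge0 ?sqr_ge0// mulr_ge0// mulr_ge0.
exists C => // f w v cf g fo.
have [cw cv] := green_continuous _ _ _ g; have wo := green_orthogonal _ _ _ cf g fo.
have [wE vE b0 b1] := g.
pose h x := f x - k ^+ 2 * w x.
have ch : continuous h by rewrite /h; csolve.
rewrite -/(int01 (fun x => h x ^+ 2)); set Q := int01 (fun x => h x ^+ 2).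
have Q0 : 0 <= Q by apply: int01_ge0 => x; exact: sqr_ge0.
(* [A] and [B] are the coordinates of (w, v / k) in a frame rotating with angle k x. They would be
   constant if f were k^2 w, so their increments are controlled by h. *)
pose A x := w x * cos (k * x) - v x / k * sin (k * x).
pose B x := w x * sin (k * x) + v x / k * cos (k * x).
have HA x : is_derive x 1 A (h x / k * sin (k * x)).
  by rewrite /A /h; dsolve; field.
have HB x : is_derive x 1 B (- (h x / k * cos (k * x))).
  by rewrite /B /h; dsolve; field.
have chk : continuous (fun x => h x / k) by csolve.
have Qk : int01 (fun x => (h x / k) ^+ 2) = Q / k ^+ 2.
  rewrite -[RHS]mulrC -int01_scale; last by csolve.
  by apply: eq_int01 => x _; rewrite expr_div_n mulrC.
have dA x : 0 <= x <= 1 -> (A x - A 0) ^+ 2 <= Q / k ^+ 2.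
  rewrite -Qk; apply: sqr_increment_le chk HA _ x => x.
  rewrite exprMn ler_piMr ?sqr_ge0// -(cos2Dsin2 (k * x)) lerDr sqr_ge0//.
have dB x : 0 <= x <= 1 -> (B x - B 0) ^+ 2 <= Q / k ^+ 2.
  rewrite -Qk; apply: sqr_increment_le chk HB _ x => x.
  rewrite sqrrN exprMn ler_piMr ?sqr_ge0// -(cos2Dsin2 (k * x)) lerDl sqr_ge0//.
(* The part of w produced by h; the rest is w(0) times the mode. *)
pose r x := (A x - A 0) * cos (k * x) + (B x - B 0) * sin (k * x).
have A0 : A 0 = w 0 by rewrite /A mulr0 cos0 sin0; ring.
have B0 : B 0 = sigma / k * w 0 by rewrite /B mulr0 cos0 sin0 b0; field.
have wr x : w x = w 0 * mode k x + r x.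
  rewrite /r A0 B0 /A /B /mode.
  have := cos2Dsin2 (k * x); set c := cos _; set s := sin _ => cs.
  rewrite -[LHS]mulr1 -cs; field.
  done.
have r2 x : 0 <= x <= 1 -> r x ^+ 2 <= 2 * (Q / k ^+ 2).
  move=> x01; apply: le_trans (sqr_rotation_le _ _ _) _.
  by rewrite mulr_natl mulr2n lerD ?dA ?dB.
have cr : continuous r by rewrite /r; csolve.
have w02 : w 0 ^+ 2 <= C1 * Q.
  rewrite /C1; have [D0|D0] := eqVneq D 0.
    (* Since w is orthogonal to the mode, the square integral of r = w - w(0) mode is a sum of two
       squares and dominates the term with w(0)^2. *)
    have wm0 : int01 (fun x => w x * mode k x) = 0 by apply: wo; split.
    have : int01 (fun x => r x ^+ 2) =
        int01 (fun x => w x ^+ 2) + w 0 ^+ 2 * int01 (fun x => mode k x ^+ 2).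
      have -> : int01 (fun x => r x ^+ 2) = int01 (fun x => w x ^+ 2 +
          ((- 2 * w 0) * (w x * mode k x) + w 0 ^+ 2 * mode k x ^+ 2)).
        by apply: eq_int01 => x _; rewrite [w x in RHS]wr; ring.
      by rewrite !int01_add ?int01_scale ?wm0; [ring|csolve..].
    have w20 : 0 <= int01 (fun x => w x ^+ 2) by apply: int01_ge0 => ?; exact: sqr_ge0.
    have : int01 (fun x => r x ^+ 2) <= 2 * (Q / k ^+ 2).
      by rewrite -[leRHS]int01_cst; apply: le_int01; [csolve|csolve|exact: r2].
    move=> le1 eq1; rewrite mulrAC ler_pdivlMr; last by rewrite lt_def Mn0.
    by rewrite mulrAC -mulrA; move: le1; rewrite eq1; lra.
  (* The analogue of r for v / k at the point 1. Inserting both decompositions into the condition at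
     1 expresses w(0) D through the remainders. *)
  pose r' := (B 1 - B 0) * cos (k * 1) + (- (A 1 - A 0)) * sin (k * 1).
  have x11 : 0 <= (1 : R) <= 1 by rewrite ler01 lexx.
  have r'2 : r' ^+ 2 <= 2 * (Q / k ^+ 2).
    apply: le_trans (sqr_rotation_le _ _ _) _.
    by rewrite sqrrN mulr_natl mulr2n lerD ?dA ?dB.
  have vr : v 1 = w 0 * dmode k 1 + k * r'.
    rewrite /r' A0 B0 /A /B /dmode.
    have := cos2Dsin2 (k * 1); set c := cos _; set s := sin _ => cs.
    by rewrite -[LHS]mulr1 -cs; field.
  have w0D : w 0 * D = - (k * r' + sigma * r 1).
    apply/eqP; rewrite -addr_eq0 /D; apply/eqP.
    transitivity (w 0 * dmode k 1 + k * r' + sigma * (w 0 * mode k 1 + r 1)); first by ring.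
    by rewrite -vr -wr b1; ring.
  have D2 : 0 < D ^+ 2 by rewrite exprn_even_gt0.
  rewrite mulrAC ler_pdivlMr// -exprMn w0D sqrrN.
  have := r2 1 x11; set q := Q / k ^+ 2 => r12.
  have -> : (4 + 4 * (sigma / k) ^+ 2) * Q = 4 * k ^+ 2 * q + 4 * sigma ^+ 2 * q.
    by rewrite /q; field.
  have := sqr_ge0 (k * r' - sigma * r 1).
  have : k ^+ 2 * r' ^+ 2 <= k ^+ 2 * (2 * q) by rewrite ler_wpM2l ?sqr_ge0.
  have : sigma ^+ 2 * r 1 ^+ 2 <= sigma ^+ 2 * (2 * q) by rewrite ler_wpM2l ?sqr_ge0.
  nra.
have fh x : f x = h x + k ^+ 2 * w x by rewrite /h; ring.
have wx x : 0 <= x <= 1 -> w x ^+ 2 <= (2 * C1 * M + 4 / k ^+ 2) * Q.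
  move=> /r2 rx; rewrite (wr x).
  have : w 0 ^+ 2 * mode k x ^+ 2 <= C1 * Q * M.
    by apply: ler_pM; rewrite ?sqr_ge0//; exact: mode_sqr_le.
  have -> : (2 * C1 * M + 4 / k ^+ 2) * Q = 2 * (C1 * Q * M) + 4 * (Q / k ^+ 2) by ring.
  by have := sqr_ge0 (w 0 * mode k x - r x); nra.
have -> : C * Q = int01 (fun x => 2 * h x ^+ 2 + (C - 2) * Q).
  by rewrite int01_add ?int01_scale ?int01_cst -/Q; [ring|csolve..].
apply: le_int01; [by csolve|by csolve|move=> x x01].
have := sqr_ge0 (h x - k ^+ 2 * w x); rewrite (fh x).
have : k ^+ 4 * w x ^+ 2 <= k ^+ 4 * ((2 * C1 * M + 4 / k ^+ 2) * Q).
  by rewrite ler_wpM2l ?wx.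
have -> : (C - 2) * Q = 2 * (k ^+ 4 * ((2 * C1 * M + 4 / k ^+ 2) * Q)) by rewrite /C; ring.
have -> : k ^+ 4 * w x ^+ 2 = (k ^+ 2 * w x) ^+ 2 by ring.
nra.
Qed.

(* Otherwise let rho be the supremum of <g, G g> / |g|^2 over the nonzero functions
   g orthogonal to the modes, where G is the Green operator.  By Cauchy-Schwarz for the form of G, |G g|^2 <= rho <g, G g>, while
   [green_resolvent_bound] at k^2 = 1 / rho bounds |g| by |g - G g / rho|; so the
   quotient stays below rho (1 - 1 / C). *)
Lemma mode_complete_continuous f : continuous f -> mode_orthogonal f ->
  forall x, 0 <= x <= 1 -> f x = 0.
Proof.
move=> cf fo; apply: int01_sqr_eq0 => //; apply: contrapT => /eqP fn0.
pose S := [set q : R | exists g w v, [/\ continuous g, mode_orthogonal g,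
  green g w v, int01 (fun x => g x ^+ 2) != 0 &
  q = int01 (fun x => g x * w x) / int01 (fun x => g x ^+ 2)]].
have sq_ge0 g : 0 <= int01 (fun x => g x ^+ 2) by apply: int01_ge0 => ?; exact: sqr_ge0.
have int0 g h : continuous g -> continuous h ->
    int01 (fun x => g x ^+ 2) = 0 -> int01 (fun x => g x * h x) = 0.
  move=> cg ch g0; rewrite -[RHS](int01_cst 0); apply: eq_int01 => x x01.
  by rewrite (int01_sqr_eq0 _ cg g0)// mul0r.
pose K := 2 + 2 / sigma.
have K0 : 0 < K by rewrite ltr_wpDr// divr_ge0// ltW.
have ubS : ubound S K.
  move=> q [g [w [v [cg go gw gn0 ->]]]]; have [cw cv] := green_continuous _ _ _ gw.
  have g0 : 0 < int01 (fun x => g x ^+ 2) by rewrite lt_def gn0 sq_ge0.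
  rewrite ler_pdivrMr//.
  have := green_bound _ _ _ cg gw; rewrite -/K.
  have : 0 <= int01 (fun x => (K * g x + (-1) * w x) ^+ 2) by exact: sq_ge0.
  have -> : int01 (fun x => (K * g x + (-1) * w x) ^+ 2) =
      int01 (fun x => K ^+ 2 * g x ^+ 2 + ((- 2 * K) * (g x * w x) + w x ^+ 2)).
    by apply: eq_int01 => x _; ring.
  rewrite !int01_add ?int01_scale; [|csolve..].
  set a := int01 _; set b := int01 _; set c := int01 _ => h1 h2.
  have : K * b <= K * (K * a) by nra.
  by rewrite ler_pM2l.
have [w [v gw]] := green_exists _ cf; have [cw cv] := green_continuous _ _ _ gw.
have supS : has_sup S.
  split; last by exists K.
  by exists (int01 (fun x => f x * w x) / int01 (fun x => f x ^+ 2)), f, w, v; split.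
pose rho := sup S.
have rhoP g w' v' : continuous g -> mode_orthogonal g -> green g w' v' ->
    int01 (fun x => g x * w' x) <= rho * int01 (fun x => g x ^+ 2).
  move=> cg go gw'; have [cw' cv'] := green_continuous _ _ _ gw'.
  have [g0|g0] := eqVneq (int01 (fun x => g x ^+ 2)) 0.
    by rewrite int0// g0 mulr0.
  rewrite -ler_pdivrMr ?lt_def ?g0 ?sq_ge0//.
  by apply: (sup_upper_bound supS); exists g, w', v'; split.
have rho0 : 0 < rho.
  have : 0 <= rho.
    have := rhoP _ _ _ cf fo gw; have := green_energy_ge0 _ _ _ cf gw.
    have : 0 < int01 (fun x => f x ^+ 2) by rewrite lt_def fn0 sq_ge0.
    by nra.
  (* If rho were 0, the energy of the Green solution of f would vanish, hence also v and then f = -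
     v'. *)
  rewrite le_eqVlt => /predU1P[rho0|//]; exfalso.
  have E0 : int01 (fun x => f x * w x) = 0.
    apply/eqP; rewrite eq_le (green_energy_ge0 _ _ _ cf gw) andbT.
    by have := rhoP _ _ _ cf fo gw; rewrite -rho0 mul0r.
  have := green_energy _ _ _ cf gw; rewrite E0 => /esym/eqP.
  rewrite paddr_eq0 ?sq_ge0//; last first.
    by rewrite mulr_ge0 ?(ltW sigma_gt0)// addr_ge0 ?sqr_ge0.
  move=> /andP[/eqP v0 _].
  have [wE vE _ _] := gw.
  have v00 := int01_sqr_eq0 _ cv v0.
  have cNf : continuous (fun x => - f x) by csolve.
  have f00 := is_derive_eq0_itv _ _ 0 vE cNf v00.
  move/eqP: fn0; apply; rewrite -[RHS](int01_cst 0); apply: eq_int01 => x x01.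
  by rewrite -sqrrN f00// expr0n.
(* The form of the Green operator is nonnegative at [g - rho^-1 * w'], while its value at [w'] is at
   most rho times the square integral of [w']. Expanding gives Cauchy-Schwarz with the factor
   rho. *)
have sq_le g w' v' : continuous g -> mode_orthogonal g -> green g w' v' ->
    int01 (fun x => w' x ^+ 2) <= rho * int01 (fun x => g x * w' x).
  move=> cg go gw'; have [cw' cv'] := green_continuous _ _ _ gw'.
  have w'o := green_orthogonal _ _ _ cg gw' go.
  have [w2 [v2 gw2]] := green_exists _ cw'; have [cw2 cv2] := green_continuous _ _ _ gw2.
  have gl := green_linear _ _ _ _ _ _ (- rho^-1) gw' gw2.
  have := rhoP _ _ _ cw' w'o gw2.
  have := green_sym _ _ _ _ _ _ cg cw' gw' gw2.
  have := green_energy_ge0 _ _ _ _ gl => /(_ _)/wrap[]; first by csolve.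
  have -> : int01 (fun x => (g x + - rho^-1 * w' x) * (w' x + - rho^-1 * w2 x)) =
     int01 (fun x => g x * w' x + (- rho^-1 * (w' x * w' x) +
       (- rho^-1 * (g x * w2 x) + rho^-1 ^+ 2 * (w' x * w2 x)))).
    by apply: eq_int01 => x _; ring.
  rewrite !int01_add ?int01_scale; [|csolve..].
  have -> : (fun x => w' x ^+ 2) = (fun x => w' x * w' x).
    by apply/funext => x; rewrite expr2.
  set a := int01 _; set b := int01 _; set c := int01 _; set d := int01 _.
  move=> h1 bc h2; move: h1; rewrite -bc => h1.
  have : 0 <= rho ^+ 2 * (a + (- rho^-1 * b + (- rho^-1 * b + rho^-1 ^+ 2 * d))).
    by rewrite mulr_ge0 ?sqr_ge0.
  have -> : rho ^+ 2 * (a + (- rho^-1 * b + (- rho^-1 * b + rho^-1 ^+ 2 * d))) =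
     rho ^+ 2 * a - 2 * rho * b + d by field; rewrite gt_eqF.
  move=> h3; have : rho * b <= rho * (rho * a) by nra.
  by rewrite ler_pM2l.
pose k := Num.sqrt rho^-1.
have k0 : 0 < k by rewrite sqrtr_gt0 invr_gt0.
have k2 : k ^+ 2 = rho^-1 by rewrite sqr_sqrtr// invr_ge0 ltW.
have [C C0 HC] := green_resolvent_bound _ k0.
have : rho <= rho * (1 - C^-1).
  apply: (ge_sup supS.1) => q [g [w' [v' [cg go gw' gn0 ->]]]].
  have [cw' cv'] := green_continuous _ _ _ gw'.
  rewrite ler_pdivrMr ?lt_def ?gn0 ?sq_ge0//.
  have := HC _ _ _ cg gw' go; have := sq_le _ _ _ cg go gw'.
  rewrite k2.
  have -> : int01 (fun x => (g x - rho^-1 * w' x) ^+ 2) = int01 (fun x => g x ^+ 2 +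
     ((- 2 * rho^-1) * (g x * w' x) + rho^-1 ^+ 2 * w' x ^+ 2)).
    by apply: eq_int01 => x _; ring.
  rewrite !int01_add ?int01_scale; [|csolve..].
  set a := int01 (fun x => g x ^+ 2); set b := int01 (fun x => g x * w' x).
  set c := int01 (fun x => w' x ^+ 2) => h1 h2.
  have h3 : a <= C * (a - rho^-1 * b).
    apply: (le_trans h2); rewrite ler_pM2l//.
    have : rho^-1 ^+ 2 * c <= rho^-1 ^+ 2 * (rho * b) by rewrite ler_wpM2l ?sqr_ge0.
    have -> : rho^-1 ^+ 2 * (rho * b) = rho^-1 * b by field; rewrite gt_eqF.
    by lra.
  have : rho / C * a <= rho / C * (C * (a - rho^-1 * b)).
    by rewrite ler_wpM2l// divr_ge0 ?(ltW rho0) ?(ltW C0).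
  have -> : rho / C * (C * (a - rho^-1 * b)) = rho * a - b.
    by field; rewrite !gt_eqF.
  have -> : rho * (1 - C^-1) * a = rho * a - rho / C * a by ring.
  lra.
have : 0 < rho * C^-1 by rewrite divr_gt0.
nra.
Qed.

End robin_modes.

(** * Completeness of the modes among integrable functions *)

Section robin_modes_L1.
Context {R : realType}.
Variable sigma : R.
Hypothesis sigma_gt0 : 0 < sigma.
Local Notation mu := (@lebesgue_measure R).
Implicit Types f : R -> R.

Lemma Rintegral_derive (f F : R -> R) (a b : R) : a <= b -> continuous f ->
  (forall x : R, is_derive x 1 F (f x)) -> \int[mu]_(x in `[a, b]) f x = F b - F a.
Proof.
rewrite le_eqVlt => /predU1P[<- _ _|ab cf Ff].
  by rewrite set_itv1 Rintegral_set1 subrr.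
have cF : continuous F by move=> x; exact: is_derive_continuous (Ff x).
rewrite /Rintegral (@continuous_FTC2 _ f F a b)//.
- exact: continuous_subspaceT.
- split; first by move=> x _; have ? := Ff x; exact: ex_derive.
  + by apply: cvg_at_right_filter; exact: cF.
  + by apply: cvg_at_left_filter; exact: cF.
- by move=> x _; have ? := Ff x; rewrite derive1E derive_val.
Qed.

Lemma continuous_bounded_itv (f : R -> R) : continuous f ->
  exists2 M : R, 0 <= M & forall x, 0 <= x <= 1 -> `|f x| <= M.
Proof.
move=> cf.
have : bounded_set (f @` `[0, 1]).
  apply: compact_bounded; apply: continuous_compact; last exact: segment_compact.
  exact: continuous_subspaceT.
move=> [M [Mr HM]]; exists (Num.max 0 (M + 1)); first by rewrite le_max lexx.
move=> x x01; rewrite le_max; apply/orP; right; apply: HM; first by rewrite ltrDl.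
by exists x => //=; rewrite in_itv.
Qed.

Lemma integrable_mul_continuous f (g : R -> R) :
  mu.-integrable `[0, 1] (EFin \o f) -> continuous g ->
  mu.-integrable `[0, 1] (EFin \o (fun x => f x * g x)).
Proof.
move=> fi cg.
rewrite (_ : EFin \o _ = ((EFin \o f) \* (EFin \o g))%E); last first.
  by apply/funext => x /=; rewrite EFinM.
apply: integrableMl => //.
  by apply: measurable_funTS; exact: continuous_measurable_fun.
have [M M0 HM] := continuous_bounded_itv _ cg.
exists M; split => [|x Mx y /=]; first exact: num_real.
by rewrite in_itv/= => /HM /le_trans; apply; exact: ltW.
Qed.

Lemma integrable_restrict01 f : mu.-integrable `[0, 1] (EFin \o f) ->
  mu.-integrable setT (EFin \o (f \_ `[0, 1])).
Proof.
by move=> fi; rewrite -restrict_EFin; apply/integrable_restrict => //=; rewrite setTI.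
Qed.

(* Integration by parts for an absolutely continuous function, by Fubini. *)
Lemma Rintegral_primitive_by_parts f (psi dpsi : R -> R) :
  mu.-integrable `[0, 1] (EFin \o f) -> continuous dpsi ->
  (forall x : R, is_derive x 1 psi (dpsi x)) ->
  let F x := \int[mu]_(t in `[0, x]) f t in
  \int[mu]_(s in `[0, 1]) (F s * dpsi s) =
  F 1 * psi 1 - \int[mu]_(t in `[0, 1]) (f t * psi t).
Proof.
move=> fi cd psiE F.
pose f1 : R -> R := f \_ `[0, 1].
have f1i : mu.-integrable setT (EFin \o f1) by exact: integrable_restrict01.
have mf1 : measurable_fun setT f1 by apply/measurable_EFinP; exact: measurable_int f1i.
pose d := dpsi \_ `[0, 1].
have md : measurable_fun setT d.
  apply/(measurable_restrictT _ _).1 => //.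
  by apply: measurable_funTS; exact: continuous_measurable_fun.
have [M M0 HM] := continuous_bounded_itv _ cd.
(* The kernel f(t) psi'(s) on the triangle t <= s. Integrating over t first gives F(s) psi'(s), over
   s first f(t) (psi(1) - psi(t)). *)
pose h (p : measurableTypeR R * measurableTypeR R) :=
  if p.2 <= p.1 then d p.1 * f1 p.2 else 0.
have mh : measurable_fun setT h.
  apply: measurable_fun_ifT => //.
  - by apply: measurable_fun_ler; [exact: measurable_snd|exact: measurable_fst].
  - apply: measurable_funM.
    + exact: (measurableT_comp md measurable_fst).
    + exact: (measurableT_comp mf1 measurable_snd).
have dM s : `|d s| <= M * (\1_(`[0, 1]%classic : set R) s).
  rewrite /d patchE indicE; case: ifPn; rewrite ?normr0 ?mulr0//.
  by rewrite inE/= in_itv/= mulr1 => /HM.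
have hi : (mu \x mu)%E.-integrable setT (EFin \o h).
  apply/integrable12ltyP; first exact/measurable_EFinP.
  pose I := (\int[mu]_t `|(f1 t)%:E|)%E.
  have /integrableP[_ Ioo] := f1i.
  have I0 : (0 <= I)%E by apply: integral_ge0 => ? _; exact: abse_ge0.
  have Ifin : I \is a fin_num by rewrite ge0_fin_numE.
  apply: (@le_lt_trans _ _ (\int[mu]_s (fine I * M * (\1_(`[0, 1]%classic : set R) s))%:E)%E).
    apply: ge0_le_integral => //.
    + by move=> s _; apply: integral_ge0 => ? _; exact: abse_ge0.
    + apply: (measurable_fun_fubini_tonelli_F (fun p => `|(h p)%:E|%E)) => //.
      by apply: measurableT_comp => //; exact/measurable_EFinP.
    + apply/measurable_EFinP; apply: measurable_funM => //; exact: measurable_indic.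
    move=> s _; rewrite -mulrA mulrC EFinM fineK//.
    apply: (@le_trans _ _ (`|d s|%:E * I)%E); last first.
      by apply: lee_wpmul2r => //; rewrite lee_fin dM.
    rewrite -ge0_integralZl//; last first.
      by apply: measurableT_comp => //; exact/measurable_EFinP.
    apply: ge0_le_integral => //.
    + apply: measurableT_comp => //; apply/measurable_EFinP.
      exact: (measurableT_comp mh (pair1_measurable s)).
    + by apply: measurable_funeM; apply: measurableT_comp => //; exact/measurable_EFinP.
    + move=> t _; rewrite -EFinM lee_fin /h/=; case: ifP => _; last first.
        by rewrite normr0 mulr_ge0.
      by rewrite normrM.
  under eq_integral do rewrite EFinM.
  rewrite ge0_integralZl//; last 2 first.
  - by apply/measurable_EFinP; exact: measurable_indic.
  - by rewrite lee_fin mulr_ge0// fine_ge0.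
  rewrite integral_indic//= setIT lebesgue_measure_itv/= lte_fin ltr01.
  by rewrite -EFinB -EFinM ltry.
have := Fubini hi.
have -> : (\int[mu]_s \int[mu]_t (EFin \o h) (s, t))%E =
    (\int[mu]_(s in `[0%R, 1%R]) (F s * dpsi s)%:E)%E.
  rewrite [RHS]integral_mkcond; apply: eq_integral => s _.
  rewrite patchE; case: ifPn => [|s01]; last first.
    rewrite -[RHS](@integral0 _ _ _ mu setT); apply: eq_integral => t _ /=.
    by rewrite /h /d /= patchE (negbTE s01) mul0r if_same.
  move=> s01; rewrite (_ : (fun t => _) = (fun t => (dpsi s)%:E * ((f \_ `[0, s]) t)%:E)%E); last first.
    apply/funext => t; rewrite /= /h /= -EFinM; congr (_%:E).
    rewrite /d /f1 !patchE s01 !mem_setE !in_itv/=.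
    move: s01; rewrite inE/= in_itv/= => /andP[s0 s1].
    have [ts|ts] := leP t s; last by rewrite andbF mulr0.
    by rewrite (le_trans ts s1).
  have fis : mu.-integrable `[0, s] (EFin \o f).
    apply: integrableS fi => //; apply: subset_itvl; rewrite bnd_simp.
    by move: s01; rewrite inE/= in_itv/= => /andP[].
  have fis' : mu.-integrable setT (EFin \o (f \_ `[0, s])).
    by rewrite -restrict_EFin; apply/integrable_restrict => //=; rewrite setTI.
  rewrite integralZl//; rewrite mulrC EFinM; congr (_ * _)%E.
  rewrite /F /Rintegral fineK.
    rewrite [RHS]integral_mkcond; apply: eq_integral => t _.
    by rewrite restrict_EFin.
  by apply: integrable_fin_num.
have -> : (\int[mu]_t \int[mu]_s (EFin \o h) (s, t))%E =
    (\int[mu]_(t in `[0%R, 1%R]) (f t * (psi 1 - psi t))%:E)%E.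
  rewrite [RHS]integral_mkcond; apply: eq_integral => t _.
  rewrite patchE; case: ifPn => [|t01]; last first.
    rewrite -[RHS](@integral0 _ _ _ mu setT); apply: eq_integral => s _ /=.
    by rewrite /h /f1 /= patchE (negbTE t01) mulr0 if_same.
  move=> t01; rewrite (_ : (fun s => _) = (fun s => (f t)%:E * ((dpsi \_ `[t, 1]) s)%:E)%E); last first.
    apply/funext => s; rewrite /= /h /= -EFinM; congr (_%:E).
    rewrite /d /f1 !patchE t01 !mem_setE !in_itv/=.
    move: t01; rewrite inE/= in_itv/= => /andP[t0 t1].
    have [ts|ts] := leP t s; last by rewrite mulr0.
    by rewrite (le_trans t0 ts) mulrC.
  have dt : mu.-integrable `[t, 1] (EFin \o dpsi) by exact: continuous_integrable_itv.
  have dt' : mu.-integrable setT (EFin \o (dpsi \_ `[t, 1])).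
    by rewrite -restrict_EFin; apply/integrable_restrict => //=; rewrite setTI.
  rewrite integralZl// EFinM; congr (_ * _)%E.
  rewrite -(Rintegral_derive dpsi psi t 1)//; last first.
    by move: t01; rewrite inE/= in_itv/= => /andP[].
  rewrite /Rintegral fineK.
    rewrite [RHS]integral_mkcond; apply: eq_integral => s _.
    by rewrite restrict_EFin.
  by apply: integrable_fin_num.
move=> H.
transitivity (\int[mu]_(t in `[0, 1]) (f t * (psi 1 - psi t))).
  by rewrite /Rintegral H.
have cpsi : continuous psi by move=> x; exact: is_derive_continuous (psiE x).
have fpsii : mu.-integrable `[0, 1] (EFin \o (fun t => f t * psi t)).
  exact: integrable_mul_continuous.
have -> : (fun t => f t * (psi 1 - psi t)) = (fun t => f t * psi 1 - f t * psi t).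
  by apply/funext => t; rewrite mulrBr.
rewrite RintegralB//; last first.
  by apply: integrable_mul_continuous => //; exact: continuous_fcst.
by rewrite RintegralZr.
Qed.

Lemma primitive_continuous_extension f : mu.-integrable `[0, 1] (EFin \o f) ->
  exists2 F : R -> R, continuous F &
    forall x, 0 <= x <= 1 -> F x = \int[mu]_(t in `[0, x]) f t.
Proof.
move=> fi; pose f1 : R -> R := f \_ `[0, 1].
have f1i : mu.-integrable setT (EFin \o f1) by exact: integrable_restrict01.
(* The range from - 1 to 2 makes 0 and 1 interior points, so that P is continuous there in the
   two-sided sense. *)
pose P x := \int[mu]_(t in `[-1, x]) f1 t.
have f1i' : mu.-integrable `[-1, 2] (EFin \o f1) by exact: integrableS f1i.
have cP x : 0 <= x <= 1 -> {for x, continuous P}.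
  move=> /andP[x0 x1].
  have := @parameterized_integral_continuous R (-1) 2 f1 _ f1i'.
  have -> : -1 <= 2 :> R by lra.
  move=> /(_ isT)/continuous_within_itvP; rewrite (_ : -1 < 2 :> R); last by lra.
  by move=> /(_ isT)[+ _ _]; apply; rewrite in_itv/=; lra.
(* The projection onto [0, 1], written with absolute values so that its continuity is immediate. *)
pose cl (x : R) := (`|x| - `|x - 1| + 1) / 2.
have cnorm (g : R -> R) : continuous g -> continuous (fun x => `|g x|).
  by move=> cg x; apply: (@continuous_comp _ _ _ g Num.norm); [exact: cg|exact: norm_continuous].
have ccl : continuous cl.
  by rewrite /cl; csolve; apply: cnorm; csolve.
have cl_id x : 0 <= x <= 1 -> cl x = x.
  by move=> /andP[x0 x1]; rewrite /cl ger0_norm// ler0_norm ?subr_le0//; lra.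
have cl01 x : 0 <= cl x <= 1.
  rewrite /cl; have [x0|x0] := leP 0 x; have [x1|x1] := leP x 1.
  - by rewrite ger0_norm// ler0_norm ?subr_le0//; lra.
  - by rewrite ger0_norm// ger0_norm ?subr_ge0 ?(ltW x1)//; lra.
  - by rewrite ltr0_norm// ler0_norm ?subr_le0//; lra.
  - by rewrite ltr0_norm// ger0_norm ?subr_ge0 ?(ltW x1)//; lra.
exists (P \o cl).
  by move=> x; apply: continuous_comp; [exact: ccl|exact/cP/cl01].
move=> x /andP[x0 x1] /=; rewrite cl_id ?x0//.
rewrite /P Rintegral_mkcond [RHS]Rintegral_mkcond; apply: eq_Rintegral => t _.
rewrite /f1 !patchE !mem_setE !in_itv/=.
have [tx|tx] := leP t x; last by rewrite !andbF.
rewrite (le_trans tx x1) !andbT.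
have [t0|t0] := leP 0 t; first by rewrite (le_trans _ t0) ?lerN10.
by case: ifP.
Qed.

(** Reduction to continuous functions. The Green solution w of f can be built from the primitive F,
    and integration by parts shows that it is orthogonal to the modes. So w = 0, then w' = 0 and F =
    0, and by Lebesgue differentiation f = 0 almost everywhere. *)
Lemma mode_complete_L1 f : mu.-integrable `[0, 1] (EFin \o f) ->
  (forall k, robin_frequency sigma k ->
    \int[mu]_(x in `[0, 1]) (f x * mode sigma k x) = 0) ->
  {ae mu, forall x : R, 0 < x < 1 -> f x = 0}.
Proof.
move=> fi fo; have [F cF FE] := primitive_continuous_extension _ fi.
have F0 : F 0 = 0 by rewrite FE ?lexx ?ler01// set_itv1 Rintegral_set1.
have [W HW] := primitive_exists F cF.
pose s2 := sigma * (2 + sigma).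
have s3 : 2 + sigma != 0 by rewrite gt_eqF// addr_gt0.
have s0 : sigma != 0 by rewrite gt_eqF.
pose al := (F 1 + sigma * (W 1 - W 0)) / s2.
pose w x := al + sigma * al * x - (W x - W 0).
pose v x := sigma * al - F x.
have wE (x : R) : is_derive x 1 w (v x) by rewrite /w /v; dsolve; ring.
have cw : continuous w by csolve.
have cv : continuous v by rewrite /v; csolve.
have w0 : w 0 = al by rewrite /w; ring.
have b1 : v 1 = - (sigma * w 1).
  by rewrite /w /v /al /s2; field; rewrite ?s3 ?s0.
have b0 : v 0 = sigma * w 0 by rewrite w0 /v F0 subr0.
have wo : mode_orthogonal sigma w.
  move=> k [k0 kE]; have kn0 : k != 0 by rewrite gt_eqF.
  have cm := continuous_mode sigma k; have cd := continuous_dmode sigma k.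
  have Hm x := is_derive_mode sigma k x kn0.
  have Hd x := is_derive_dmode sigma k x kn0.
  have H1 : int01 (fun x => v x * dmode sigma k x - k ^+ 2 * (w x * mode sigma k x)) =
      w 1 * dmode sigma k 1 - w 0 * dmode sigma k 0.
    have HF (x : R) : is_derive x 1 (fun x => w x * dmode sigma k x)
      (v x * dmode sigma k x - k ^+ 2 * (w x * mode sigma k x)) by dsolve; ring.
    by rewrite (int01_derive _ _ _ HF); last by csolve.
  have H2 : int01 (fun x => F x * dmode sigma k x) = F 1 * mode sigma k 1.
    have /= := Rintegral_primitive_by_parts _ _ _ fi cd Hm.
    rewrite (fo k)// subr0 -FE ?ler01 ?lexx// => <-.
    by apply: eq_int01 => x x01; rewrite FE.
  have H3 : int01 (fun x => v x * dmode sigma k x) =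
      v 1 * mode sigma k 1 - v 0 * mode sigma k 0.
    have -> : int01 (fun x => v x * dmode sigma k x) =
       int01 (fun x => sigma * al * dmode sigma k x + (-1) * (F x * dmode sigma k x)).
      by apply: eq_int01 => x _; rewrite /v; ring.
    rewrite int01_add ?int01_scale ?H2; [|csolve..].
    rewrite (int01_derive _ _ cd Hm) /v F0; ring.
  move: H1; have -> : (fun x => v x * dmode sigma k x - k ^+ 2 * (w x * mode sigma k x)) =
      (fun x => v x * dmode sigma k x + (- k ^+ 2) * (w x * mode sigma k x)).
    by apply/funext => x; rewrite mulNr.
  rewrite int01_add ?int01_scale ?H3; [|csolve..].
  set q := int01 _; rewrite b0 b1 mode0 dmode0 => H1.
  have d1 : dmode sigma k 1 = - (sigma * mode sigma k 1).
    by apply/eqP; rewrite -addr_eq0 kE.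
  have : k ^+ 2 * q = 0 by move: H1; rewrite d1; lra.
  by move/eqP; rewrite mulf_eq0 expf_eq0/= (negbTE kn0) => /eqP.
have w00 := mode_complete_continuous _ sigma_gt0 _ cw wo.
have v00 := is_derive_eq0_itv _ _ 0 wE cv w00.
have al0 : al = 0 by rewrite -w0 w00// lexx ler01.
have F00 x : 0 <= x <= 1 -> F x = 0.
  by move=> /v00; rewrite /v al0 mulr0 sub0r => /eqP; rewrite oppr_eq0 => /eqP.
pose f1 : R -> R := f \_ `[0, 1].
have f1i : mu.-integrable setT (EFin \o f1) by exact: integrable_restrict01.
have intf1 y : mu.-integrable [set` Interval (BLeft 0) (BRight y)] (EFin \o f1).
  exact: integrableS f1i.
have locf1 : locally_integrable setT f1.
  exact: (open_integrable_locally openT f1i).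
have /= := @FTC1 R f1 (BLeft 0) intf1 locf1.
apply: filterS; first exact: (ae_filter_ringOfSetsType mu).
move=> x Hx /andP[x0 x1].
have [] := Hx _; first by rewrite lte_fin.
move=> dG; have -> : f1 x = f x by rewrite /f1 patchE mem_setE in_itv/= !ltW.
move=> <-.
have cst : is_derive x 1 (fun _ : R => 0 : R) 0 by exact: is_derive_cst.
transitivity ('D_1 (fun _ : R => 0 : R) x); last by rewrite derive_val.
rewrite derive1E; apply: near_eq_derive; near=> y.
have y01 : 0 <= y <= 1.
  by apply/andP; split; near: y; [exact: lt_le_nbhsr|exact: lt_le_nbhsl].
transitivity (F y); last exact: F00.
rewrite FE//; apply: eq_Rintegral => t.
rewrite inE/= in_itv/= => /andP[t0 ty].
by rewrite /f1 patchE mem_setE in_itv/= t0 (le_trans ty)//; case/andP: y01.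
Unshelve. all: by end_near. Qed.

End robin_modes_L1.

(** * The phase and the Robin frequencies as its level points *)

Section robin_phase.
Context {R : realType}.
Variable sigma : R.
Hypothesis sigma_gt0 : 0 < sigma.
Implicit Types (k x : R) (n m : nat).

Lemma is_derive_lt (f g : R -> R) (a b : R) :
  (forall x, a <= x <= b -> is_derive x 1 f (g x)) ->
  (forall x, a <= x <= b -> 0 < g x) -> a < b -> f a < f b.
Proof.
move=> fg g0 ab.
have ooW x : x \in `]a, b[ -> a <= x <= b.
  by rewrite in_itv/= => /andP[/ltW -> /ltW ->].
apply: (@gtr0_derive1_lt_cc _ f a b); rewrite ?in_itv/= ?lexx ?(ltW ab)//.
- by move=> x /ooW xab; have ? := fg _ xab; exact: ex_derive.
- by move=> x /ooW xab; have ? := fg _ xab; rewrite derive1E derive_val; exact: g0.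
- apply: continuous_in_subspaceT => x; rewrite inE/= in_itv/= => /fg.
  exact: is_derive_continuous.
Qed.

Lemma is_derive_atan_div k : 0 < k ->
  is_derive k 1 (fun k => atan (sigma / k)) (- (sigma / (k ^+ 2 + sigma ^+ 2))).
Proof.
move=> k0; have kn0 : k != 0 by rewrite gt_eqF.
have dV : is_derive k 1 (fun y => y^-1) (- (k ^+ 2)^-1).
  have := @is_deriveV R id k 1 1 kn0 (is_derive_id _ _).
  by move=> h; apply: (is_derive_eq h); rewrite /GRing.scale/= mulr1.
have dq : is_derive k 1 (fun y => sigma / y) (- (sigma / k ^+ 2)).
  by dsolve; ring.
apply: (is_derive_eq (is_derive_fcomp _ _ _ _ _ (is_derive1_atan _) dq)).
have D0 : k ^+ 2 + sigma ^+ 2 != 0 by rewrite gt_eqF// addr_gt0// exprn_gt0.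
have -> : 1 + (sigma / k) ^+ 2 = (k ^+ 2 + sigma ^+ 2) / k ^+ 2 by field.
by field; rewrite kn0 D0.
Qed.

Definition phase k := k - 2 * atan (sigma / k).

Definition dphase k := 1 + 2 * (sigma / (k ^+ 2 + sigma ^+ 2)).

Lemma is_derive_phase k : 0 < k -> is_derive k 1 phase (dphase k).
Proof.
by move=> k0; have ? := is_derive_atan_div _ k0; rewrite /phase /dphase; dsolve; ring.
Qed.

Lemma phase_lt k k' : 0 < k -> k < k' -> phase k < phase k'.
Proof.
move=> k0 kk'.
have D x : k <= x <= k' -> is_derive x 1 phase (dphase x).
  by move=> /andP[kx _]; apply: is_derive_phase; exact: lt_le_trans kx.
apply: (is_derive_lt phase dphase _ _ D _ kk') => x /andP[kx _].
rewrite /dphase addr_gt0// mulr_gt0// divr_gt0// addr_gt0// exprn_gt0//.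
exact: lt_le_trans kx.
Qed.

Lemma phase_gtNpi k : 0 < k -> - pi < phase k.
Proof.
move=> k0; rewrite /phase; have := atan_ltpi2 (sigma / k); lra.
Qed.

(** The lower bound, satisfied by the phase, excludes the negative multiples of pi. *)
Lemma sin_eq0_natpi x : - pi < x -> sin x = 0 -> exists n, x = n%:R * pi.
Proof.
move=> xpi sx; have [x0|x0] := leP 0 x; last first.
  have : 0 < sin (- x) by apply: sin_gt0_pi; rewrite oppr_gt0 x0 ltrNl.
  by rewrite sinN sx oppr0 ltxx.
have pi0 : 0 < (pi : R) by exact: pi_gt0.
have /Num.Theory.truncn_itv /andP[n1 n2] : 0 <= x / pi by rewrite divr_ge0// ltW.
set n := Num.truncn _ in n1 n2; exists n.
have y0 : 0 <= x - n%:R * pi by rewrite subr_ge0 -ler_pdivlMr.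
have y1 : x - n%:R * pi < pi.
  by rewrite ltrBlDl -{2}[pi]mul1r -mulrDl natr1 -ltr_pdivrMr.
have sy : sin (x - n%:R * pi) = 0.
  have := alternatingn (@sinDpi R) n (x - n%:R * pi).
  have -> : x - n%:R * pi + pi *+ n = x by rewrite -[pi *+ n]mulr_natl subrK.
  rewrite sx => /esym/eqP.
  by rewrite mulf_eq0 signr_eq0 => /eqP.
apply/eqP; rewrite -subr_eq0; apply/eqP; move: y0; rewrite le_eqVlt => /predU1P[//|y0].
have : 0 < sin (x - n%:R * pi) by apply: sin_gt0_pi; rewrite y0 y1.
by rewrite sy ltxx.
Qed.

(** With t = atan (sigma / k), the boundary expression at 1 multiplied by (cos t)^2 equals - k sin
    (k - 2 t), and k - 2 t is the phase. This is where the phase comes from. *)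
Lemma robin_frequencyP k : robin_frequency sigma k <->
  0 < k /\ exists n, phase k = n%:R * pi.
Proof.
pose t := atan (sigma / k).
have ct : cos t != 0.
  by rewrite gt_eqF// cos_gt0_pihalf// atan_gtNpi2 atan_ltpi2.
have tt : sin t = sigma / k * cos t.
  by rewrite -[sigma / k in RHS](@atanK R) -/t /tan divfK.
have E : 0 < k -> cos t ^+ 2 * (dmode sigma k 1 + sigma * mode sigma k 1) =
    - k * sin (k - t *+ 2).
  move=> k0; have kn0 : k != 0 by rewrite gt_eqF.
  rewrite sinB sin_mulr2n cos_mulr2n /mode /dmode !mulr1.
  have := cos2Dsin2 t; rewrite tt; set c := cos t; set C := cos k; set S := sin k => cs.
  rewrite -[in RHS](mulr1n (1 : R)) -{1}cs; field.
  done.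
have phE : phase k = k - t *+ 2 by rewrite /phase -/t mulr2n; ring.
split=> [[k0 kE]|[k0 [n nE]]]; split => //.
  apply: sin_eq0_natpi; first exact: phase_gtNpi.
  have := E k0; rewrite kE mulr0 -phE => /esym/eqP.
  by rewrite mulf_eq0 oppr_eq0 gt_eqF//= => /eqP.
have := E k0; rewrite -phE nE.
have -> : sin (n%:R * pi) = 0 :> R.
  have := alternatingn (@sinDpi R) n 0; rewrite add0r -[pi *+ n]mulr_natl => ->.
  by rewrite sin0 mulr0.
by rewrite mulr0 => /eqP; rewrite mulf_eq0 expf_eq0/= (negbTE ct) => /eqP.
Qed.

Lemma phase_root_exists n : exists2 k, 0 < k & phase k = n%:R * pi.
Proof.
have pi0 : 0 < (pi : R) by exact: pi_gt0.
(* From a <= sigma follows atan (sigma / a) >= pi / 4, and then a <= pi / 4 gives a phase at most 0.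
   At [b] the term n pi + pi outweighs 2 atan, which is less than pi. *)
pose a := Num.min sigma (pi / 4).
have a0 : 0 < a by rewrite lt_min sigma_gt0 divr_gt0.
pose b : R := n%:R * pi + pi + a.
have n0 : 0 <= n%:R * pi :> R by rewrite mulr_ge0// ltW.
have ab : a <= b by rewrite /b lerDr addr_ge0// ltW.
have ha : phase a <= n%:R * pi.
  apply: le_trans n0; rewrite /phase subr_le0.
  have h1 : pi / 4 <= atan (sigma / a).
    rewrite -atan1; apply: le_atan; rewrite ler_pdivlMr// mul1r.
    by rewrite /a ge_min lexx.
  have h2 : a <= pi / 4 by rewrite /a ge_min lexx orbT.
  lra.
have hb : n%:R * pi <= phase b.
  by rewrite /phase /b; have := atan_ltpi2 (sigma / b); rewrite /b; lra.
have cph : {within `[a, b], continuous phase}.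
  apply: continuous_in_subspaceT => x; rewrite inE/= in_itv/= => /andP[ax _].
  exact: (is_derive_continuous _ _ _ (is_derive_phase _ (lt_le_trans a0 ax))).
have [|k kab kE] := IVT ab cph (v := n%:R * pi).
  by rewrite ge_min le_max ha hb orbT.
exists k => //; apply: lt_le_trans a0 _.
by move: kab; rewrite in_itv/= => /andP[].
Qed.

End robin_phase.

(** * The one-dimensional eigenvalues and their numbering *)

Section robin_eigenvalues_1d.
Context {R : realType}.
Variable sigma : R.
Hypothesis sigma_gt0 : 0 < sigma.
Implicit Types (k x lambda : R) (n m : nat).

(** If lambda <= 0, the function phi phi' is nondecreasing, because its derivative is phi'^2 -
    lambda phi^2. It starts at sigma phi(0)^2 >= 0 and ends at - sigma phi(1)^2 <= 0, so it
    vanishes; thus phi^2 is constant and equal to phi(0)^2 = 0. *)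
Lemma robin1_eigenvalue_gt0 lambda : robin1_eigenvalue sigma lambda -> 0 < lambda.
Proof.
move=> [phi [dphi [[cp cd] D b0 b1 [z z01 pz]]]].
rewrite ltNge; apply/negP => l0.
have sub01 x : x <= 1 -> `[0, x] `<=` `[0, 1].
  by move=> x1; apply: subset_itvl; rewrite bnd_simp.
have sub10 x : 0 <= x -> `[x, 1] `<=` `[0, 1].
  by move=> x0; apply: subset_itvr; rewrite bnd_simp.
pose P x := phi x * dphi x.
pose dP x := dphi x ^+ 2 - lambda * phi x ^+ 2.
have cP : {within `[0, 1], continuous P}.
  by move=> x; apply: cvgM; [exact: cp|exact: cd].
have DP x : x \in `]0, 1[ -> is_derive x 1 P (dP x).
  by move=> /D[? ?]; rewrite /P /dP; dsolve; ring.
have dP0 x : 0 <= dP x.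
  by rewrite /dP subr_ge0 (le_trans _ (sqr_ge0 _))// mulr_le0_ge0// sqr_ge0.
have mono x : 0 <= x <= 1 -> P 0 <= P x <= P 1.
  move=> /andP[x0 x1]; apply/andP; split.
    have DPx y : y \in `]0, x[ -> is_derive y 1 P (dP y).
      by rewrite in_itv/= => /andP[y0 yx]; apply: DP; rewrite in_itv/= y0 (lt_le_trans yx).
    have cPx := continuous_subspaceW (sub01 _ x1) cP.
    exact: (is_derive_nondecreasing P dP 0 x DPx cPx (fun y _ => dP0 y) x0).
  have DPx y : y \in `]x, 1[ -> is_derive y 1 P (dP y).
    by rewrite in_itv/= => /andP[y0 yx]; apply: DP; rewrite in_itv/= yx (le_lt_trans _ y0).
  have cPx := continuous_subspaceW (sub10 _ x0) cP.
  exact: (is_derive_nondecreasing P dP x 1 DPx cPx (fun y _ => dP0 y) x1).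
have d0 : dphi 0 = sigma * phi 0.
  by move/eqP: b0; rewrite addrC subr_eq0 => /eqP.
have d1 : dphi 1 = - (sigma * phi 1).
  by move/eqP: b1; rewrite addr_eq0 => /eqP.
have P0 : P 0 = sigma * phi 0 ^+ 2.
  by rewrite /P d0; ring.
have P1 : P 1 = - (sigma * phi 1 ^+ 2).
  by rewrite /P d1; ring.
have x11 : 0 <= (1 : R) <= 1 by rewrite ler01 lexx.
have /andP[P01 _] := mono 1 x11.
have q0 : 0 <= sigma * phi 0 ^+ 2 by rewrite mulr_ge0 ?sqr_ge0// ltW.
have q1 : 0 <= sigma * phi 1 ^+ 2 by rewrite mulr_ge0 ?sqr_ge0// ltW.
move: P01; rewrite P0 P1 => P01.
have q01 : sigma * phi 0 ^+ 2 = 0 /\ sigma * phi 1 ^+ 2 = 0.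
  have : sigma * phi 0 ^+ 2 + sigma * phi 1 ^+ 2 == 0.
    by rewrite eq_le addr_ge0// andbT -lerBrDr sub0r.
  by rewrite paddr_eq0// => /andP[/eqP ? /eqP ?].
have [Z0 Z1] := q01.
have PZ x : 0 <= x <= 1 -> P x = 0.
  by move=> /mono; rewrite P0 P1 Z0 Z1 oppr0 => /le_anti.
have phi0 : phi 0 = 0.
  by move/eqP: Z0; rewrite mulf_eq0 gt_eqF//= sqrf_eq0 => /eqP.
move: z01; rewrite in_itv/= => /andP[z0 z1].
have cst : phi 0 ^+ 2 = phi z ^+ 2.
  have Dp2 y : y \in `]0, z[ -> is_derive y 1 (fun x => phi x ^+ 2) (2 * P y).
    rewrite in_itv/= => /andP[y0 yz].
    have [? ?] : is_derive y 1 phi (dphi y) /\ is_derive y 1 dphi (- (lambda * phi y)).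
      by apply: D; rewrite in_itv/= y0 (lt_le_trans yz).
    by rewrite /P; dsolve; ring.
  have cp2 : {within `[0, z], continuous (fun x => phi x ^+ 2)}.
    rewrite (_ : (fun x => phi x ^+ 2) = (fun x => phi x * phi x)); last first.
      by apply/funext => x; rewrite expr2.
    by apply: continuous_subspaceW (sub01 _ z1) _ => y; apply: cvgM; exact: cp.
  have P2 y : y \in `]0, z[ -> 2 * P y = 0.
    rewrite in_itv/= => /andP[y0 yz]; rewrite PZ ?mulr0//.
    by rewrite (ltW y0) (le_trans (ltW yz)).
  exact: (is_derive_eq0_constant _ _ 0 z Dp2 cp2 P2 z0).
move: pz; rewrite -sqrf_eq0 -cst phi0 expr0n eqxx; done.
Qed.

Lemma robin1_eigenvalueP lambda : robin1_eigenvalue sigma lambda <->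
  exists2 k, robin_frequency sigma k & lambda = k ^+ 2.
Proof.
split=> [le|[k [k0 kE] ->]]; last first.
  have kn0 : k != 0 by rewrite gt_eqF.
  exists (mode sigma k), (dmode sigma k); split.
  - by split; apply: continuous_subspaceT; [exact: continuous_mode|exact: continuous_dmode].
  - by move=> x _; split; [exact: is_derive_mode|exact: is_derive_dmode].
  - by rewrite dmode0 mode0 mulr1 addNr.
  - exact: kE.
  - by exists 0; rewrite ?mode0 ?oner_neq0// in_itv/= lexx ler01.
have l0 := robin1_eigenvalue_gt0 _ le.
have [phi [dphi [[cp cd] D b0 b1 [z z01 pz]]]] := le.
pose k := Num.sqrt lambda.
have k0 : 0 < k by rewrite sqrtr_gt0.
have kn0 : k != 0 by rewrite gt_eqF.
have lE : lambda = k ^+ 2 by rewrite sqr_sqrtr// ltW.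
have sub01 x : x <= 1 -> `[0, x] `<=` `[0, 1].
  by move=> x1; apply: subset_itvl; rewrite bnd_simp.
(* The rotating coordinates of (phi, phi' / k) are constant along a solution. Evaluating them at 0
   shows that phi is phi(0) times the mode. *)
pose A x := phi x * cos (k * x) - dphi x * (sin (k * x) / k).
pose B x := phi x * sin (k * x) + dphi x * (cos (k * x) / k).
have wc (f : R -> R) (E : set R) : continuous f -> {within E, continuous f}.
  exact: continuous_subspaceT.
have cA : {within `[0, 1], continuous A}.
  move=> x; apply: cvgB; apply: cvgM; [exact: cp| |exact: cd|].
    by apply: (wc (fun x => cos (k * x))); csolve.
  by apply: (wc (fun x => sin (k * x) / k)); csolve.
have cB : {within `[0, 1], continuous B}.
  move=> x; apply: cvgD; apply: cvgM; [exact: cp| |exact: cd|].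
    by apply: (wc (fun x => sin (k * x))); csolve.
  by apply: (wc (fun x => cos (k * x) / k)); csolve.
have DA x : x \in `]0, 1[ -> is_derive x 1 A 0.
  by move=> /D[? ?]; rewrite /A; dsolve; rewrite lE; field.
have DB x : x \in `]0, 1[ -> is_derive x 1 B 0.
  by move=> /D[? ?]; rewrite /B; dsolve; rewrite lE; field.
have sub x y : x <= 1 -> y \in `]0, x[ -> y \in `]0, 1[.
  by move=> x1; rewrite !in_itv/= => /andP[-> yx]; exact: lt_le_trans x1.
have Ax x : 0 <= x <= 1 -> A x = phi 0.
  move=> /andP[x0 x1].
  have DAx y : y \in `]0, x[ -> is_derive y 1 A 0 by move=> /(sub _ _ x1)/DA.
  have cAx := continuous_subspaceW (sub01 _ x1) cA.
  rewrite -(is_derive_eq0_constant A (fun=> 0) 0 x DAx cAx (fun y _ => erefl) x0).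
  by rewrite /A mulr0 cos0 sin0 mul0r mulr0 subr0 mulr1.
have Bx x : 0 <= x <= 1 -> B x = sigma / k * phi 0.
  move=> /andP[x0 x1].
  have DBx y : y \in `]0, x[ -> is_derive y 1 B 0 by move=> /(sub _ _ x1)/DB.
  have cBx := continuous_subspaceW (sub01 _ x1) cB.
  rewrite -(is_derive_eq0_constant B (fun=> 0) 0 x DBx cBx (fun y _ => erefl) x0).
  rewrite /B mulr0 cos0 sin0 mulr0 add0r.
    have -> : dphi 0 = sigma * phi 0.
      by move/eqP: b0; rewrite addrC subr_eq0 => /eqP.
  by field.
have phiE x : 0 <= x <= 1 -> phi x = phi 0 * mode sigma k x.
  move=> x01; have := Ax x x01; have := Bx x x01; rewrite /A /B /mode.
  have := cos2Dsin2 (k * x); set c := cos _; set s := sin _ => cs hB hA.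
  have -> : phi 0 * (c + sigma / k * s) = phi 0 * c + sigma / k * phi 0 * s by ring.
  rewrite -hB -hA -[LHS]mulr1 -cs; field.
  done.
have dphiE x : 0 <= x <= 1 -> dphi x = phi 0 * dmode sigma k x.
  move=> x01; have := Ax x x01; have := Bx x x01; rewrite /A /B /dmode.
  have := cos2Dsin2 (k * x); set c := cos _; set s := sin _ => cs hB hA.
  have -> : phi 0 * (sigma * c - k * s) = k * (sigma / k * phi 0 * c - phi 0 * s) by field.
  rewrite -hB -hA -[LHS]mulr1 -cs; field.
  done.
have phi0 : phi 0 != 0.
  apply/negP => /eqP phi0; move: pz; rewrite phiE ?phi0 ?mul0r ?eqxx//.
exists k => //; split => //.
have x11 : 0 <= (1 : R) <= 1 by rewrite ler01 lexx.
have := b1; rewrite phiE// dphiE// mulrCA -mulrDr => /eqP.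
by rewrite mulf_eq0 (negbTE phi0) => /eqP.
Qed.

(** This matches two numberings. If [K m] is the unique point of phase m pi, the eigenvalues are the
    strictly increasing values K(m)^2, so exactly n of them lie below K(n)^2. *)
Lemma robin_freqP n : robin_frequency sigma (robin_freq sigma n) /\
  phase sigma (robin_freq sigma n) = n%:R * pi.
Proof.
have /choice[K HK] : forall n, exists k, 0 < k /\ phase sigma k = n%:R * pi.
  by move=> m; have [k k0 kE] := phase_root_exists _ sigma_gt0 m; exists k.
have pi0 : 0 < (pi : R) by exact: pi_gt0.
have Kinj k m : 0 < k -> phase sigma k = m%:R * pi -> k = K m.
  move=> k0 kE; have [Km0 KmE] := HK m.
  apply/eqP; rewrite eq_le !leNgt; apply/andP; split; apply/negP => lt.
    by have := phase_lt _ sigma_gt0 _ _ Km0 lt; rewrite kE KmE ltxx.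
  by have := phase_lt _ sigma_gt0 _ _ k0 lt; rewrite kE KmE ltxx.
have Klt i j : (K i < K j) = (i < j)%N.
  have [ij|ji|->] := ltngtP i j; last by rewrite ltxx.
  - rewrite ltNge le_eqVlt; apply/negP => /predU1P[KE|lt].
      have := (HK j).2; rewrite KE (HK i).2 => /eqP.
      by rewrite (inj_eq (mulIf (lt0r_neq0 pi0))) eqr_nat ltn_eqF.
    have := phase_lt _ sigma_gt0 _ _ (HK j).1 lt.
    by rewrite (HK i).2 (HK j).2 ltr_pM2r// ltr_nat ltnNge ltnW.
  - apply/negP => lt; have := phase_lt _ sigma_gt0 _ _ (HK i).1 lt.
    by rewrite (HK i).2 (HK j).2 ltr_pM2r// ltr_nat ltnNge ltnW.
have Ksq i j : (K i ^+ 2 < K j ^+ 2) = (i < j)%N.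
  by rewrite -Klt ltr_sqr ?nnegrE ?(ltW (HK _).1).
have evP lambda : robin1_eigenvalue sigma lambda <-> exists m, lambda = K m ^+ 2.
  rewrite robin1_eigenvalueP; split => [[k /(robin_frequencyP sigma _)[k0 [m kE]] ->]|[m ->]].
    by exists m; rewrite (Kinj k m).
  exists (K m) => //; apply/(robin_frequencyP sigma _); split; first exact: (HK m).1.
  by exists m; exact: (HK m).2.
have below m : [set l : R | robin1_eigenvalue sigma l /\ l < K m ^+ 2] =
    (fun i => K i ^+ 2) @` `I_m.
  apply/seteqP; split => l /=.
    by move=> [/evP[i ->]]; rewrite Ksq => im; exists i.
  by move=> [i im <-]; split; [apply/evP; exists i|rewrite Ksq].
have card m : ([set l : R | robin1_eigenvalue sigma l /\ l < K m ^+ 2] #= `I_m)%card.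
  rewrite below; apply: inj_card_eq => i j _ _ E.
  by case: (ltngtP i j) => // lt; have := lt; rewrite -Ksq E ltxx.
(* The set under [xget] is the singleton of K(n)^2, so the default value 0 does not occur. *)
have -> : robin_freq sigma n = K n.
  rewrite /robin_freq /robin1_nth_eigenvalue.
  rewrite [X in Num.sqrt X](_ : _ = K n ^+ 2).
    by rewrite sqrtr_sqr gtr0_norm// (HK n).1.
  apply: xget_unique => [|l [/evP[m ->] cm]].
    by split; [apply/evP; exists n|exact: card].
  have : (`I_m #= `I_n)%card by apply: card_eq_trans cm; rewrite card_eq_sym; exact: card.
  by move=> /card_eq_II ->.
split; last exact: (HK n).2.
by apply/(robin_frequencyP sigma _); split; [exact: (HK n).1|exists n; exact: (HK n).2].
Qed.

End robin_eigenvalues_1d.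

(** * Spacing of the frequencies and the bound on multiplicities *)

Section robin_frequencies.
Context {R : realType}.
Variable sigma : R.
Hypothesis sigma_gt0 : 0 < sigma.
Implicit Types (k x : R) (n m i j : nat).
Local Notation freq := (robin_freq sigma).

Lemma freq_gt0 n : 0 < freq n.
Proof. by have [[]] := robin_freqP _ sigma_gt0 n. Qed.

Lemma freq_phase n : phase sigma (freq n) = n%:R * pi.
Proof. by have [] := robin_freqP _ sigma_gt0 n. Qed.

Lemma freq_lt i j : (i < j)%N -> freq i < freq j.
Proof.
move=> ij; rewrite ltNge le_eqVlt; apply/negP => /predU1P[E|lt].
  have := freq_phase j; rewrite E freq_phase => /eqP.
  by rewrite (inj_eq (mulIf (lt0r_neq0 (pi_gt0 R)))) eqr_nat ltn_eqF.
have := phase_lt _ sigma_gt0 _ _ (freq_gt0 j) lt.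
by rewrite !freq_phase ltr_pM2r ?pi_gt0// ltr_nat ltnNge ltnW.
Qed.

Lemma freq_inj : injective freq.
Proof.
by move=> i j E; case: (ltngtP i j) => // /freq_lt; rewrite E ltxx.
Qed.

Lemma freq_le i j : (i <= j)%N -> freq i <= freq j.
Proof. by rewrite leq_eqVlt => /predU1P[->//|/freq_lt/ltW]. Qed.

Lemma freq_surj k : robin_frequency sigma k -> exists n, k = freq n.
Proof.
move=> /(robin_frequencyP sigma _)[k0 [n kE]]; exists n.
apply/eqP; rewrite eq_le !leNgt; apply/andP; split; apply/negP => lt.
  by have := phase_lt _ sigma_gt0 _ _ (freq_gt0 n) lt; rewrite kE freq_phase ltxx.
by have := phase_lt _ sigma_gt0 _ _ k0 lt; rewrite kE freq_phase ltxx.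
Qed.

(** The derivative 1 + 2 sigma / (k^2 + sigma^2) is at most 1 + 2 / sigma. As phases of distinct
    frequencies differ by at least pi, the frequencies cannot cluster. *)
Lemma phase_lipschitz k k' : 0 < k -> k <= k' ->
  phase sigma k' - phase sigma k <= (1 + 2 / sigma) * (k' - k).
Proof.
move=> k0 kk'.
pose f x := (1 + 2 / sigma) * x - phase sigma x.
pose g x := (1 + 2 / sigma) - dphase sigma x.
have D x : k <= x -> is_derive x 1 f (g x).
  move=> kx; have ? := is_derive_phase _ sigma_gt0 _ (lt_le_trans k0 kx).
  by rewrite /f /g; dsolve; ring.
have D1 x : x \in `]k, k'[ -> is_derive x 1 f (g x).
  by rewrite in_itv/= => /andP[/ltW kx _]; exact: D.
have cf : {within `[k, k'], continuous f}.
  apply: continuous_in_subspaceT => x; rewrite inE/= in_itv/= => /andP[kx _].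
  exact: is_derive_continuous (D x kx).
have g0 x : x \in `]k, k'[ -> 0 <= g x.
  rewrite in_itv/= => /andP[kx _]; rewrite /g /dphase subr_ge0 lerD2l.
  rewrite ler_pM2l// ler_pdivrMr; last first.
    by rewrite addr_gt0// exprn_gt0// (lt_trans k0).
  rewrite -ler_pdivrMl ?invr_gt0// invrK.
  by rewrite expr2 lerDr sqr_ge0.
have := is_derive_nondecreasing f g k k' D1 cf g0 kk'.
rewrite /f; lra.
Qed.

(** The first bound separates frequencies of equal sign. The second, which includes i = j, separates
    k_i from - k_j and rests on k_0 > 0. *)
Lemma freq_separated : exists2 gam : R, 0 < gam & forall i j,
  (i <> j -> gam <= `|freq i - freq j|) /\ gam <= freq i + freq j.
Proof.
have c0 : 0 < 1 + 2 / sigma by rewrite addr_gt0// divr_gt0.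
pose gam := Num.min (pi / (1 + 2 / sigma)) (freq 0).
exists gam; first by rewrite lt_min freq_gt0 divr_gt0// pi_gt0.
have gap i j : (i < j)%N -> gam <= freq j - freq i.
  move=> ij; rewrite /gam ge_min; apply/orP; left.
  rewrite ler_pdivrMr// mulrC.
  apply: le_trans (phase_lipschitz _ _ (freq_gt0 i) (ltW (freq_lt _ _ ij))).
  rewrite !freq_phase -mulrBl ler_peMl ?pi_ge0//.
  by rewrite -natrB ?(ltnW ij)// ler1n subn_gt0.
move=> i j; split.
  case: (ltngtP i j) => // ij _; have h := gap _ _ ij; apply: (le_trans h).
    by rewrite distrC ler_norm.
  exact: ler_norm.
rewrite /gam ge_min; apply/orP; right.
by rewrite (le_trans (freq_le _ _ (leq0n i)))// lerDl ltW// freq_gt0.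
Qed.

Lemma atan_ge0 x : 0 <= x -> 0 <= atan x :> R.
Proof. by move=> x0; rewrite -(@atan0 R); exact: le_atan. Qed.

Lemma atan_le_id x : 0 <= x -> atan x <= x.
Proof.
move=> x0.
pose f (y : R) := y - atan y.
pose g y : R := 1 - (1 + y ^+ 2)^-1.
have D (y : R) : is_derive y 1 f (g y).
  by have ? := is_derive1_atan y; rewrite /f /g; dsolve; ring.
have cf : {within `[0, x], continuous f}.
  by apply: continuous_subspaceT; exact: (is_derive_fcontinuous _ _ D).
have g0 y : y \in `]0, x[ -> 0 <= g y.
  move=> _; rewrite /g subr_ge0 invf_le1 ?lerDl ?sqr_ge0//.
  by rewrite ltr_pwDl// sqr_ge0.
have := is_derive_nondecreasing f g 0 x (fun y _ => D y) cf g0 x0.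
by rewrite /f atan0 subrr subr_ge0.
Qed.

Lemma atan_ge_div x : 0 <= x -> x / (1 + x ^+ 2) <= atan x.
Proof.
move=> x0.
pose f (y : R) := atan y - y / (1 + y ^+ 2).
pose g y : R := 2 * y ^+ 2 / (1 + y ^+ 2) ^+ 2.
have q0 y : 1 + y ^+ 2 != 0 :> R by rewrite gt_eqF// ltr_pwDl// sqr_ge0.
have D (y : R) : is_derive y 1 f (g y).
  have ? := is_derive1_atan y.
  have dq : is_derive y 1 (fun y : R => 1 + y ^+ 2) (2 * y) by dsolve; ring.
  have dV : is_derive y 1 (fun y => (1 + y ^+ 2)^-1) (- ((1 + y ^+ 2) ^+ 2)^-1 * (2 * y)).
    have := @is_deriveV R (fun y => 1 + y ^+ 2) y (2 * y) 1 (q0 y) dq.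
    by move=> h; apply: (is_derive_eq h).
  by rewrite /f /g; dsolve; field; exact: q0.
have cf : {within `[0, x], continuous f}.
  by apply: continuous_subspaceT; exact: (is_derive_fcontinuous _ _ D).
have g0 y : y \in `]0, x[ -> 0 <= g y.
  by move=> _; rewrite /g divr_ge0 ?sqr_ge0// mulr_ge0// sqr_ge0.
have := is_derive_nondecreasing f g 0 x (fun y _ => D y) cf g0 x0.
by rewrite /f atan0 mul0r subrr subr_ge0.
Qed.

(** With a = atan (sigma / k) and n pi = k - 2 a, the difference is 4 a k - 4 a^2, and a k <= sigma
    because atan x <= x. The lower bound uses k - 2 a >= 0. *)
Lemma freq_sqr_bounds n : 0 <= freq n ^+ 2 - (n%:R * pi) ^+ 2 <= 4 * sigma.
Proof.
have k0 := freq_gt0 n; have := freq_phase n; rewrite /phase => <-.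
set k := freq n in k0 *.
have ph0 : 0 <= k - 2 * atan (sigma / k).
  by have := freq_phase n; rewrite /phase -/k => ->; rewrite mulr_ge0// pi_ge0.
have a0 : 0 <= atan (sigma / k) by rewrite atan_ge0// divr_ge0// ltW.
have a1 : atan (sigma / k) * k <= sigma.
  by rewrite -ler_pdivlMr// atan_le_id// divr_ge0// ltW.
move: a0 a1 ph0; set a := atan _ => a0 a1 ph0.
have -> : k ^+ 2 - (k - 2 * a) ^+ 2 = 4 * (a * k) - 4 * a ^+ 2 by ring.
apply/andP; split; first by nra.
by have := sqr_ge0 a; lra.
Qed.

(** The derivative of the squared phase with respect to k^2, that is, phase times [dphase] divided
    by k. *)
Definition slope k := (1 - 2 * (atan (sigma / k) / k)) * dphase sigma k.

(** The first factor of the slope grows at rate at least 4 sigma / (x D) with D = x^2 + sigma^2, by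
    [atan_ge_div]; the second decreases at rate 4 sigma x / D^2, which is no larger since x^2 <= D.
    The inequality is strict because the growth is multiplied by [dphase] > 1. *)
Lemma slope_lt k k' : 0 < k -> k < k' -> slope k < slope k'.
Proof.
move=> k0 kk'.
pose a x := atan (sigma / x).
pose D x := x ^+ 2 + sigma ^+ 2.
pose dslope x := (2 * (sigma / (x * D x)) + 2 * (a x / x ^+ 2)) * (1 + 2 * (sigma / D x)) -
  (1 - 2 * (a x / x)) * (4 * sigma * x / D x ^+ 2).
have xgt0 x : k <= x <= k' -> 0 < x by move=> /andP[kx _]; exact: lt_le_trans kx.
have Dgt0 x : 0 < x -> 0 < D x by move=> x0; rewrite /D addr_gt0// exprn_gt0.
have Ds x : k <= x <= k' -> is_derive x 1 slope (dslope x).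
  move=> /xgt0 x0; have xn0 : x != 0 by rewrite gt_eqF.
  have D0 : D x != 0 by rewrite gt_eqF// Dgt0.
  have da := is_derive_atan_div _ sigma_gt0 _ x0.
  have dV : is_derive x 1 (fun y => y^-1) (- (x ^+ 2)^-1).
    have := @is_deriveV R id x 1 1 xn0 (is_derive_id _ _).
    by move=> h; apply: (is_derive_eq h); rewrite /GRing.scale/= mulr1.
  have dD : is_derive x 1 (fun y : R => y ^+ 2 + sigma ^+ 2) (2 * x) by dsolve; ring.
  have dW : is_derive x 1 (fun y => (y ^+ 2 + sigma ^+ 2)^-1) (- (D x ^+ 2)^-1 * (2 * x)).
    have := @is_deriveV R (fun y => y ^+ 2 + sigma ^+ 2) x (2 * x) 1 D0 dD.
    by move=> h; apply: (is_derive_eq h).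
  rewrite /slope /dphase /dslope /a; dsolve.
  rewrite -/(D x); field.
  by rewrite xn0 D0.
apply: (is_derive_lt slope dslope _ _ Ds _ kk') => x /xgt0 x0.
have xn0 : x != 0 by rewrite gt_eqF.
have D0 := Dgt0 x x0.
have ax0 : 0 <= a x / x by rewrite divr_ge0 ?(ltW x0)// atan_ge0// divr_ge0// ltW.
have ale : sigma / (x * D x) <= a x / x ^+ 2.
  have h : sigma / x / (1 + (sigma / x) ^+ 2) <= a x.
    by rewrite atan_ge_div// divr_ge0// ltW.
  rewrite ler_pdivlMr ?exprn_gt0//; apply: le_trans h.
  have -> : 1 + (sigma / x) ^+ 2 = D x / x ^+ 2 by rewrite /D; field.
  rewrite le_eqVlt; apply/orP; left; apply/eqP; field.
  by rewrite xn0 gt_eqF.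
rewrite /dslope subr_gt0.
set q := 4 * sigma * x / D x ^+ 2.
have q0 : 0 <= q by rewrite divr_ge0 ?sqr_ge0// !mulr_ge0// ltW.
apply: (@le_lt_trans _ _ q).
  by rewrite ler_piMl// lerBlDr lerDl mulr_ge0.
have u0 : 0 < sigma / (x * D x) by rewrite divr_gt0// mulr_gt0.
have w0 : 0 < sigma / D x by rewrite divr_gt0.
apply: (@le_lt_trans _ _ (4 * (sigma / (x * D x)))).
  have -> : q = 4 * (sigma / (x * D x)) * (x ^+ 2 / D x).
    by rewrite /q; field; rewrite xn0 gt_eqF.
  have xD : x ^+ 2 / D x <= 1 by rewrite ler_pdivrMr// mul1r lerDl sqr_ge0.
  by apply: ler_piMr => //; apply: mulr_ge0 => //; exact: ltW.
nra.
Qed.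

(* The function h(k)^2, with h the phase, is strictly convex in k^2. *)
Lemma phase_sqr_convex (a b c d : R) : 0 < a -> a <= b -> b <= c -> c < d ->
  d ^+ 2 - c ^+ 2 = b ^+ 2 - a ^+ 2 ->
  phase sigma b ^+ 2 - phase sigma a ^+ 2 < phase sigma d ^+ 2 - phase sigma c ^+ 2.
Proof.
move=> a0 ab bc cd E.
(* Subtracting the tangent at b, with k^2 as the variable, makes f decrease on [a, b] and increase
   on [c, d]. The subtracted terms have equal increments on the two intervals. *)
pose f x := phase sigma x ^+ 2 - slope b * x ^+ 2.
pose g x := 2 * x * (slope x - slope b).
have D x : a <= x -> is_derive x 1 f (g x).
  move=> ax; have x0 := lt_le_trans a0 ax; have xn0 : x != 0 by rewrite gt_eqF.
  have ? := is_derive_phase _ sigma_gt0 _ x0.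
  by rewrite /f /g; set S := slope b; rewrite /slope; dsolve; rewrite /phase; field.
have slope_le x y : a <= x -> x <= y -> slope x <= slope y.
  rewrite le_eqVlt => ax; rewrite le_eqVlt => /predU1P[->//|xy].
  apply/ltW/slope_lt => //.
  by case/predU1P: ax => [<-//|ax]; exact: lt_trans ax.
have fab : f b <= f a.
  rewrite -lerN2.
  have DN x : x \in `]a, b[ -> is_derive x 1 (fun x => - f x) (- g x).
    rewrite in_itv/= => /andP[ax _]; have ? := D x (ltW ax).
    by dsolve.
  have cN : {within `[a, b], continuous (fun x => - f x)}.
    apply: continuous_in_subspaceT => x; rewrite inE/= in_itv/= => /andP[ax _].
    by apply: cvgN; exact: is_derive_continuous (D x ax).
  have gN x : x \in `]a, b[ -> 0 <= - g x.
    rewrite in_itv/= => /andP[ax xb]; rewrite -mulrN mulr_ge0//.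
      by rewrite mulr_ge0// ltW// (lt_trans a0).
    by rewrite opprB subr_ge0 slope_le// ltW.
  exact: (is_derive_nondecreasing _ _ a b DN cN gN ab).
(* The derivative of f vanishes at c when c = b, so strict growth is claimed only on [e, d]. *)
pose e := (c + d) / 2.
have ce : c < e by rewrite /e; lra.
have ed : e < d by rewrite /e; lra.
have fce : f c <= f e.
  have Dce x : x \in `]c, e[ -> is_derive x 1 f (g x).
    by rewrite in_itv/= => /andP[/ltW cx _]; apply: D; rewrite (le_trans ab)// (le_trans bc).
  have cf : {within `[c, e], continuous f}.
    apply: continuous_in_subspaceT => x; rewrite inE/= in_itv/= => /andP[cx _].
    by apply: (is_derive_continuous _ _ _ (D x _)); rewrite (le_trans ab)// (le_trans bc).
  have g0 x : x \in `]c, e[ -> 0 <= g x.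
    rewrite in_itv/= => /andP[/ltW cx _].
    have x0 : 0 <= x by rewrite (le_trans _ cx)// (le_trans _ bc)// (le_trans _ ab)// ltW.
    by rewrite mulr_ge0// ?mulr_ge0// subr_ge0 slope_le// (le_trans bc).
  exact: (is_derive_nondecreasing _ _ c e Dce cf g0 (ltW ce)).
have fed : f e < f d.
  have b0 : 0 < b by exact: lt_le_trans ab.
  have be : b < e by exact: le_lt_trans ce.
  have Ded x : e <= x <= d -> is_derive x 1 f (g x).
    by move=> /andP[ex _]; apply: D; rewrite (le_trans ab)// (le_trans (ltW be)).
  apply: (is_derive_lt f g _ _ Ded _ ed) => x /andP[ex _].
  have bx := lt_le_trans be ex.
  apply: mulr_gt0; first by rewrite mulr_gt0// (lt_trans b0).
  by rewrite subr_gt0; exact: slope_lt.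
move: fab (le_lt_trans fce fed); rewrite /f.
set Pa := phase _ a; set Pb := phase _ b; set Pc := phase _ c; set Pd := phase _ d.
have -> : d ^+ 2 = c ^+ 2 + (b ^+ 2 - a ^+ 2) by rewrite -E; ring.
set S := slope b; rewrite !mulrDr mulrN; lra.
Qed.

(** If n < n', equality of the sums of squares forces m' < m, so k_n < k_n' <= k_m' < k_m. Equal
    eigenvalues mean equal increments of k^2 on the two outer gaps, and convexity then makes the
    increments of the squared phase differ, against the equality. *)
Lemma pair_inj n m n' m' : (n <= m)%N -> (n' <= m')%N ->
  square_eigenvalue sigma n m = square_eigenvalue sigma n' m' ->
  (n ^ 2 + m ^ 2 = n' ^ 2 + m' ^ 2)%N -> n = n' /\ m = m'.
Proof.
wlog : n m n' m' / (n <= n')%N => [H nm nm' EL EN|nn' nm nm' EL EN].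
  case: (leqP n n') => [nn'|/ltnW nn']; first exact: H.
  by have [-> ->] := H _ _ _ _ nn' nm' nm (esym EL) (esym EN).
move: nn'; rewrite leq_eqVlt => /predU1P[E|lt].
  split => //; move: EN; rewrite E => /addnI /eqP.
  by rewrite eqn_exp2r// => /eqP.
have mm' : (m' < m)%N.
  rewrite ltnNge; apply/negP => mm'; move: EN => /eqP; rewrite ltn_eqF//.
  by rewrite -addSn leq_add// ?leq_exp2r// ltn_exp2r.
exfalso.
have EF : freq m ^+ 2 - freq m' ^+ 2 = freq n' ^+ 2 - freq n ^+ 2.
  by move: EL; rewrite /square_eigenvalue; lra.
have := phase_sqr_convex _ _ _ _ (freq_gt0 n) (freq_le _ _ (ltnW lt))
  (freq_le _ _ nm') (freq_lt _ _ mm') EF.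
rewrite !freq_phase !exprMn -!mulrBl ltr_pM2r ?exprn_gt0 ?pi_gt0//.
have : (n%:R ^+ 2 + m%:R ^+ 2 : R) = n'%:R ^+ 2 + m'%:R ^+ 2.
  by rewrite -!natrX -!natrD EN.
lra.
Qed.

Lemma eq_of_modn_close (K N M : nat) : (N %% K = M %% K)%N ->
  (N < M + K)%N -> (M < N + K)%N -> N = M.
Proof.
wlog NM : N M / (N <= M)%N.
  by move=> H E h1 h2; case: (leqP N M) => [/H|/ltnW/H/(_ (esym E) h2 h1)]; first exact.
move=> /eqP E _ h; apply/eqP; rewrite eqn_leq NM /= -subn_eq0.
have : (K %| (M - N))%N by rewrite -(eqn_mod_dvd K NM) eq_sym.
by apply: contraLR; rewrite -lt0n => /gtnNdvd ->//; rewrite ltn_subLR.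
Qed.

(** For the pairs of one eigenvalue the numbers n^2 + m^2 are distinct and lie in a window shorter
    than K, so their residues modulo K are distinct. Residues avoid the choice of a smallest
    pair. *)
Lemma eigenpairs_card_le : exists K : nat, forall Lambda : R,
  ([set p : nat * nat | (p.1 <= p.2)%N /\
    square_eigenvalue sigma p.1 p.2 = Lambda] #<= `I_K)%card.
Proof.
(* Each squared frequency exceeds (n pi)^2 by at most 4 sigma, which leaves n^2 + m^2 a window of
   length 8 sigma / pi^2. The successor keeps the modulus positive. *)
pose K := (Num.bound (8 * sigma / pi ^+ 2 : R)).+1.
have pi2 : 0 < (pi : R) ^+ 2 by rewrite exprn_gt0// pi_gt0.
have KP : 8 * sigma / pi ^+ 2 < K%:R.
  apply: (@lt_le_trans _ _ (Num.bound (8 * sigma / pi ^+ 2 : R))%:R).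
    by apply: archi_boundP; apply: divr_ge0; [apply: mulr_ge0 => //; exact: ltW|exact: ltW].
  by rewrite ler_nat.
exists K => Lambda.
pose P := [set p : nat * nat | (p.1 <= p.2)%N /\ square_eigenvalue sigma p.1 p.2 = Lambda].
pose N (p : nat * nat) := (p.1 ^ 2 + p.2 ^ 2)%N.
have NR p : (N p)%:R * (pi : R) ^+ 2 = (p.1%:R * pi) ^+ 2 + (p.2%:R * pi) ^+ 2.
  by rewrite /N natrD !natrX; ring.
have Nbound p : P p -> (N p)%:R * (pi : R) ^+ 2 <= Lambda <= (N p)%:R * pi ^+ 2 + 8 * sigma.
  move=> [_ <-]; rewrite NR /square_eigenvalue.
  have := freq_sqr_bounds p.1; have := freq_sqr_bounds p.2.
  by move=> /andP[h1 h2] /andP[h3 h4]; apply/andP; split; lra.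
have Nclose p q : P p -> P q -> (N q < N p + K)%N.
  move=> /Nbound/andP[p1 p2] /Nbound/andP[q1 q2].
  rewrite -(ltr_nat R) natrD -(ltr_pM2r pi2) mulrDl.
  apply: le_lt_trans (_ : (N p)%:R * pi ^+ 2 + 8 * sigma < _); first exact: le_trans q1 p2.
  by rewrite ltrD2l -ltr_pdivrMr.
have inj p q : P p -> P q -> (N p %% K = N q %% K)%N -> p = q.
  move=> Pp Pq E.
  have EN : N p = N q.
    have := Nclose _ _ Pp Pq; have := Nclose _ _ Pq Pp.
    by move=> h1 h2; exact: (eq_of_modn_close _ _ _ E).
  case: p q Pp Pq EN {E} => [n m] [n' m'] [/= nm E1] [/= nm' E2] EN.
  by have [-> ->] := pair_inj _ _ _ _ nm nm' (etrans E1 (esym E2)) EN.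
pose f p := (N p %% K)%N.
have sub : f @` P `<=` `I_K by move=> _ [p _ <-] /=; rewrite ltn_mod.
apply: card_le_trans (subset_card_le sub).
have : (f @` P #= P)%card.
  by apply: inj_card_eq => p q /set_mem Pp /set_mem Pq; exact: inj.
by rewrite card_eq_le => /andP[].
Qed.

Lemma eigenpairs_finite : exists K : nat, forall Lambda : R,
  exists s : seq (nat * nat), [/\ uniq s, (size s <= K)%N &
    forall p, p \in s <-> (p.1 <= p.2)%N /\ square_eigenvalue sigma p.1 p.2 = Lambda].
Proof.
have [K HK] := eigenpairs_card_le; exists K => Lambda.
have fP : finite_set [set p : nat * nat | (p.1 <= p.2)%N /\
    square_eigenvalue sigma p.1 p.2 = Lambda].
  exact: card_le_finite (HK Lambda) (finite_II K).
exists (finmap.enum_fset (fset_set [set p : nat * nat | (p.1 <= p.2)%N /\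
    square_eigenvalue sigma p.1 p.2 = Lambda])); split.
- exact: finmap.fset_uniq.
- exact: geq_card_fset_set.
- by move=> p; rewrite -[p \in _]/(p \in fset_set _) in_fset_set// inE.
Qed.

Lemma K_square_lty : (K_square sigma < +oo)%E.
Proof.
have [K HK] := eigenpairs_card_le.
apply: (@le_lt_trans _ _ (K%:R%:E)); last exact: ltry.
apply: ge_ereal_sup => _ [Lambda _ <-].
rewrite /kappa_square /counting asboolT; last first.
  exact: card_le_finite (HK Lambda) (finite_II K).
by rewrite lee_fin ler_nat geq_card_fset_set.
Qed.

End robin_frequencies.

(** * Measurability and integrability on the square *)

Section measure_on_the_plane.
Context {R : realType}.
Local Notation mu := (@lebesgue_measure R).
Local Notation mR := (measurableTypeR R).
Local Notation plane := (R * R)%type.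
Local Notation S := (unit_square : set plane).
Implicit Types f g : plane -> R.

(** The measurable sets of the plane are those of the product, so an open set is written as a
    countable union of boxes with rational centres and radii 1 / (n + 1). Boxes that leave A are
    replaced by the empty set. *)
Lemma open_measurable_plane (A : set plane) : open A -> measurable (A : set (mR * mR)).
Proof.
move=> oA.
pose box (i : rat * rat * nat) : set (mR * mR) :=
  `]ratr i.1.1 - i.2.+1%:R^-1, ratr i.1.1 + i.2.+1%:R^-1[%classic `*`
  `]ratr i.1.2 - i.2.+1%:R^-1, ratr i.1.2 + i.2.+1%:R^-1[%classic.
pose F i : set (mR * mR) := if `[< box i `<=` A >] then box i else set0.
have -> : (A : set (mR * mR)) = \bigcup_i F i; last first.
  apply: countable_bigcupT_measurable => // i; rewrite /F; case: ifP => _ //.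
  by apply: measurableX; exact: measurable_itv.
apply/seteqP; split => [[x y] Axy|p [i _]]; last first.
  by rewrite /F; case: ifPn => // /asboolP; apply.
have /nbhs_ballP[e /= e0 He] : nbhs (x, y) A by exact: open_nbhs_nbhs.
(* Two points of a box of radius 1 / (n + 1) differ by less than 2 / (n + 1) < e in each
   coordinate. *)
pose n := Num.bound (2 / e).
have ne : 2 / n.+1%:R < e.
  have : 2 / e < n.+1%:R.
    apply: (@lt_le_trans _ _ n%:R); last by rewrite ler_nat.
    by apply: archi_boundP; rewrite divr_ge0// ltW.
  by rewrite !ltr_pdivrMr// mulrC.
have n0 : 0 < n.+1%:R^-1 :> R by rewrite invr_gt0.
have rat_near (z d : R) : 0 < d -> exists q : rat, ratr q - d < z < ratr q + d.
  move=> d0; have zz : z - d < z + d by lra.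
  have [q] := rat_in_itvoo zz.
  by rewrite in_itv/= => /andP[h1 h2]; exists q; apply/andP; split; lra.
have [q1 hq1] := rat_near x _ n0; have [q2 hq2] := rat_near y _ n0.
exists (q1, q2, n) => //; rewrite /F asboolT.
  by split; rewrite /= in_itv.
move=> [x' y'] []; rewrite /= !in_itv/= => hx hy; apply: He.
have ne' : n.+1%:R^-1 + n.+1%:R^-1 < e.
  by move: ne; rewrite [2 / _]mulr_natl mulr2n.
have near (a b c d : R) : c - d < a < c + d -> c - d < b < c + d -> d + d < e ->
    ball a e b.
  move=> /andP[h1 h2] /andP[h3 h4] h5; rewrite /ball/= ltr_norml; apply/andP; split; lra.
by split; [exact: near hq1 hx ne'|exact: near hq2 hy ne'].
Qed.

Lemma continuous_measurable_plane f (D : set (mR * mR)) : continuous f ->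
  measurable_fun D (f : mR * mR -> R).
Proof.
move=> cf; apply: measurable_funTS.
apply: (measurability _ (RGenOpens.measurableE R)).
move=> _ [_ [a [b ->] <-]]; rewrite setTI; apply: open_measurable_plane.
by move/continuousP : cf; apply; exact: interval_open.
Qed.

Lemma measurable_unit_square : measurable (S : set (mR * mR)).
Proof. by apply: measurableX; exact: measurable_itv. Qed.

Lemma plane_measure_unit_square : plane_measure S = 1%E.
Proof.
pose I : set R := `]0, 1[%classic.
have mI : measurable I by exact: measurable_itv.
have muI : mu I = 1%E.
  by rewrite /I lebesgue_measure_itv/= lte_fin ltr01 -EFinB subr0.
transitivity (mu I * mu I)%E; last by rewrite muI mule1.
exact: (product_measure1E mu mu mI mI).
Qed.

Lemma continuous_bounded_square f : continuous f ->
  exists2 M : R, 0 <= M & forall x y, 0 <= x <= 1 -> 0 <= y <= 1 -> `|f (x, y)| <= M.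
Proof.
move=> cf.
have : bounded_set (f @` (`[0, 1] `*` `[0, 1])).
  apply: compact_bounded; apply: continuous_compact.
    exact: continuous_subspaceT.
  by apply: compact_setX; exact: segment_compact.
move=> [M [Mr HM]]; exists (Num.max 0 (M + 1)); first by rewrite le_max lexx.
move=> x y x01 y01; rewrite le_max; apply/orP; right; apply: HM; first by rewrite ltrDl.
by exists (x, y) => //=; split; rewrite /= in_itv.
Qed.

Lemma unit_squareP (p : plane) : S p -> 0 <= p.1 <= 1 /\ 0 <= p.2 <= 1.
Proof.
by move=> []; rewrite /= !in_itv/= => /andP[/ltW -> /ltW ->] /andP[/ltW -> /ltW ->].
Qed.

Lemma continuous_integrable_square f : continuous f ->
  plane_measure.-integrable S (EFin \o f).
Proof.
move=> cf; apply: measurable_bounded_integrable.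
- exact: measurable_unit_square.
- by apply: (@le_lt_trans _ _ (plane_measure S)); rewrite // plane_measure_unit_square ltry.
- exact: continuous_measurable_plane.
- have [M M0 HM] := continuous_bounded_square _ cf.
  exists M; split => [|x Mx [a b] /unit_squareP[/= a01 b01]]; first exact: num_real.
  by rewrite (le_trans (HM _ _ a01 b01))// ltW.
Qed.

End measure_on_the_plane.

(** * Fubini's theorem and completeness of products of modes *)

Section fubini_on_the_square.
Context {R : realType}.
Local Notation mu := (@lebesgue_measure R).
Local Notation mR := (measurableTypeR R).
Local Notation plane := (R * R)%type.
Local Notation S := (unit_square : set plane).
Variable sigma : R.
Hypothesis sigma_gt0 : 0 < sigma.
Implicit Types f g : plane -> R.

Lemma integrable_restrict_square f : plane_measure.-integrable S (EFin \o f) ->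
  (mu \x mu)%E.-integrable setT (EFin \o (f \_ S : mR * mR -> R)).
Proof.
move=> fi; rewrite -restrict_EFin.
by apply/integrable_restrict => //=; rewrite ?setTI//; exact: measurable_unit_square.
Qed.

Lemma integral_square_mkcond f :
  (\int[plane_measure]_(p in S) (f p)%:E =
   \int[(mu \x mu)%E]_p ((f \_ S : mR * mR -> R) p)%:E)%E.
Proof.
rewrite integral_mkcond; apply: eq_integral => p _.
by rewrite restrict_EFin.
Qed.

Lemma restrict_square f x y : (f \_ S) (x, y) =
  if (0 < x < 1) && (0 < y < 1) then f (x, y) else 0.
Proof.
rewrite patchE; congr (if _ then _ else _).
by apply/idP/idP => [/set_mem[/=]|/andP[h1 h2]]; [rewrite !in_itv/= => -> ->|
  rewrite inE; split; rewrite /= in_itv].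
Qed.

Lemma integral_oo_cc (h : R -> R) : measurable_fun (`[0, 1]%classic : set R) h ->
  (\int[mu]_(x in `]0%R, 1%R[) (h x)%:E = \int[mu]_(x in `[0%R, 1%R]) (h x)%:E)%E.
Proof.
move=> mh; rewrite [RHS]integral_itv_bndoo//.
apply/measurable_EFinP; apply: measurable_funS mh => //.
exact: subset_itv_oo_cc.
Qed.

Definition square_int f : R := \int[plane_measure]_(p in S) f p.

Lemma continuous_slice1 f y : continuous f -> continuous (fun x => f (x, y)).
Proof.
move=> cf x; apply: (@continuous_comp _ _ _ (fun x => (x, y)) f); last exact: cf.
exact: (cvg_pair (F := nbhs x) (G := nbhs x) (H := nbhs y) (f := id) (g := fun=> y) cvg_id (cvg_cst y)).
Qed.

Lemma continuous_slice2 f x : continuous f -> continuous (fun y => f (x, y)).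
Proof.
move=> cf y; apply: (@continuous_comp _ _ _ (fun y => (x, y)) f); last exact: cf.
exact: (cvg_pair (F := nbhs y) (G := nbhs x) (H := nbhs y) (f := fun=> x) (g := id) (cvg_cst x) cvg_id).
Qed.

Lemma EFin_int01 (h : R -> R) : continuous h ->
  (\int[mu]_(x in `]0%R, 1%R[) (h x)%:E)%E = (int01 h)%:E.
Proof.
move=> ch; rewrite integral_oo_cc; last first.
  by apply: measurable_funTS; exact: continuous_measurable_fun.
rewrite /int01 /Rintegral fineK//; apply: integrable_fin_num => //.
exact: continuous_integrable_itv.
Qed.

Lemma square_int_fubini12 f : continuous f ->
  square_int f = int01 (fun x => int01 (fun y => f (x, y))).
Proof.
move=> cf; have fi := continuous_integrable_square _ cf.
have gi := integrable_restrict_square _ fi.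
pose g := f \_ S : mR * mR -> R.
have inner x : (\int[mu]_y (g (x, y))%:E)%E =
    ((fun x => int01 (fun y => f (x, y))) \_ `]0, 1[ x)%:E.
  rewrite patchE mem_setE in_itv/=; case: ifPn => x01.
    rewrite -EFin_int01; last exact: continuous_slice2.
    rewrite [RHS]integral_mkcond; apply: eq_integral => y _.
    by rewrite /g restrict_square x01/= !patchE mem_setE in_itv/=; case: ifP.
  rewrite -[RHS](@integral0 _ _ _ mu setT); apply: eq_integral => y _.
  by rewrite /g restrict_square (negbTE x01).
have E := integral12_prod_meas1 gi.
have mF := measurable_fubini_F gi.
(* This identification also yields the measurability of the inner integral as a function of x. *)
have Fe : fubini_F mu (EFin \o g) = EFin \o ((fun x => int01 (fun y => f (x, y))) \_ `]0, 1[).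
  by apply/funext => x; exact: inner.
have mh : measurable_fun (`]0, 1[%classic : set R) (fun x => int01 (fun y => f (x, y))).
  move: mF; rewrite Fe => /measurable_EFinP mF.
  by apply/(measurable_restrictT _ _).
rewrite /square_int /Rintegral integral_square_mkcond -[X in fine X]E Fe.
rewrite /int01 /Rintegral; congr fine.
rewrite integral_itv_bndoo; last exact/measurable_EFinP.
rewrite [RHS]integral_mkcond; apply: eq_integral => x _.
by rewrite restrict_EFin.
Qed.

Lemma square_int_fubini21 f : continuous f ->
  square_int f = int01 (fun y => int01 (fun x => f (x, y))).
Proof.
move=> cf; have fi := continuous_integrable_square _ cf.
have gi := integrable_restrict_square _ fi.
pose g := f \_ S : mR * mR -> R.
have inner y : (\int[mu]_x (g (x, y))%:E)%E =
    ((fun y => int01 (fun x => f (x, y))) \_ `]0, 1[ y)%:E.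
  rewrite patchE mem_setE in_itv/=; case: ifPn => y01.
    rewrite -EFin_int01; last exact: continuous_slice1.
    rewrite [RHS]integral_mkcond; apply: eq_integral => x _.
    by rewrite /g restrict_square y01 andbT !patchE mem_setE in_itv/=; case: ifP.
  rewrite -[RHS](@integral0 _ _ _ mu setT); apply: eq_integral => x _.
  by rewrite /g restrict_square (negbTE y01) andbF.
have E := integral21_prod_meas1 gi.
have mF := measurable_fubini_G gi.
have Fe : fubini_G mu (EFin \o g) = EFin \o ((fun y => int01 (fun x => f (x, y))) \_ `]0, 1[).
  by apply/funext => y; exact: inner.
have mh : measurable_fun (`]0, 1[%classic : set R) (fun y => int01 (fun x => f (x, y))).
  move: mF; rewrite Fe => /measurable_EFinP mF.
  by apply/(measurable_restrictT _ _).
rewrite /square_int /Rintegral integral_square_mkcond -[X in fine X]E Fe.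
rewrite /int01 /Rintegral; congr fine.
rewrite integral_itv_bndoo; last exact/measurable_EFinP.
rewrite [RHS]integral_mkcond; apply: eq_integral => y _.
by rewrite restrict_EFin.
Qed.

(** Completeness in one variable is used twice. The coefficient F_m(x) of the section at x is
    orthogonal to every mode, so it vanishes for almost every x; hence almost every section is
    orthogonal to all modes and vanishes almost everywhere. *)
Lemma mode_complete_square f : plane_measure.-integrable S (EFin \o f) ->
  (forall k l, robin_frequency sigma k -> robin_frequency sigma l ->
     square_int (fun p => f p * (mode sigma k p.1 * mode sigma l p.2)) = 0) ->
  {ae plane_measure, forall p, S p -> f p = 0}.
Proof.
move=> fi fo; have gi := integrable_restrict_square _ fi.
have aeF := ae_filter_ringOfSetsType mu.
have aeF2 := ae_filter_ringOfSetsType (mu \x mu)%E.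
pose g := f \_ S : mR * mR -> R.
have g0 x y : ~~ (0 < x < 1) -> g (x, y) = 0.
  by move=> /negbTE x01; rewrite /g restrict_square x01.
have g0' x y : ~~ (0 < y < 1) -> g (x, y) = 0.
  by move=> /negbTE y01; rewrite /g restrict_square y01 andbF.
have mg : measurable_fun setT g by apply/measurable_EFinP; exact: measurable_int gi.
pose psi n := mode sigma (robin_freq sigma n).
have psib n : exists2 M : R, 0 <= M & forall x, `|psi n x| <= M.
  exists (1 + (1 + (sigma / robin_freq sigma n) ^+ 2)).
    by rewrite addr_ge0// addr_ge0// sqr_ge0.
  move=> x; have := mode_sqr_le sigma (robin_freq sigma n) x.
  rewrite -/(psi n x) -(@real_normK _ (psi n x)) ?num_real//.
  have := normr_ge0 (psi n x); set b := `|_|; set B := (_ / _) ^+ 2 => b0 bB.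
  by have := sqr_ge0 (b - 1); nra.
have mpsi n : measurable_fun setT (psi n).
  by apply: continuous_measurable_fun; exact: continuous_mode.
have mpsi1 n : measurable_fun setT (fun p : mR * mR => psi n p.1).
  exact: (measurableT_comp (mpsi n) measurable_fst).
have mpsi2 n : measurable_fun setT (fun p : mR * mR => psi n p.2).
  exact: (measurableT_comp (mpsi n) measurable_snd).
have mulI (h : mR * mR -> R) (b : mR * mR -> R) :
    (mu \x mu)%E.-integrable setT (EFin \o h) -> measurable_fun setT b ->
    (exists2 M : R, 0 <= M & forall p, `|b p| <= M) ->
    (mu \x mu)%E.-integrable setT (EFin \o (fun p => h p * b p)).
  move=> hi mb [M M0 HM].
  rewrite (_ : EFin \o _ = ((EFin \o h) \* (EFin \o b))%E); last first.
    by apply/funext => p /=; rewrite EFinM.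
  apply: integrableMl => //; exists M; split => [|x Mx p _ /=]; first exact: num_real.
  exact: le_trans (HM p) (ltW Mx).
pose h m (p : mR * mR) : R := g p * psi m p.2.
have hi m : (mu \x mu)%E.-integrable setT (EFin \o h m).
  by apply: mulI => //; have [M M0 HM] := psib m; exists M.
pose hh n m (p : mR * mR) : R := h m p * psi n p.1.
have hhi n m : (mu \x mu)%E.-integrable setT (EFin \o hh n m).
  by apply: mulI => //; have [M M0 HM] := psib n; exists M.
pose F m x : R := \int[mu]_y h m (x, y).
have FE m x : F m x = fine (fubini_F mu (EFin \o h m) x) by [].
have Fi m : mu.-integrable setT (EFin \o F m).
  apply: (le_integrable _ _ _ (integrable_fubini_F (hi m))) => //.
    apply/measurable_EFinP; rewrite (_ : F m = fine \o fubini_F mu (EFin \o h m))//.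
    by apply: measurableT_comp => //; exact: measurable_fubini_F (hi m).
  move=> x _ /=; rewrite FE.
  by case: (fubini_F _ _ _) => [r||] //=; rewrite ?normr0 ?leey.
have slice_ok : {ae mu, forall x, mu.-integrable setT (fun y => (g (x, y))%:E)}.
  exact: ae_integrable1 gi.
have F0 m x : ~~ (0 < x < 1) -> F m x = 0.
  move=> x01; transitivity (\int[mu]_(y in setT) (0 : R)).
    by apply: eq_Rintegral => y _; rewrite /h g0// mul0r.
  by rewrite Rintegral_cst// mul0r.
have not_oo (x : R) : ~~ (0 <= x <= 1) -> ~~ (0 < x < 1).
  by apply: contra => /andP[/ltW -> /ltW ->].
have Fo m n : \int[mu]_(x in `[0, 1]) (F m x * psi n x) = 0.
  transitivity (\int[mu]_(x in setT) (F m x * psi n x)).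
    rewrite Rintegral_mkcond; apply: eq_Rintegral => x _.
    rewrite patchE mem_setE in_itv/=; case: ifPn => // /not_oo x01.
    by rewrite F0// mul0r.
  have [k0 l0] := (robin_freqP _ sigma_gt0 n, robin_freqP _ sigma_gt0 m).
  rewrite -[RHS](fo _ _ k0.1 l0.1) /square_int /Rintegral integral_square_mkcond; congr fine.
  transitivity (\int[mu]_x fubini_F mu (EFin \o hh n m) x)%E; last first.
    rewrite integral12_prod_meas1//; apply: eq_integral => p _ /=; congr (_%:E).
    rewrite /hh /h /g !patchE; case: ifP => _; last by rewrite !mul0r.
    by rewrite -mulrA [psi m _ * _]mulrC.
  apply: ae_eq_integral => //.
  - apply/measurable_EFinP; apply: measurable_funM => //.
    by apply/measurable_EFinP; exact: measurable_int (Fi m).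
    exact: mpsi.
  - exact: measurable_fubini_F (hhi n m).
  apply: filterS slice_ok => x gx _.
  have hx : mu.-integrable setT (fun y => (h m (x, y))%:E).
    rewrite (_ : (fun y => _) = ((fun y => (g (x, y))%:E) \* (EFin \o psi m))%E); last first.
      by apply/funext => y /=; rewrite EFinM.
    apply: integrableMl => //; first exact: mpsi.
    have [M M0 HM] := psib m; exists M; split => [|z Mz p _ /=]; first exact: num_real.
    exact: le_trans (HM p) (ltW Mz).
  rewrite /fubini_F /hh /= /F /Rintegral EFinM fineK; last exact: integrable_fin_num.
  rewrite -integralZr//; apply: eq_integral => y _.
have Fz m : {ae mu, forall x, 0 < x < 1 -> F m x = 0}.
  apply: (mode_complete_L1 sigma sigma_gt0).
    exact: integrableS (Fi m).
  by move=> k /(freq_surj _ sigma_gt0)[n ->]; exact: Fo.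
(* The modes are countable, so one null set of x serves all m. *)
have Fz' : {ae mu, forall x, forall m, 0 < x < 1 -> F m x = 0}.
  exact: ae_foralln.
have gz : {ae mu, forall x, (\int[mu]_y `|(g (x, y))%:E|)%E = 0%E}.
  apply: filterS2 slice_ok Fz' => x gx Fx.
  have [x01|x01] := boolP (0 < x < 1); last first.
    rewrite -[RHS](@integral0 _ _ _ mu setT); apply: eq_integral => y _.
    by rewrite g0// abse0.
  have /ae_eq_integral_abs : measurable_fun setT (fun y => (g (x, y))%:E).
    exact: measurable_int gx.
  move=> /(_ mu measurableT)[_]; apply.
  have : {ae mu, forall y, 0 < y < 1 -> g (x, y) = 0}.
    apply: (mode_complete_L1 sigma sigma_gt0); first exact: integrableS gx.
    move=> k /(freq_surj _ sigma_gt0)[m ->].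
    transitivity (F m x); last exact: Fx.
    rewrite Rintegral_mkcond; apply: eq_Rintegral => y _.
    rewrite patchE mem_setE in_itv/=; case: ifPn => // /not_oo y01.
    by rewrite /h g0'// mul0r.
  apply: filterS => y gy _; congr (_%:E).
  by have [/gy//|y01] := boolP (0 < y < 1); exact: g0'.
have : (\int[(mu \x mu)%E]_p `|(g p)%:E|)%E = 0%E.
  rewrite (fubini_tonelli1 (fun p => `|(g p)%:E|%E))//; last first.
    by apply: measurableT_comp => //; exact/measurable_EFinP.
  rewrite -[RHS](@integral0 _ _ _ mu setT); apply: ae_eq_integral => //.
    apply: (measurable_fun_fubini_tonelli_F (fun p => `|(g p)%:E|%E)) => //.
    by apply: measurableT_comp => //; exact/measurable_EFinP.
  by apply: filterS gz => x gx _.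
move/(ae_eq_integral_abs _ measurableT); move=> /(_ _)/wrap[].
  exact: measurable_int gi.
apply: filterS => p /(_ I)[gp] Sp; move: gp; rewrite /g patchE mem_set//.
Qed.

End fubini_on_the_square.

(** * Directional derivatives and smoothness of products of modes *)

Section directional_derivatives.
Context {R : realType}.
Local Notation plane := (R * R)%type.
Implicit Types (f w : plane -> R) (p e : plane) (x y t : R).

Lemma is_derive_line f p e d :
  is_derive (0 : R) 1 (fun t => f (t *: e + p)) d -> is_derive p e f d.
Proof.
move=> fd.
have E : (fun h : R => h^-1 *: (f (h *: e + p) - f p)) =
   (fun h : R => h^-1 *: (f ((h *: (1 : R) + 0) *: e + p) - f (0 *: e + p))).
  by apply/funext => h; rewrite addr0 -[h *: (1 : R)]/(h * 1) mulr1 scale0r add0r.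
apply: DeriveDef.
  by rewrite /derivable E; have := @ex_derive _ _ _ _ _ _ _ fd.
by rewrite /derive E; have := @derive_val _ _ _ _ _ _ _ fd.
Qed.

Lemma is_derive_slice_x f x y : derivable f (x, y) dir_x ->
  is_derive x 1 (fun t => f (t, y)) ('D_dir_x f (x, y)).
Proof.
move=> fd.
have E : (fun h : R => h^-1 *: (f (h *: dir_x + (x, y)) - f (x, y))) =
   (fun h : R => h^-1 *: (f (h *: (1 : R) + x, y) - f (x, y))).
  apply/funext => h; congr (_ *: (f _ - _)).
  by apply: injective_projections => //=; rewrite scaler0 add0r.
apply: DeriveDef; first by move: fd; rewrite /derivable E.
by rewrite /derive E.
Qed.

Lemma is_derive_slice_y f x y : derivable f (x, y) dir_y ->
  is_derive y 1 (fun t => f (x, t)) ('D_dir_y f (x, y)).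
Proof.
move=> fd.
have E : (fun h : R => h^-1 *: (f (h *: dir_y + (x, y)) - f (x, y))) =
   (fun h : R => h^-1 *: (f (x, h *: (1 : R) + y) - f (x, y))).
  apply/funext => h; congr (_ *: (f _ - _)).
  by apply: injective_projections => //=; rewrite scaler0 add0r.
apply: DeriveDef; first by move: fd; rewrite /derivable E.
by rewrite /derive E.
Qed.

(* Closed under all directional derivatives. *)
Definition wave (k l a b c d : R) (p : plane) : R :=
  a * (cos (k * p.1) * cos (l * p.2)) + b * (cos (k * p.1) * sin (l * p.2)) +
  c * (sin (k * p.1) * cos (l * p.2)) + d * (sin (k * p.1) * sin (l * p.2)).

Lemma is_derive_wave k l a b c d p e : is_derive p e (wave k l a b c d)
  (wave k l (b * l * e.2 + c * k * e.1) (- (a * l * e.2) + d * k * e.1)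
    (- (a * k * e.1) + d * l * e.2) (- (b * k * e.1) - c * l * e.2) p).
Proof.
apply: is_derive_line; rewrite /wave /=.
have -> : (fun t : R => a * (cos (k * (t * e.1 + p.1)) * cos (l * (t * e.2 + p.2))) +
    b * (cos (k * (t * e.1 + p.1)) * sin (l * (t * e.2 + p.2))) +
    c * (sin (k * (t * e.1 + p.1)) * cos (l * (t * e.2 + p.2))) +
    d * (sin (k * (t * e.1 + p.1)) * sin (l * (t * e.2 + p.2)))) =
  (fun t : R => a * (cos (k * (t * e.1 + p.1)) * cos (l * (t * e.2 + p.2))) +
    b * (cos (k * (t * e.1 + p.1)) * sin (l * (t * e.2 + p.2))) +
    c * (sin (k * (t * e.1 + p.1)) * cos (l * (t * e.2 + p.2))) +
    d * (sin (k * (t * e.1 + p.1)) * sin (l * (t * e.2 + p.2)))) by [].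
dsolve; rewrite !mul0r !add0r; ring.
Qed.

Lemma continuous_tensor (f g : R -> R) : continuous f -> continuous g ->
  continuous (fun p : plane => f p.1 * g p.2).
Proof.
move=> cf cg p; apply: cvgM.
  by apply: (@continuous_comp _ _ _ fst f); [exact: cvg_fst|exact: cf].
by apply: (@continuous_comp _ _ _ snd g); [exact: cvg_snd|exact: cg].
Qed.

Lemma continuous_wave k l a b c d : continuous (wave k l a b c d).
Proof.
have h (f g : R -> R) (q : R) : continuous f -> continuous g ->
    continuous (fun p : plane => q * (f p.1 * g p.2)).
  by move=> cf cg p; apply: cvgM; [exact: cvg_cst|exact: continuous_tensor].
move=> p; rewrite /wave.
by apply: cvgD; [apply: cvgD; [apply: cvgD|]|]; apply: (h (fun x => _ (k * x)) (fun y => _ (l * y))); csolve.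
Qed.

Lemma smooth_wave k l a b c d : smooth (wave k l a b c d).
Proof.
move=> s /=.
have [a' [b' [c' [d' ->]]]] : exists a' b' c' d',
    foldr (fun (e : plane) (h : plane -> R) => 'D_e h) (wave k l a b c d) s =
    wave k l a' b' c' d'.
  elim: s => [|e s [a' [b' [c' [d' /= ->]]]]]; first by exists a, b, c, d.
  do 4 eexists; apply/funext => p.
  have ? := is_derive_wave k l a' b' c' d' p e; rewrite derive_val; reflexivity.
split; first exact: continuous_wave.
by move=> p e; have ? := is_derive_wave k l a' b' c' d' p e; exact: ex_derive.
Qed.

Variable sigma : R.
Hypothesis sigma_gt0 : 0 < sigma.

Lemma smooth_mode2 k l : k != 0 -> l != 0 ->
  smooth (fun p : plane => mode sigma k p.1 * mode sigma l p.2).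
Proof.
move=> k0 l0; have := smooth_wave k l 1 (sigma / l) (sigma / k) (sigma / k * (sigma / l)).
rewrite (_ : wave _ _ _ _ _ _ = fun p : plane => mode sigma k p.1 * mode sigma l p.2)//.
by apply/funext => p; rewrite /wave /mode; ring.
Qed.

Lemma derive_mode2_x k l p : k != 0 ->
  is_derive p dir_x (fun p : plane => mode sigma k p.1 * mode sigma l p.2)
    (dmode sigma k p.1 * mode sigma l p.2).
Proof.
move=> k0; apply: is_derive_line => /=.
have ? := is_derive_mode sigma k p.1 k0.
have -> : (fun t : R => mode sigma k (t * 1 + p.1) * mode sigma l (t * 0 + p.2)) =
   (fun t : R => mode sigma k (t + p.1) * mode sigma l p.2).
  by apply/funext => t; rewrite mulr1 mulr0 add0r.
have H : is_derive (0 : R) 1 (fun t : R => mode sigma k (t + p.1)) (dmode sigma k p.1).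
  rewrite /mode /dmode; dsolve; rewrite !add0r; field; exact: k0.
dsolve; ring.
Qed.

Lemma derive_mode2_y k l p : l != 0 ->
  is_derive p dir_y (fun p : plane => mode sigma k p.1 * mode sigma l p.2)
    (mode sigma k p.1 * dmode sigma l p.2).
Proof.
move=> l0; apply: is_derive_line => /=.
have -> : (fun t : R => mode sigma k (t * 0 + p.1) * mode sigma l (t * 1 + p.2)) =
   (fun t : R => mode sigma k p.1 * mode sigma l (t + p.2)).
  by apply/funext => t; rewrite mulr1 mulr0 add0r.
have H : is_derive (0 : R) 1 (fun t : R => mode sigma l (t + p.2)) (dmode sigma l p.2).
  rewrite /mode /dmode; dsolve; rewrite !add0r; field; exact: l0.
dsolve; ring.
Qed.

End directional_derivatives.

(** * Green's identity for smooth functions against products of modes *)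

Section green_on_the_square.
Context {R : realType}.
Variable sigma : R.
Local Notation plane := (R * R)%type.
Local Notation S := (unit_square : set plane).
Implicit Types (f g w : plane -> R).

Lemma continuous_padd f g : continuous f -> continuous g ->
  continuous (fun p => f p + g p).
Proof. by move=> cf cg p; exact: cvgD (cf p) (cg p). Qed.

Lemma continuous_pmul f g : continuous f -> continuous g ->
  continuous (fun p => f p * g p).
Proof. by move=> cf cg p; exact: cvgM (cf p) (cg p). Qed.

Lemma continuous_pscale (a : R) f : continuous f -> continuous (fun p => a * f p).
Proof. by move=> cf; apply: continuous_pmul => // p; exact: cvg_cst. Qed.

Lemma square_int_add f g : plane_measure.-integrable S (EFin \o f) ->
  plane_measure.-integrable S (EFin \o g) ->
  square_int (fun p => f p + g p) = square_int f + square_int g.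
Proof.
by move=> fi gi; rewrite /square_int RintegralD//; exact: measurable_unit_square.
Qed.

Lemma square_int_scale (a : R) f : plane_measure.-integrable S (EFin \o f) ->
  square_int (fun p => a * f p) = a * square_int f.
Proof.
by move=> fi; rewrite /square_int RintegralZl//; exact: measurable_unit_square.
Qed.

Lemma eq_square_int f g : (forall p, S p -> f p = g p) -> square_int f = square_int g.
Proof. by move=> fg; apply: eq_Rintegral => p; rewrite inE; exact: fg. Qed.

Lemma green_x w (a a' b : R -> R) : continuous w -> continuous ('D_dir_x w) ->
  (forall p, derivable w p dir_x) -> continuous a' -> continuous b ->
  (forall x : R, is_derive x 1 a (a' x)) ->
  square_int (fun p => 'D_dir_x w p * (a p.1 * b p.2)) + square_int (fun p => w p * (a' p.1 * b p.2)) =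
  int01 (fun y => (w (1, y) * a 1 - w (0, y) * a 0) * b y).
Proof.
move=> cw cDw dw ca' cb aE; have ca : continuous a by exact: is_derive_fcontinuous aE.
rewrite -square_int_add; last 2 first.
- apply: continuous_integrable_square; apply: continuous_pmul => //.
  exact: continuous_tensor.
- apply: continuous_integrable_square; apply: continuous_pmul => //.
  exact: continuous_tensor.
rewrite square_int_fubini21; last first.
  by apply: continuous_padd; apply: continuous_pmul => //; exact: continuous_tensor.
apply: eq_int01 => y _ /=.
have Dw (x : R) : is_derive x 1 (fun t => w (t, y)) ('D_dir_x w (x, y)).
  exact: is_derive_slice_x.
have HF (x : R) : is_derive x 1 (fun x => w (x, y) * a x * b y)
    ('D_dir_x w (x, y) * (a x * b y) + w (x, y) * (a' x * b y)) by dsolve; ring.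
rewrite (int01_derive _ _ _ HF); last first.
  have c1 := continuous_slice1 _ y cw; have c2 := continuous_slice1 _ y cDw.
  by csolve.
by rewrite mulrBl.
Qed.

Lemma green_y w (a b b' : R -> R) : continuous w -> continuous ('D_dir_y w) ->
  (forall p, derivable w p dir_y) -> continuous b' -> continuous a ->
  (forall x : R, is_derive x 1 b (b' x)) ->
  square_int (fun p => 'D_dir_y w p * (a p.1 * b p.2)) + square_int (fun p => w p * (a p.1 * b' p.2)) =
  int01 (fun x => (w (x, 1) * b 1 - w (x, 0) * b 0) * a x).
Proof.
move=> cw cDw dw cb' ca bE; have cb : continuous b by exact: is_derive_fcontinuous bE.
rewrite -square_int_add; last 2 first.
- apply: continuous_integrable_square; apply: continuous_pmul => //.
  exact: continuous_tensor.
- apply: continuous_integrable_square; apply: continuous_pmul => //.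
  exact: continuous_tensor.
rewrite square_int_fubini12; last first.
  by apply: continuous_padd; apply: continuous_pmul => //; exact: continuous_tensor.
apply: eq_int01 => x _ /=.
have Dw (y : R) : is_derive y 1 (fun t => w (x, t)) ('D_dir_y w (x, y)).
  exact: is_derive_slice_y.
have HF (y : R) : is_derive y 1 (fun y => w (x, y) * b y * a x)
    ('D_dir_y w (x, y) * (a x * b y) + w (x, y) * (a x * b' y)) by dsolve; ring.
rewrite (int01_derive _ _ _ HF); last first.
  have c1 := continuous_slice2 _ x cw; have c2 := continuous_slice2 _ x cDw.
  by csolve.
by rewrite mulrBl.
Qed.

Definition mode2 k l (p : plane) := mode sigma k p.1 * mode sigma l p.2.
Definition dxmode2 k l (p : plane) := dmode sigma k p.1 * mode sigma l p.2.
Definition dymode2 k l (p : plane) := mode sigma k p.1 * dmode sigma l p.2.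

Lemma continuous_mode2 k l : continuous (mode2 k l).
Proof. by apply: continuous_tensor; exact: continuous_mode. Qed.

Lemma continuous_dxmode2 k l : continuous (dxmode2 k l).
Proof. by apply: continuous_tensor; [exact: continuous_dmode|exact: continuous_mode]. Qed.

Lemma continuous_dymode2 k l : continuous (dymode2 k l).
Proof. by apply: continuous_tensor; [exact: continuous_mode|exact: continuous_dmode]. Qed.

Definition bdry (t : plane -> R) (k l : R) : R :=
  \sum_(i < 4) int01 (fun s => t (side i s) * mode2 k l (side i s)).

Lemma smoothP w : smooth w -> [/\ continuous w, forall p e, derivable w p e &
  forall e, continuous ('D_e w)].
Proof.
move=> sw; have [c0 d0] := sw [::]; split => // e.
by have [] := sw [:: e].
Qed.

Lemma sides (t : plane -> R) : \sum_(i < 4) int01 (fun s => t (side i s)) =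
  int01 (fun s => t (0, s)) + int01 (fun s => t (1, s)) +
  int01 (fun s => t (s, 0)) + int01 (fun s => t (s, 1)).
Proof. by rewrite !big_ord_recl big_ord0 /side /= addr0 !addrA. Qed.

(** Integrate by parts in each variable, moving the derivative onto the differentiated mode. The
    Robin conditions turn the boundary terms into the boundary part of the form. *)
Lemma green_smooth w k l : smooth w -> robin_frequency sigma k -> robin_frequency sigma l ->
  square_int (fun p => 'D_dir_x w p * dxmode2 k l p) +
  square_int (fun p => 'D_dir_y w p * dymode2 k l p) + sigma * bdry w k l =
  (k ^+ 2 + l ^+ 2) * square_int (fun p => w p * mode2 k l p).
Proof.
move=> /smoothP[cw dw cDw] [k0 kE] [l0 lE].
have kn0 : k != 0 by rewrite gt_eqF.
have ln0 : l != 0 by rewrite gt_eqF.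
have [ck cl cdk cdl] : [/\ continuous (mode sigma k), continuous (mode sigma l),
  continuous (dmode sigma k) & continuous (dmode sigma l)].
  by split; [exact: continuous_mode..|exact: continuous_dmode|exact: continuous_dmode].
have k1 : dmode sigma k 1 = - (sigma * mode sigma k 1) by apply/eqP; rewrite -addr_eq0 kE.
have l1 : dmode sigma l 1 = - (sigma * mode sigma l 1) by apply/eqP; rewrite -addr_eq0 lE.
have cNk : continuous (fun x => - (k ^+ 2 * mode sigma k x)) by csolve.
have cNl : continuous (fun x => - (l ^+ 2 * mode sigma l x)) by csolve.
have ci := continuous_integrable_square _ (continuous_pmul _ _ cw (continuous_mode2 k l)).
have := green_x w (dmode sigma k) _ (mode sigma l) cw (cDw _) (fun p => dw p _) cNk cl
  (fun x => is_derive_dmode sigma k x kn0).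
have -> : (fun p => w p * (- (k ^+ 2 * mode sigma k p.1) * mode sigma l p.2)) =
   (fun p => - k ^+ 2 * (w p * mode2 k l p)).
  by apply/funext => p; rewrite /mode2; ring.
rewrite square_int_scale// -/(dxmode2 k l _).
have := green_y w (mode sigma k) (dmode sigma l) _ cw (cDw _) (fun p => dw p _) cNl ck
  (fun x => is_derive_dmode sigma l x ln0).
have -> : (fun p => w p * (mode sigma k p.1 * - (l ^+ 2 * mode sigma l p.2))) =
   (fun p => - l ^+ 2 * (w p * mode2 k l p)).
  by apply/funext => p; rewrite /mode2; ring.
rewrite square_int_scale//.
have -> : sigma * bdry w k l =
   - int01 (fun y => (w (1, y) * dmode sigma k 1 - w (0, y) * dmode sigma k 0) * mode sigma l y)
   - int01 (fun x => (w (x, 1) * dmode sigma l 1 - w (x, 0) * dmode sigma l 0) * mode sigma k x).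
  have c1 y := continuous_slice1 _ y cw; have c2 x := continuous_slice2 _ x cw.
  have c1y := c1 1; have c0y := c1 0; have c1x := c2 1; have c0x := c2 0.
  rewrite /bdry (sides (fun p => w p * mode2 k l p)) /mode2 /=.
  have -> : int01 (fun y => (w (1, y) * dmode sigma k 1 - w (0, y) * dmode sigma k 0) *
      mode sigma l y) =
      (- sigma) * int01 (fun s => w (0, s) * (mode sigma k 0 * mode sigma l s)) +
      (- sigma) * int01 (fun s => w (1, s) * (mode sigma k 1 * mode sigma l s)).
    rewrite -!int01_scale -?int01_add; [|csolve..].
    by apply: eq_int01 => y _; rewrite k1 dmode0 mode0; ring.
  have -> : int01 (fun x => (w (x, 1) * dmode sigma l 1 - w (x, 0) * dmode sigma l 0) *
      mode sigma k x) =
      (- sigma) * int01 (fun s => w (s, 0) * (mode sigma k s * mode sigma l 0)) +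
      (- sigma) * int01 (fun s => w (s, 1) * (mode sigma k s * mode sigma l 1)).
    rewrite -!int01_scale -?int01_add; [|csolve..].
    by apply: eq_int01 => x _; rewrite l1 dmode0 mode0; ring.
  by ring.
move=> h2 h1; rewrite -h1 -h2 /dxmode2 /dymode2; ring.
Qed.

End green_on_the_square.

(** * Stability of integrals under L^2 approximation *)

Section L2_approximation.
Context d (T : measurableType d) (R : realType) (m : {measure set T -> \bar R}).
Variable D : set T.
Hypotheses (mD : measurable D) (mD1 : m D = 1%E).
Implicit Types f g b : T -> R.

Lemma L2_integrable f : measurable_fun D f ->
  (\int[m]_(x in D) (f x ^+ 2)%:E < +oo)%E -> m.-integrable D (EFin \o f).
Proof.
move=> mf f2.
have mf2 : measurable_fun D (fun x => f x ^+ 2) by exact: measurable_funX.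
have f2i : m.-integrable D (EFin \o (fun x => f x ^+ 2)).
  apply/integrableP; split; first exact/measurable_EFinP.
  rewrite (eq_integral (fun x => (f x ^+ 2)%:E))// => x _ /=.
  by rewrite ger0_norm// sqr_ge0.
have ci : m.-integrable D (EFin \o (fun _ : T => 1 : R)).
  apply/integrableP; split; first exact/measurable_EFinP.
  under eq_integral do rewrite /= normr1.
  by rewrite integral_cst// mD1 mule1 ltry.
apply: (le_integrable mD _ _ (integrableD mD ci f2i)); first exact/measurable_EFinP.
move=> x _ /=; rewrite lee_fin [leRHS]ger0_norm ?addr_ge0 ?sqr_ge0//.
rewrite -(@real_normK _ (f x)) ?num_real//.
have := normr_ge0 (f x); set a := `|_| => a0.
by have := sqr_ge0 (a - 1); nra.
Qed.

Lemma integrable_mul_bounded f b (M : R) : m.-integrable D (EFin \o f) ->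
  measurable_fun D b -> (forall x, D x -> `|b x| <= M) ->
  m.-integrable D (EFin \o (fun x => f x * b x)).
Proof.
move=> fi mb HM.
rewrite (_ : EFin \o _ = ((EFin \o f) \* (EFin \o b))%E); last first.
  by apply/funext => p /=; rewrite EFinM.
apply: integrableMl => //; exists M; split => [|x Mx p Dp /=]; first exact: num_real.
exact: le_trans (HM p Dp) (ltW Mx).
Qed.

(** Cauchy-Schwarz on a set of measure 1, obtained by integrating M |d| <= M / (2 eps) d^2 + M eps /
    2 with d = g - f. The measure space is general because the square and its sides both occur. *)
Lemma Rintegral_approx f g b (M eps : R) : m.-integrable D (EFin \o f) ->
  m.-integrable D (EFin \o g) -> measurable_fun D b ->
  (forall x, D x -> `|b x| <= M) -> 0 <= M -> 0 < eps ->
  (\int[m]_(x in D) ((g x - f x) ^+ 2)%:E <= (eps ^+ 2)%:E)%E ->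
  `|\int[m]_(x in D) (f x * b x) - \int[m]_(x in D) (g x * b x)| <= M * eps.
Proof.
move=> fi gi mb HM M0 e0 fg.
have fbi := integrable_mul_bounded _ _ _ fi mb HM.
have gbi := integrable_mul_bounded _ _ _ gi mb HM.
have mf : measurable_fun D f by apply/measurable_EFinP; exact: measurable_int fi.
have mg : measurable_fun D g by apply/measurable_EFinP; exact: measurable_int gi.
have md2 : measurable_fun D (fun x => (g x - f x) ^+ 2).
  by apply: measurable_funX; exact: measurable_funB.
rewrite -RintegralB//.
have fgi := integrableB mD fbi gbi.
apply: (le_trans (le_normr_Rintegral mD fgi)).
rewrite -lee_fin /Rintegral fineK; last first.
  by apply: integrable_fin_num => //; exact: (integrable_norm fgi).
apply: (@le_trans _ _ (\int[m]_(x in D)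
   ((M / (2 * eps))%:E * ((g x - f x) ^+ 2)%:E + (M * eps / 2)%:E))%E).
  apply: ge0_le_integral => //.
  - apply/measurable_EFinP; apply: measurableT_comp => //.
    by apply: measurable_funB; apply: measurable_funM.
  - by apply: emeasurable_funD => //; apply: measurable_funeM; exact/measurable_EFinP.
  - move=> x Dx; rewrite -EFinM -EFinD lee_fin -mulrBl normrM.
    apply: (@le_trans _ _ (`|f x - g x| * M)); first by rewrite ler_wpM2l// HM.
    rewrite distrC -(@real_normK _ (g x - f x)) ?num_real//.
    set a := `|_|.
    have -> : M / (2 * eps) * a ^+ 2 + M * eps / 2 = M / (2 * eps) * (a ^+ 2 + eps ^+ 2).
      by field; rewrite gt_eqF.
    have -> : a * M = M / (2 * eps) * (2 * a * eps) by field; rewrite gt_eqF.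
    apply: ler_wpM2l; first by rewrite divr_ge0// mulr_ge0// ltW.
    by have := sqr_ge0 (a - eps); nra.
have c1 : 0 <= M / (2 * eps) by rewrite divr_ge0// mulr_ge0// ltW.
have c2 : 0 <= M * eps / 2 by rewrite divr_ge0// mulr_ge0// ltW.
have md2' : measurable_fun D (fun x => ((g x - f x) ^+ 2)%:E) by exact/measurable_EFinP.
have d2ge0 x : D x -> (0 <= ((g x - f x) ^+ 2)%:E)%E by move=> _; rewrite lee_fin sqr_ge0.
have f10 x : D x -> (0 <= (M / (2 * eps))%:E * ((g x - f x) ^+ 2)%:E)%E.
  by move=> _; apply: mule_ge0; rewrite lee_fin// sqr_ge0.
have mf1 : measurable_fun D (fun x => ((M / (2 * eps))%:E * ((g x - f x) ^+ 2)%:E)%E).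
  by apply: measurable_funeM.
rewrite (ge0_integralD m mD f10 mf1 (f2 := fun=> (M * eps / 2)%:E))//.
rewrite (ge0_integralZl m mD md2' d2ge0)//.
rewrite integral_cst// mD1 mule1.
apply: (@le_trans _ _ ((M / (2 * eps))%:E * (eps ^+ 2)%:E + (M * eps / 2)%:E)%E).
  by apply: leeD2r; apply: lee_wpmul2l.
rewrite -EFinM -EFinD lee_fin le_eqVlt; apply/orP; left; apply/eqP.
by field; rewrite gt_eqF.
Qed.

End L2_approximation.

(** * Green's identity for functions with a weak gradient and a trace *)

Section weak_green_identity.
Context {R : realType}.
Variable sigma : R.
Hypothesis sigma_gt0 : 0 < sigma.
Local Notation plane := (R * R)%type.
Local Notation S := (unit_square : set plane).
Local Notation mu := (@lebesgue_measure R).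

Definition L2_square (f : plane -> R) : Prop :=
  measurable_fun (S : set (measurableTypeR R * measurableTypeR R)) f /\
  (\int[plane_measure]_(p in S) (f p ^+ 2)%:E < +oo)%E.

Definition L2_boundary (t : plane -> R) : Prop := forall i : 'I_4,
  measurable_fun (`[0, 1]%classic : set R) (fun s => t (side i s)) /\
  (\int[mu]_(s in `[0%R, 1%R]) (t (side i s) ^+ 2)%:E < +oo)%E.

Lemma plane_measure1 : plane_measure S = 1%E.
Proof. exact: plane_measure_unit_square. Qed.

Lemma L2_square_integrable f : L2_square f -> plane_measure.-integrable S (EFin \o f).
Proof.
move=> [mf f2]; apply: L2_integrable => //.
- exact: measurable_unit_square.
- exact: plane_measure1.
Qed.

Lemma continuous_side (f : plane -> R) (i : 'I_4) : continuous f ->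
  continuous (fun s : R => f (side i s)).
Proof.
move=> cf; case: i => n ni; move: n ni => [|[|[|[|//]]]] ni; rewrite /side/=.
- exact: (continuous_slice2 _ 0 cf).
- exact: (continuous_slice2 _ 1 cf).
- exact: (continuous_slice1 _ 0 cf).
- exact: (continuous_slice1 _ 1 cf).
Qed.

Lemma side_in01 (i : 'I_4) (s : R) : 0 <= s <= 1 ->
  0 <= (side i s).1 <= 1 /\ 0 <= (side i s).2 <= 1.
Proof.
by move=> s01; case: i => n ni; move: n ni => [|[|[|[|//]]]] ni; rewrite /side/= s01 ?lexx ?ler01.
Qed.

(** Each term changes by at most a constant times eps when u, its gradient and its trace are
    replaced by those of a smooth approximant, for which [green_smooth] applies. So the difference
    of the two sides is at most K eps for every eps. *)
Lemma weak_green (u gx gy t : plane -> R) k l :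
  L2_square u -> L2_square gx -> L2_square gy -> L2_boundary t ->
  robin_frequency sigma k -> robin_frequency sigma l ->
  (forall eps : R, 0 < eps -> exists w : plane -> R, [/\ smooth w,
    (\int[plane_measure]_(p in S) ((w p - u p) ^+ 2)%:E <= (eps ^+ 2)%:E)%E,
    (\int[plane_measure]_(p in S) (('D_dir_x w p - gx p) ^+ 2)%:E <= (eps ^+ 2)%:E)%E,
    (\int[plane_measure]_(p in S) (('D_dir_y w p - gy p) ^+ 2)%:E <= (eps ^+ 2)%:E)%E &
    forall i : 'I_4, (\int[mu]_(s in `[0%R, 1%R]) ((w (side i s) - t (side i s)) ^+ 2)%:E
      <= (eps ^+ 2)%:E)%E]) ->
  square_int (fun p => gx p * dxmode2 sigma k l p) +
  square_int (fun p => gy p * dymode2 sigma k l p) + sigma * bdry sigma t k l =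
  (k ^+ 2 + l ^+ 2) * square_int (fun p => u p * mode2 sigma k l p).
Proof.
move=> Lu Lgx Lgy Lt rk rl approx.
have cm := continuous_mode2 sigma k l.
have cdx := continuous_dxmode2 sigma k l.
have cdy := continuous_dymode2 sigma k l.
have [M1 M10 HM1] := continuous_bounded_square _ cm.
have [M2 M20 HM2] := continuous_bounded_square _ cdx.
have [M3 M30 HM3] := continuous_bounded_square _ cdy.
have est (f w b : plane -> R) M eps : L2_square f -> continuous w -> continuous b ->
    (forall x y, 0 <= x <= 1 -> 0 <= y <= 1 -> `|b (x, y)| <= M) -> 0 <= M -> 0 < eps ->
    (\int[plane_measure]_(p in S) ((w p - f p) ^+ 2)%:E <= (eps ^+ 2)%:E)%E ->
    `|square_int (fun p => f p * b p) - square_int (fun p => w p * b p)| <= M * eps.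
  move=> Lf cw cb HM M0 e0 h; apply: Rintegral_approx => //.
  - exact: measurable_unit_square.
  - exact: plane_measure1.
  - exact: L2_square_integrable.
  - exact: continuous_integrable_square.
  - exact: continuous_measurable_plane.
  - by move=> [x y] /unit_squareP[/= hx hy]; exact: HM.
pose A := square_int (fun p => gx p * dxmode2 sigma k l p) +
  square_int (fun p => gy p * dymode2 sigma k l p) + sigma * bdry sigma t k l -
  (k ^+ 2 + l ^+ 2) * square_int (fun p => u p * mode2 sigma k l p).
pose K := M2 + M3 + sigma * (M1 + M1 + M1 + M1) + (k ^+ 2 + l ^+ 2) * M1.
have kl0 : 0 <= k ^+ 2 + l ^+ 2 by rewrite addr_ge0 ?sqr_ge0.
have K0 : 0 <= K.
  by rewrite !addr_ge0// mulr_ge0// ?(ltW sigma_gt0)// !addr_ge0.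
have bound eps : 0 < eps -> `|A| <= K * eps.
  move=> e0; have [w [sw wu wx wy wt]] := approx _ e0.
  have [cw dw cDw] := smoothP _ sw.
  have E := green_smooth sigma w k l sw rk rl.
  have h1 := est u w _ M1 eps Lu cw cm HM1 M10 e0 wu.
  have h2 := est gx _ _ M2 eps Lgx (cDw dir_x) cdx HM2 M20 e0 wx.
  have h3 := est gy _ _ M3 eps Lgy (cDw dir_y) cdy HM3 M30 e0 wy.
  have h4 i : `|int01 (fun s => t (side i s) * mode2 sigma k l (side i s)) -
      int01 (fun s => w (side i s) * mode2 sigma k l (side i s))| <= M1 * eps.
    have [mt t2] := Lt i.
    have m01 : mu (`[0, 1]%classic : set R) = 1%E.
      by rewrite lebesgue_measure_itv/= lte_fin ltr01 -EFinB subr0.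
    have cws := continuous_side w i cw; have cms := continuous_side _ i cm.
    apply: (Rintegral_approx _ _ _ mu (`[0, 1]%classic : set R)) => //.
    - exact: L2_integrable.
    - exact: continuous_integrable_itv.
    - by apply: measurable_funTS; exact: continuous_measurable_fun.
    - move=> s /=; rewrite in_itv/= => s01.
      have [s1 s2] := side_in01 i s s01.
      by have := HM1 _ _ s1 s2; rewrite -surjective_pairing.
  have h5 : `|bdry sigma t k l - bdry sigma w k l| <= (M1 + M1 + M1 + M1) * eps.
    rewrite /bdry -sumrB; apply: (le_trans (ler_norm_sum _ _ _)).
    apply: (@le_trans _ _ (\sum_(i < 4) M1 * eps)); first by apply: ler_sum => i _; exact: h4.
    by rewrite !big_ord_recl big_ord0 addr0 !mulrDl !addrA.
  have -> : A = (square_int (fun p => gx p * dxmode2 sigma k l p) -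
        square_int (fun p => 'D_dir_x w p * dxmode2 sigma k l p)) +
      (square_int (fun p => gy p * dymode2 sigma k l p) -
        square_int (fun p => 'D_dir_y w p * dymode2 sigma k l p)) +
      sigma * (bdry sigma t k l - bdry sigma w k l) -
      (k ^+ 2 + l ^+ 2) * (square_int (fun p => u p * mode2 sigma k l p) -
        square_int (fun p => w p * mode2 sigma k l p)).
    move/eqP: (E); rewrite -subr_eq0 => /eqP E0.
    by rewrite -[LHS]subr0 -E0 /A; ring.
  have -> : K * eps = M2 * eps + M3 * eps + sigma * ((M1 + M1 + M1 + M1) * eps) +
      (k ^+ 2 + l ^+ 2) * (M1 * eps) by rewrite /K; ring.
  apply: (le_trans (ler_normB _ _)); apply: lerD.
    apply: (le_trans (ler_normD _ _)); apply: lerD.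
      by apply: (le_trans (ler_normD _ _)); exact: lerD.
    by rewrite normrM (gtr0_norm sigma_gt0) ler_wpM2l// ltW.
  by rewrite normrM (ger0_norm kl0) ler_wpM2l.
have A0 : A = 0.
  apply/eqP; rewrite -normr_le0 leNgt; apply/negP => An0.
  have K1 : 0 < K + 1 by rewrite ltr_wpDl.
  have := bound (`|A| / (2 * (K + 1))) _; rewrite divr_gt0 ?mulr_gt0// => /(_ isT).
  rewrite mulrA ler_pdivlMr ?mulr_gt0//; nra.
by apply/eqP; rewrite -subr_eq0; apply/eqP.
Qed.

End weak_green_identity.

(** * Eigenfunctions tested against products of modes *)

Section kernel.
Context {R : realType}.
Variable sigma : R.
Hypothesis sigma_gt0 : 0 < sigma.
Local Notation C := R[i].
Local Notation plane := (R * R)%type.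
Local Notation S := (unit_square : set plane).
Local Notation mu := (@lebesgue_measure R).
Local Notation mR := (measurableTypeR R).
Implicit Types (z : C) (u f g t : plane -> C).

(** The Boolean index lets real and imaginary parts be treated by a single argument; the modes are
    real, so the two parts decouple. *)
Definition part (b : bool) z : R := if b then complex.Im z else complex.Re z.

Lemma partD b z z' : part b (z + z') = part b z + part b z'.
Proof. by case: b; [exact: ImD|exact: ReD]. Qed.

Lemma partB b z z' : part b (z - z') = part b z - part b z'.
Proof. by case: b; case: z => x y; case: z' => x' y'. Qed.

Lemma partMr b z (a : R) : part b (z * (a%:C)%C) = part b z * a.
Proof. by case: b; case: z => x y /=; rewrite mulr0 ?subr0 ?add0r. Qed.

Lemma partMl b z (a : R) : part b ((a%:C)%C * z) = a * part b z.
Proof. by rewrite mulrC partMr mulrC. Qed.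

Lemma part_sqr_le b z : part b z ^+ 2 <= sqnorm z.
Proof. by case: b; rewrite /sqnorm ?lerDr ?lerDl sqr_ge0. Qed.

Lemma conjC_real (a : R) : ((a%:C)%C)^*%C = (a%:C)%C.
Proof. by rewrite /= oppr0. Qed.

Lemma part_integralC b f : part b (integralC f) = square_int (fun p => part b (f p)).
Proof. by case: b. Qed.

Lemma part_L2dot_real b f (v : plane -> R) :
  part b (L2dot f (fun p => ((v p)%:C)%C)) = square_int (fun p => part b (f p) * v p).
Proof.
rewrite part_integralC; apply: eq_square_int => p _.
by rewrite conjC_real partMr.
Qed.

Lemma part_boundary b f : part b (boundary_integralC f) =
  \sum_(i < 4) int01 (fun s => part b (f (side i s))).
Proof.
rewrite /boundary_integralC !big_ord_recl !big_ord0 !partD.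
by case: b.
Qed.

Lemma measurable_part b (D : set (mR * mR)) u : measurable_complex_fun D u ->
  measurable_fun D (fun p => part b (u p)).
Proof. by case: b => -[]. Qed.

Lemma measurable_sqnorm d (T : measurableType d) (D : set T) (h : T -> C) :
  (forall b, measurable_fun D (fun x => part b (h x))) ->
  measurable_fun D (fun x => (sqnorm (h x))%:E).
Proof.
move=> mh; apply/measurable_EFinP; apply: measurable_funD; apply: measurable_funX.
  exact: (mh false).
exact: (mh true).
Qed.

Lemma integral_part_le b d (T : measurableType d) (m : {measure set T -> \bar R})
    (D : set T) (h : T -> C) : measurable D ->
  (forall b, measurable_fun D (fun x => part b (h x))) ->
  (\int[m]_(x in D) (part b (h x) ^+ 2)%:E <= \int[m]_(x in D) (sqnorm (h x))%:E)%E.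
Proof.
move=> mD mh; apply: ge0_le_integral => //.
- by move=> x _; rewrite lee_fin sqr_ge0.
- by apply/measurable_EFinP; apply: measurable_funX.
- exact: measurable_sqnorm.
- by move=> x _; rewrite lee_fin part_sqr_le.
Qed.

Lemma L2_square_part b u : in_L2 u -> L2_square (fun p => part b (u p)).
Proof.
move=> [mu_ u2]; split; first exact: measurable_part.
apply: le_lt_trans u2; apply: integral_part_le; first exact: measurable_unit_square.
by move=> b'; exact: measurable_part.
Qed.

Lemma measurable_boundary_part b t (i : 'I_4) : boundary_in_L2 t ->
  measurable_fun (`[0, 1]%classic : set R) (fun s => part b (t (side i s))).
Proof. by move=> [/(_ i)[m1 m2] _]; case: b. Qed.

Lemma boundary_term_le t (i : 'I_4) :
  (\int[mu]_(s in `[0%R, 1%R]) (sqnorm (t (side i s)))%:E <= boundary_L2sq t)%E.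
Proof.
rewrite /boundary_L2sq (bigD1 i)//= leeDl// sume_ge0// => j _.
by apply: integral_ge0 => s _; rewrite lee_fin sqnorm_ge0.
Qed.

Lemma L2_boundary_part b t : boundary_in_L2 t -> L2_boundary (fun p => part b (t p)).
Proof.
move=> Lt i; split; first exact: measurable_boundary_part.
apply: (@le_lt_trans _ _ (boundary_L2sq t)); last by case: Lt.
apply: le_trans (boundary_term_le t i).
by apply: integral_part_le => // b'; exact: measurable_boundary_part.
Qed.

Lemma smooth_part b u : smoothC u -> smooth (fun p => part b (u p)).
Proof. by case: b => -[]. Qed.

Lemma part_partialC b e u p : part b (partialC e u p) = 'D_e (fun q => part b (u q)) p.
Proof. by case: b. Qed.

Lemma lt_near_cvg0 (s : nat -> \bar R) (e : R) : 0 < e -> s @ \oo --> 0%E ->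
  \forall j \near \oo, (s j < e%:E)%E.
Proof.
move=> e0 s0; have : nbhs (0%E : \bar R) [set x | (x < e%:E)%E].
  by apply: open_nbhs_nbhs; split; [exact: open_ereal_lt_ereal|rewrite /= lte_fin].
exact: s0.
Qed.

(** The four limits in [is_trace] are along one sequence, so a single index serves all of them.
    Passing to a part does not increase the squared modulus. *)
Lemma trace_approx b u gx gy t : in_L2 u -> in_L2 gx -> in_L2 gy ->
  boundary_in_L2 t -> is_trace u gx gy t ->
  forall eps : R, 0 < eps -> exists w : plane -> R, [/\ smooth w,
    (\int[plane_measure]_(p in S) ((w p - part b (u p)) ^+ 2)%:E <= (eps ^+ 2)%:E)%E,
    (\int[plane_measure]_(p in S) (('D_dir_x w p - part b (gx p)) ^+ 2)%:E <= (eps ^+ 2)%:E)%E,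
    (\int[plane_measure]_(p in S) (('D_dir_y w p - part b (gy p)) ^+ 2)%:E <= (eps ^+ 2)%:E)%E &
    forall i : 'I_4, (\int[mu]_(s in `[0%R, 1%R])
      ((w (side i s) - part b (t (side i s))) ^+ 2)%:E <= (eps ^+ 2)%:E)%E].
Proof.
move=> Lu Lgx Lgy Lt [w sw [cu cx cy ct]] eps e0.
have e20 : 0 < eps ^+ 2 by rewrite exprn_gt0.
have [j [[ju jx] [jy jt]]] : exists j : nat,
   ((L2sq S (fun x => (w j x - u x)%R) < (eps ^+ 2)%:E)%E /\
    (L2sq S (fun x => (partialC dir_x (w j) x - gx x)%R) < (eps ^+ 2)%:E)%E) /\
   ((L2sq S (fun x => (partialC dir_y (w j) x - gy x)%R) < (eps ^+ 2)%:E)%E /\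
    (boundary_L2sq (fun x => (w j x - t x)%R) < (eps ^+ 2)%:E)%E).
  apply: (@filter_ex _ \oo); apply: filterI; apply: filterI; exact: lt_near_cvg0.
have swb b' := smoothP _ (smooth_part b' _ (sw j)).
exists (fun p => part b (w j p)); split; first exact: smooth_part.
- apply: le_trans (ltW ju); under eq_integral do rewrite -partB.
  apply: integral_part_le; first exact: measurable_unit_square.
  move=> b'; under eq_fun do rewrite partB; apply: measurable_funB.
    by apply: continuous_measurable_plane; case: (swb b').
  by apply: measurable_part; case: Lu.
- apply: le_trans (ltW jx); under eq_integral do rewrite -part_partialC -partB.
  apply: integral_part_le; first exact: measurable_unit_square.
  move=> b'; under eq_fun do rewrite partB part_partialC; apply: measurable_funB.
    by apply: continuous_measurable_plane; case: (swb b').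
  by apply: measurable_part; case: Lgx.
- apply: le_trans (ltW jy); under eq_integral do rewrite -part_partialC -partB.
  apply: integral_part_le; first exact: measurable_unit_square.
  move=> b'; under eq_fun do rewrite partB part_partialC; apply: measurable_funB.
    by apply: continuous_measurable_plane; case: (swb b').
  by apply: measurable_part; case: Lgy.
- move=> i; apply: le_trans (ltW jt); under eq_integral do rewrite -partB.
  apply: le_trans (boundary_term_le _ i).
  apply: integral_part_le => // b'.
  have -> : (fun s => part b' (w j (side i s) - t (side i s))) =
      (fun s => part b' (w j (side i s)) - part b' (t (side i s))).
    by apply/funext => s; rewrite partB.
  apply: measurable_funB.
    apply: measurable_funTS; apply: continuous_measurable_fun.
    by apply: (continuous_side (fun p => part b' (w j p))); case: (swb b').
  exact: measurable_boundary_part.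
Qed.

Definition realC (v : plane -> R) : plane -> C := fun p => ((v p)%:C)%C.

Lemma L2sq_continuous_lty u : continuous (fun p => complex.Re (u p)) ->
  continuous (fun p => complex.Im (u p)) -> (L2sq S u < +oo)%E.
Proof.
move=> cr ci; rewrite /L2sq.
have cs : continuous (fun p => sqnorm (u p)).
  rewrite (_ : (fun p => _) = fun p => complex.Re (u p) * complex.Re (u p) +
    complex.Im (u p) * complex.Im (u p)); last by apply/funext => p; rewrite /sqnorm !expr2.
  by apply: continuous_padd; apply: continuous_pmul.
have /integrableP[_] := continuous_integrable_square _ cs.
apply: le_lt_trans; rewrite le_eqVlt; apply/orP; left; apply/eqP.
by apply: eq_integral => p _ /=; rewrite ger0_norm// sqnorm_ge0.
Qed.

Lemma in_L2_real (v : plane -> R) : continuous v -> in_L2 (realC v).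
Proof.
move=> cv; have c0 : continuous (fun _ : plane => 0 : R) by move=> p; exact: cvg_cst.
split; first by split; exact: continuous_measurable_plane.
exact: L2sq_continuous_lty.
Qed.

Lemma sqnorm_real (a : R) : sqnorm ((a%:C)%C : C) = a ^+ 2.
Proof. by rewrite /sqnorm /= expr0n addr0. Qed.

Lemma boundary_in_L2_real (v : plane -> R) : continuous v -> boundary_in_L2 (realC v).
Proof.
move=> cv; split => [i|].
  split; last exact: measurable_cst.
  apply: measurable_funTS; apply: continuous_measurable_fun.
  exact: (continuous_side v).
rewrite /boundary_L2sq; apply: lte_sum_pinfty => i _.
have cs : continuous (fun s => v (side i s) ^+ 2).
  by apply: continuous_fexp; exact: (continuous_side v).
have /integrableP[_] := continuous_integrable_itv _ 0 1 cs.
apply: le_lt_trans; rewrite le_eqVlt; apply/orP; left; apply/eqP.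
by apply: eq_integral => s _ /=; rewrite sqnorm_real ger0_norm// sqr_ge0.
Qed.

Lemma integralC_real (f g : plane -> R) :
  integralC (fun p => realC f p * ((g p)%:C)%C) =
  Complex (square_int (fun p => f p * g p)) 0.
Proof.
apply/eqP; rewrite eq_complex; apply/andP; split; apply/eqP.
  rewrite -[LHS]/(part false _) part_integralC /=; apply: eq_square_int => p _ /=.
  by rewrite mulr0 subr0.
rewrite -[LHS]/(part true _) part_integralC /=.
transitivity (square_int (fun=> 0 : R)).
  by apply: eq_square_int => p _ /=; rewrite mulr0 mul0r addr0.
by rewrite /square_int Rintegral_cst ?mul0r//; exact: measurable_unit_square.
Qed.

Lemma weak_partial_real (e : plane) (v v' : plane -> R) :
  (forall psi, test_function psi ->
    square_int (fun p => 'D_e psi p * v p) + square_int (fun p => psi p * v' p) = 0) ->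
  weak_partial e (realC v) (realC v').
Proof.
move=> H psi tpsi; rewrite !integralC_real.
apply/eqP; rewrite eq_complex /= oppr0 eqxx andbT; apply/eqP.
have -> : square_int (fun p => v p * 'D_e psi p) = square_int (fun p => 'D_e psi p * v p).
  by apply: eq_square_int => p _; rewrite mulrC.
have -> : square_int (fun p => v' p * psi p) = square_int (fun p => psi p * v' p).
  by apply: eq_square_int => p _; rewrite mulrC.
by have := H psi tpsi; move/eqP; rewrite addr_eq0 => /eqP.
Qed.

Lemma test_function_eq0 (psi : plane -> R) p : test_function psi -> ~ S p -> psi p = 0.
Proof.
move=> [_ _ sub] Sp; apply: contrapT => /eqP p0; apply: Sp; apply: sub.
exact: subset_closure.
Qed.

(** This is [green_x] with the test function in the role of w; its boundary term vanishes because
    the support lies in the open square. *)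
Lemma weak_partial_mode2_x k l : k != 0 ->
  weak_partial dir_x (realC (mode2 sigma k l)) (realC (dxmode2 sigma k l)).
Proof.
move=> k0; apply: weak_partial_real => psi tpsi.
have [spsi _ _] := tpsi; have [c d cD] := smoothP _ spsi.
rewrite (green_x psi (mode sigma k) (dmode sigma k) (mode sigma l) c (cD _)
  (fun p => d p _) (continuous_dmode _ _) (continuous_mode _ _)
  (fun x => is_derive_mode sigma k x k0)).
rewrite -[RHS](int01_cst 0); apply: eq_int01 => y _.
rewrite !test_function_eq0 ?mul0r ?subrr ?mul0r//.
- by move=> [/=]; rewrite in_itv/= ltxx.
- by move=> [/=]; rewrite in_itv/= ltxx andbF.
Qed.

Lemma weak_partial_mode2_y k l : l != 0 ->
  weak_partial dir_y (realC (mode2 sigma k l)) (realC (dymode2 sigma k l)).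
Proof.
move=> l0; apply: weak_partial_real => psi tpsi.
have [spsi _ _] := tpsi; have [c d cD] := smoothP _ spsi.
rewrite (green_y psi (mode sigma k) (mode sigma l) (dmode sigma l) c (cD _)
  (fun p => d p _) (continuous_dmode _ _) (continuous_mode _ _)
  (fun x => is_derive_mode sigma l x l0)).
rewrite -[RHS](int01_cst 0); apply: eq_int01 => x _.
rewrite !test_function_eq0 ?mul0r ?subrr ?mul0r//.
- by move=> [_ /=]; rewrite in_itv/= ltxx.
- by move=> [_ /=]; rewrite in_itv/= ltxx andbF.
Qed.

(** The product of modes is smooth on the whole plane, so the constant sequence approximates it. *)
Lemma is_trace_mode2 k l : k != 0 -> l != 0 ->
  is_trace (realC (mode2 sigma k l)) (realC (dxmode2 sigma k l))
    (realC (dymode2 sigma k l)) (realC (mode2 sigma k l)).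
Proof.
move=> k0 l0; exists (fun=> realC (mode2 sigma k l)).
  move=> _; split; first exact: smooth_mode2.
  suff -> : (fun x => complex.Im (realC (mode2 sigma k l) x)) = wave 0 0 0 0 0 0.
    exact: smooth_wave.
  by apply/funext => p; rewrite /wave !mul0r !addr0.
have zero u : (forall p, u p = 0) -> L2sq S u = 0%E.
  move=> u0; rewrite -[RHS](@integral0 _ _ _ plane_measure S).
  by apply: eq_integral => p _; rewrite u0 sqnorm0.
have D0 e p : 'D_e (fun _ : plane => 0 : R) p = 0 by rewrite derive_cst.
have zero_cvg (s : nat -> \bar R) : (forall j, s j = 0%E) -> s @ \oo --> 0%E.
  by move=> s0; rewrite (_ : s = fun=> 0%E); [exact: cvg_cst|exact/funext].
split; apply: zero_cvg => _.
- by apply: zero => p; rewrite subrr.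
- apply: zero => p; apply/eqP; rewrite subr_eq0; apply/eqP.
  rewrite /partialC /= D0; have ? := derive_mode2_x sigma k l p k0.
  by rewrite derive_val.
- apply: zero => p; apply/eqP; rewrite subr_eq0; apply/eqP.
  rewrite /partialC /= D0; have ? := derive_mode2_y sigma k l p l0.
  by rewrite derive_val.
- rewrite /boundary_L2sq big1// => i _.
  rewrite -[RHS](@integral0 _ _ _ mu `[0%R, 1%R]%classic).
  by apply: eq_integral => s _; rewrite subrr sqnorm0.
Qed.

Definition mode2_H1 k l (k0 : k != 0) (l0 : l != 0) : sobolevH1 :=
  SobolevH1 (in_L2_real _ (continuous_mode2 sigma k l))
    (in_L2_real _ (continuous_dxmode2 sigma k l))
    (in_L2_real _ (continuous_dymode2 sigma k l))
    (weak_partial_mode2_x k l k0) (weak_partial_mode2_y k l l0)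
    (boundary_in_L2_real _ (continuous_mode2 sigma k l))
    (is_trace_mode2 k l k0 l0).

Lemma in_L2_kernel (Lambda : R) u : robin_kernel sigma Lambda u -> in_L2 u.
Proof. by move=> [_ [U <- _]]; case: U. Qed.

(** Testing the form with a product of modes gives Lambda times the coefficient of u by the
    eigenvalue equation, and k^2 + l^2 times it by [weak_green]. Only coefficients with k^2 + l^2 =
    Lambda can survive. *)
Lemma kernel_orthogonal (Lambda : R) u b k l : robin_kernel sigma Lambda u ->
  robin_frequency sigma k -> robin_frequency sigma l ->
  (Lambda - (k ^+ 2 + l ^+ 2)) *
    square_int (fun p => part b (u p) * mode2 sigma k l p) = 0.
Proof.
move=> ker rk rl; have Lu := in_L2_kernel _ _ ker.
have [k0 l0] : k != 0 /\ l != 0 by case: rk rl => [? _] [? _]; rewrite !gt_eqF.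
have [_ [U UE Uform]] := ker.
have := Uform (mode2_H1 _ _ k0 l0); rewrite /robin_form.
move: UE {Uform}; case: U => u' gx gy t Lu' Lgx Lgy _ _ Lt tr /= E; subst u'.
move=> /(congr1 (part b)); rewrite !partD partMl part_boundary !part_L2dot_real.
have -> : \sum_(i < 4) int01 (fun s => part b (t (side i s) *
     (realC (mode2 sigma k l) (side i s))^*%C)) =
   bdry sigma (fun p => part b (t p)) k l.
  apply: eq_bigr => i _; apply: eq_int01 => s _.
  by rewrite /realC conjC_real partMr.
rewrite (weak_green sigma sigma_gt0 _ _ _ _ k l (L2_square_part b _ Lu)
  (L2_square_part b _ Lgx) (L2_square_part b _ Lgy) (L2_boundary_part b _ Lt) rk rl
  (trace_approx b _ _ _ _ Lu Lgx Lgy Lt tr)).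
have -> : (fun p => part b (Lambda%:C%C * u p) * mode2 sigma k l p) =
    (fun p => Lambda * (part b (u p) * mode2 sigma k l p)).
  by apply/funext => p; rewrite partMl mulrA.
rewrite square_int_scale; first by move=> h; rewrite mulrBl h subrr.
have [M M0 HM] := continuous_bounded_square _ (continuous_mode2 sigma k l).
apply: (integrable_mul_bounded _ _ _ _ _ _ _ _ M) => //.
- exact: measurable_unit_square.
- exact: L2_square_integrable (L2_square_part b _ Lu).
- exact: continuous_measurable_plane (continuous_mode2 _ _ _).
- by move=> [x y] /unit_squareP[/= hx hy]; exact: HM.
Qed.

End kernel.

(** * Finite expansions in products of modes *)

Section expansion.
Context {R : realType}.
Variable sigma : R.
Hypothesis sigma_gt0 : 0 < sigma.
Local Notation plane := (R * R)%type.
Local Notation S := (unit_square : set plane).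
Local Notation freq := (robin_freq sigma).
Local Notation mode_sqr n := (int01 (fun x => mode sigma (freq n) x ^+ 2)).

Lemma robin_frequency_freq n : robin_frequency sigma (freq n).
Proof. by have [] := robin_freqP _ sigma_gt0 n. Qed.

Lemma int01_mode_mode m n : m != n ->
  int01 (fun x => mode sigma (freq m) x * mode sigma (freq n) x) = 0.
Proof.
move=> mn; have cm k := continuous_mode sigma k.
have := green_sym sigma _ _ _ _ _ _ _ _ (green_mode _ _ (robin_frequency_freq m))
  (green_mode _ _ (robin_frequency_freq n)).
move=> /(_ _ _)/wrap[]; [by csolve|by csolve|].
have c2 : continuous (fun x => mode sigma (freq m) x * mode sigma (freq n) x) by csolve.
under eq_int01 do rewrite mulrCA.
under [RHS]eq_int01 do rewrite -mulrA.
rewrite !int01_scale// => /eqP; rewrite -subr_eq0 -mulrBl mulf_eq0 subr_eq0.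
rewrite eqrXn2 ?ltW ?freq_gt0// => /predU1P[/(freq_inj _ sigma_gt0) E|/eqP//].
by rewrite E eqxx in mn.
Qed.

Lemma int01_mode_sqr_gt0 n : 0 < mode_sqr n.
Proof.
have cm : continuous (mode sigma (freq n)) by exact: continuous_mode.
have c2 : continuous (fun x => mode sigma (freq n) x ^+ 2) by csolve.
rewrite lt_neqAle eq_sym; apply/andP; split; last by apply: int01_ge0 => x; rewrite sqr_ge0.
apply/eqP => /(int01_sqr_eq0 _ cm) /(_ 0); rewrite lexx ler01 => /(_ isT).
by rewrite mode0 => /eqP; rewrite oner_eq0.
Qed.

Lemma square_int_tensor (a b : R -> R) : continuous a -> continuous b ->
  square_int (fun p => a p.1 * b p.2) = int01 a * int01 b.
Proof.
move=> ca cb; rewrite square_int_fubini12; last exact: continuous_tensor.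
transitivity (int01 (fun x => int01 b * a x)); last by rewrite int01_scale// mulrC.
by apply: eq_int01 => x _; rewrite mulrC -int01_scale.
Qed.

Lemma square_int_mode2 i j k l :
  square_int (fun p => mode2 sigma (freq i) (freq j) p * mode2 sigma (freq k) (freq l) p) =
  if (i == k) && (j == l) then mode_sqr i * mode_sqr j else 0.
Proof.
have cm n : continuous (mode sigma (freq n)) by exact: continuous_mode.
transitivity (square_int (fun p => (mode sigma (freq i) p.1 * mode sigma (freq k) p.1) *
   (mode sigma (freq j) p.2 * mode sigma (freq l) p.2))).
  by apply: eq_square_int => p _; rewrite /mode2 mulrACA.
rewrite (square_int_tensor (fun x => mode sigma (freq i) x * mode sigma (freq k) x)
   (fun x => mode sigma (freq j) x * mode sigma (freq l) x)); [|by csolve..].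
case: (eqVneq i k) => [->|ik]; last by rewrite int01_mode_mode// mul0r.
by case: (eqVneq j l) => [->//|jl]; rewrite (int01_mode_mode j l jl) mulr0.
Qed.

(** The terms are indexed by the second factor, the first being a function [g] of it: for a given
    eigenvalue one frequency determines the other. With s free of repetitions the second frequencies
    are distinct. *)
Definition mode_sum (s : seq nat) (g : nat -> nat) (a : nat -> R) (p : plane) : R :=
  \sum_(n <- s) a n * mode2 sigma (freq (g n)) (freq n) p.

Lemma continuous_mode_sum s g a : continuous (mode_sum s g a).
Proof.
elim: s => [|n s IH].
  rewrite (_ : mode_sum _ _ _ = fun=> 0) => [p|]; first exact: cvg_cst.
  by apply/funext => p; rewrite /mode_sum big_nil.
rewrite (_ : mode_sum _ _ _ =
  fun p => a n * mode2 sigma (freq (g n)) (freq n) p + mode_sum s g a p).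
  by apply: continuous_padd => //; apply: continuous_pscale; exact: continuous_mode2.
by apply/funext => p; rewrite /mode_sum big_cons.
Qed.

Lemma square_int_mode_sum s g a f : continuous f ->
  square_int (fun p => mode_sum s g a p * f p) =
  \sum_(n <- s) a n * square_int (fun p => mode2 sigma (freq (g n)) (freq n) p * f p).
Proof.
move=> cf; have c2 n : continuous (fun p => mode2 sigma (freq (g n)) (freq n) p * f p).
  by apply: continuous_pmul => //; exact: continuous_mode2.
elim: s => [|n s IH].
  rewrite big_nil; transitivity (square_int (fun=> 0 : R)).
    by apply: eq_square_int => p _; rewrite /mode_sum big_nil mul0r.
  by rewrite /square_int Rintegral_cst ?mul0r//; exact: measurable_unit_square.
rewrite big_cons -IH -square_int_scale; last exact: continuous_integrable_square.
rewrite -square_int_add; last 2 first.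
- by apply: continuous_integrable_square; exact: continuous_pscale.
- apply: continuous_integrable_square; apply: continuous_pmul => //.
  exact: continuous_mode_sum.
by apply: eq_square_int => p _; rewrite /mode_sum big_cons mulrDl mulrA.
Qed.

(** Subtracting the sum with the Fourier coefficients of f leaves a function orthogonal to all
    products of modes, which vanishes by completeness. *)
Lemma mode_expansion f (s : seq nat) (g : nat -> nat) : uniq s ->
  L2_square f ->
  (forall i j, ~ (j \in s /\ i = g j) ->
    square_int (fun p => f p * mode2 sigma (freq i) (freq j) p) = 0) ->
  exists a, {ae plane_measure, forall p, S p -> f p = mode_sum s g a p}.
Proof.
move=> us f2 fo.
have fi : plane_measure.-integrable S (EFin \o f) by exact: L2_square_integrable.
pose I n := mode_sqr (g n) * mode_sqr n.
have I0 n : I n != 0 by rewrite mulf_neq0// gt_eqF// int01_mode_sqr_gt0.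
pose a n := square_int (fun p => f p * mode2 sigma (freq (g n)) (freq n) p) / I n.
exists a; have cP := continuous_mode_sum s g a.
pose h p := f p + (- 1) * mode_sum s g a p.
have ii : plane_measure.-integrable S (EFin \o (fun p => - 1 * mode_sum s g a p)).
  by apply: continuous_integrable_square; exact: continuous_pscale.
have hi : plane_measure.-integrable S (EFin \o h).
  exact: (integrableD measurable_unit_square fi ii).
have : {ae plane_measure, forall p, S p -> h p = 0}.
  apply: (mode_complete_square sigma sigma_gt0 _ hi) => k l rk rl.
  have [i ->] := freq_surj _ sigma_gt0 _ rk; have [j ->] := freq_surj _ sigma_gt0 _ rl.
  have cm := continuous_mode2 sigma (freq i) (freq j).
  have [M M0 HM] := continuous_bounded_square _ cm.
  rewrite -[X in square_int X]/(fun p => h p * mode2 sigma (freq i) (freq j) p).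
  transitivity (square_int (fun p => f p * mode2 sigma (freq i) (freq j) p) +
    square_int (fun p => - 1 * (mode_sum s g a p * mode2 sigma (freq i) (freq j) p))).
    rewrite -square_int_add.
    - by apply: eq_square_int => p _; rewrite /h mulrDl -(mulrA (-1)).
    - apply: (integrable_mul_bounded _ _ _ _ _ _ _ _ M) => //.
      + exact: measurable_unit_square.
      + exact: continuous_measurable_plane.
      + by move=> [x y] /unit_squareP[/= hx hy]; exact: HM.
    - apply: continuous_integrable_square; apply: continuous_pscale.
      exact: continuous_pmul.
  rewrite square_int_scale; last first.
    by apply: continuous_integrable_square; exact: continuous_pmul.
  rewrite square_int_mode_sum//; under eq_bigr do rewrite square_int_mode2.
  case: (pselect (j \in s /\ i = g j)) => [[js ->]|nij].
    rewrite (bigD1_seq j)//= !eqxx /= big1 ?addr0; last first.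
      by move=> n nj; rewrite (negbTE nj) andbF mulr0.
    by rewrite -/(I j) /a mulrAC -mulrA divff// mulr1 mulN1r subrr.
  rewrite fo// big_seq big1 ?mulr0 ?addr0// => n ns.
  case: ifPn => [/andP[/eqP gi /eqP nj]|_]; last by rewrite mulr0.
  by case: nij; rewrite -nj gi.
have aeF := ae_filter_ringOfSetsType (@plane_measure R).
apply: filterS => p hp Sp; have := hp Sp.
by rewrite /h mulN1r => /eqP; rewrite subr_eq0 => /eqP.
Qed.

End expansion.

(** * Mode sums as exponential sums, and thick sections of plane sets *)

Section lower_bound.
Context {R : realType}.
Variable sigma : R.
Hypothesis sigma_gt0 : 0 < sigma.
Local Notation C := R[i].
Local Notation plane := (R * R)%type.
Local Notation S := (unit_square : set plane).
Local Notation mu := (@lebesgue_measure R).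
Local Notation freq := (robin_freq sigma).
Local Notation mR := (measurableTypeR R).

(** Euler's formula: a times the mode is a / 2 (1 - i sigma / k) e^(ikx) plus its complex
    conjugate. *)
Definition mode_terms (k a : R) : seq (R * C) :=
  [:: (k, Complex (a / 2) (- (a / 2 * (sigma / k))));
      (- k, Complex (a / 2) (a / 2 * (sigma / k)))].

Definition mode_trig (s : seq nat) (a : nat -> R) : seq (R * C) :=
  flatten [seq mode_terms (freq n) (a n) | n <- s].

Lemma mode_trig_cons n s a :
  mode_trig (n :: s) a = mode_terms (freq n) (a n) ++ mode_trig s a.
Proof. by []. Qed.

Lemma trig_sum_cat (s s' : seq (R * C)) x :
  trig_sum (s ++ s') x = trig_sum s x + trig_sum s' x.
Proof. by rewrite /trig_sum big_cat. Qed.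

Lemma trig_sum_mode k a x : trig_sum (mode_terms k a) x = Complex (a * mode sigma k x) 0.
Proof.
rewrite /trig_sum !big_cons big_nil addr0; apply/eqP; rewrite eq_complex.
rewrite ReD ImD /= (mulNr k x) cosN sinN /mode; set t := sigma / k.
by apply/andP; split; apply/eqP; field.
Qed.

Lemma trig_sum_mode_trig s a x :
  trig_sum (mode_trig s a) x = Complex (\sum_(n <- s) a n * mode sigma (freq n) x) 0.
Proof.
elim: s => [|n s IH]; first by rewrite /trig_sum /mode_trig !big_nil.
rewrite mode_trig_cons trig_sum_cat trig_sum_mode IH big_cons.
by apply/eqP; rewrite eq_complex /= addr0 !eqxx.
Qed.

Lemma sqnorm_coefs_mode_trig s a :
  2^-1 * \sum_(n <- s) a n ^+ 2 <= sqnorm_coefs (mode_trig s a).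
Proof.
elim: s => [|n s IH]; first by rewrite /sqnorm_coefs !big_nil mulr0.
rewrite /mode_trig /sqnorm_coefs /= !big_cons mulrDr addrA lerD//.
rewrite /sqnorm /= sqrrN; have := sqr_ge0 (a n / 2 * (sigma / freq n)).
have -> : 2^-1 * a n ^+ 2 = 2 * (a n / 2) ^+ 2 by field.
lra.
Qed.

Lemma size_mode_trig s a : size (mode_trig s a) = (2 * size s)%N.
Proof. by elim: s => //= n s ->; rewrite mulnS. Qed.

Lemma mem_mode_trig s a q : q \in mode_trig s a ->
  exists2 n, n \in s & q.1 = freq n \/ q.1 = - freq n.
Proof.
move=> /flatten_mapP[n ns]; rewrite !inE => /orP[]/eqP ->; exists n => //=.
  by left.
by right.
Qed.

Lemma gapped_mode_trig : exists2 gam : R, 0 < gam &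
  forall s a, uniq s -> gapped gam (mode_trig s a).
Proof.
have [gam gam0 gamP] := freq_separated _ sigma_gt0; exists gam => // s a.
have sum_sep i j : gam <= `|freq i + freq j|.
  by apply: le_trans (ler_norm _); have [] := gamP i j.
elim: s => // n s IH /andP[ns us].
rewrite mode_trig_cons /gapped pairwise_cat.
apply/and3P; split; last exact: IH.
- apply/allrelP => q q' qn /mem_mode_trig[m ms q'E].
  have nm : n <> m by move=> E; rewrite E ms in ns.
  have [d1 _] := gamP n m.
  move: qn; rewrite !inE => /orP[]/eqP -> /=; case: q'E => ->.
  + exact: d1.
  + by rewrite opprK.
  + by rewrite -opprD normrN.
  + by rewrite -opprD normrN; exact: d1.
- by rewrite /= opprK !andbT.
Qed.

Lemma mode_turan (N : nat) (delta : R) : 0 < delta -> exists2 c : R, 0 < c &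
  forall E : set R, measurable E -> E `<=` `[0, 1] -> (delta%:E <= mu E)%E ->
  forall s a, uniq s -> (size s <= N)%N ->
  ((c * \sum_(n <- s) a n ^+ 2)%:E <=
    \int[mu]_(x in E) ((\sum_(n <- s) a n * mode sigma (freq n) x) ^+ 2)%:E)%E.
Proof.
move=> d0; have [gam gam0 sep] := gapped_mode_trig.
have [c c0 Hc] := turan gam (2 * N)%N gam0 delta d0.
exists (c / 2); first by rewrite divr_gt0.
move=> E mE E01 dE s a us sN.
apply: (@le_trans _ _ (c * sqnorm_coefs (mode_trig s a))%:E).
  by rewrite lee_fin -mulrA ler_pM2l// sqnorm_coefs_mode_trig.
apply: le_trans (Hc E mE E01 dE _ _ (sep s a us)) _.
  by rewrite size_mode_trig leq_mul2l.
rewrite le_eqVlt; apply/orP; left; apply/eqP; apply: eq_integral => x _.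
by rewrite trig_sum_mode_trig /sqnorm /= expr0n addr0.
Qed.

(** By Fubini the measure of B is the integral of the section measures. Sections over X contribute
    at most mu(X), since each lies in [0, 1], and the others contribute at most delta / 2 in
    total. *)
Lemma thick_sections (B : set (mR * mR)) (delta : R) : measurable B ->
  B `<=` S -> 0 < delta -> (delta%:E <= plane_measure B)%E ->
  exists X : set R, [/\ measurable X, X `<=` `[0, 1],
    ((delta / 2)%:E <= mu X)%E &
    forall x, X x -> ((delta / 2)%:E <= mu (xsection B x))%E].
Proof.
move=> mB BS d0 dB.
have mx : measurable_fun setT (mu \o xsection B) by exact: measurable_fun_xsection.
pose X := [set x : mR | ((delta / 2)%:E <= (mu \o xsection B) x)%E].
have sec01 x y : xsection B x y -> (0 <= x <= 1) /\ (0 <= y <= 1).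
  by rewrite /xsection /= => /set_mem/BS/unit_squareP[].
have mX : measurable X.
  by rewrite -[X]setTI; exact: emeasurable_fun_c_infty.
exists X; split => //.
- move=> x Xx; rewrite /= in_itv /=; apply: contrapT => xn.
  have : xsection B x = set0.
    rewrite -subset0 => y /sec01[x01 _]; exact: xn.
  by move=> e; move: Xx; rewrite /X /= e measure0 lee_fin leNgt divr_gt0.
- suff : (delta%:E <= mu X + (delta / 2)%:E)%E.
    move=> h; rewrite -(@leeD2rE _ (delta / 2)%:E)// -EFinD -splitr//.
  apply: le_trans dB _.
  rewrite -[leLHS]/(\int[mu]_x (mu \o xsection B) x)%E.
  apply: (@le_trans _ _ (\int[mu]_x ((\1_X x)%:E + (delta / 2)%:E * (\1_(`[0, 1]%classic : set R) x)%:E))%E).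
    apply: ge0_le_integral => //.
    + apply: emeasurable_funD; first by apply/measurable_EFinP; exact: measurable_indic.
      by apply: measurable_funeM; apply/measurable_EFinP; exact: measurable_indic.
    + move=> x _.
      have [Xx|/negP Xx] := asboolP (X x).
        apply: (@le_trans _ _ 1%:E); last first.
          rewrite indicE mem_set// leeDl// -EFinM lee_fin mulr_ge0 ?indicE ?ler0n//.
          by rewrite ltW// divr_gt0.
        apply: (@le_trans _ _ (mu (`[0, 1]%classic : set R))).
          apply: le_measure; rewrite ?inE//; first exact: measurable_xsection.
          by move=> y /sec01[_ y01]; rewrite /= in_itv.
        by rewrite lebesgue_measure_itv/= lte01 oppr0 adde0.
      rewrite indicE memNset//; last exact/negP.
      rewrite add0e; have [x01|x01] := boolP (0 <= x <= 1).
        rewrite indicE mem_set ?mule1; last by rewrite /= in_itv.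
        by apply: ltW; rewrite ltNge; exact: Xx.
      rewrite (_ : (mu \o _) x = 0%E) /=.
        by rewrite -EFinM lee_fin mulr_ge0 ?indicE ?ler0n// ltW// divr_gt0.
      rewrite (_ : xsection B x = set0) ?measure0// -subset0 => y /sec01[x01' _].
      by rewrite x01' in x01.
  have mi (A : set mR) : measurable A -> measurable_fun setT (fun x => (\1_A x)%:E : \bar R).
    by move=> mA; apply/measurable_EFinP; exact: measurable_indic.
  have i0 (A : set mR) x : setT x -> (0 <= (\1_A x)%:E :> \bar R)%E.
    by rewrite lee_fin indicE ler0n.
  have dge0 : (0 <= (delta / 2)%:E)%E by rewrite lee_fin ltW// divr_gt0.
  rewrite (ge0_integralD mu measurableT (i0 _) (mi _ mX)); last 2 first.
  + by move=> x _; exact: mule_ge0 (i0 _ _ I).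
  + by apply: measurable_funeM; exact: mi.
  rewrite (ge0_integralZl mu measurableT (mi _ (measurable_itv _)) (i0 _) dge0).
  rewrite !integral_indic// !setIT; apply: leeD2l.
  rewrite [X in (_ * X <= _)%E](_ : _ = 1%E) ?mule1//.
  by transitivity (mu (`[0, 1]%classic : set R)) => //; rewrite lebesgue_measure_itv/= lte01 oppr0 adde0.
Qed.

End lower_bound.

(** * Bounds for mode sums on plane sets *)

Section conclusion.
Context {R : realType}.
Variable sigma : R.
Hypothesis sigma_gt0 : 0 < sigma.
Local Notation C := R[i].
Local Notation plane := (R * R)%type.
Local Notation S := (unit_square : set plane).
Local Notation mu := (@lebesgue_measure R).
Local Notation freq := (robin_freq sigma).
Local Notation mR := (measurableTypeR R).

(** Tonelli, keeping only the sections over X. The minorant h replaces the inner integral on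
    these. *)
Lemma le_integral_sections (B : set (mR * mR)) (F : plane -> R) (X : set mR)
    (h : mR -> \bar R) : measurable B -> continuous F -> measurable X ->
  measurable_fun X h -> (forall x, X x -> (0 <= h x)%E) ->
  (forall x, X x -> (h x <= \int[mu]_(y in xsection B x) (F (x, y) ^+ 2)%:E)%E) ->
  (\int[mu]_(x in X) h x <= \int[plane_measure]_(p in B) (F p ^+ 2)%:E)%E.
Proof.
move=> mB cF mX mh h0 hle.
have mF : measurable_fun setT (fun p : mR * mR => (F p ^+ 2)%:E).
  apply/measurable_EFinP; apply: measurable_funX.
  exact: (continuous_measurable_plane F setT cF).
pose G := ((fun p : mR * mR => (F p ^+ 2)%:E) \_ B)%E.
have G0 p : (0 <= G p)%E by apply: erestrict_ge0 => q _; rewrite lee_fin sqr_ge0.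
have mG : measurable_fun setT G.
  by apply/(measurable_restrictT _ mB); exact: measurable_funTS.
rewrite [leRHS]integral_mkcond -[leRHS]/(\int[(mu \x mu)%E]_p G p)%E.
rewrite (fubini_tonelli1 G)//.
have mT : measurable_fun setT (fubini_F mu G).
  exact: (measurable_fun_fubini_tonelli_F G).
apply: (@le_trans _ _ (\int[mu]_(x in X) fubini_F mu G x)%E); last first.
  by apply: ge0_subset_integral => // x _; exact: integral_ge0.
apply: ge0_le_integral => //.
  exact: measurable_funTS.
move=> x Xx; apply: le_trans (hle x Xx) _.
rewrite le_eqVlt; apply/orP; left; apply/eqP.
rewrite integral_mkcond; apply: eq_integral => y _.
by rewrite /G !patchE /xsection /= mem_setE.
Qed.

(** Over each x in X the mode sum is a one-variable sum in y with coefficients a_n phi_(g n)(x), and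
    [mode_turan] bounds its square integral below by c1 times the sum of their squares. Integrating
    over X then requires only a lower bound for the integral of each phi_(g n)^2. *)
Lemma mode_sum_lower (N : nat) (delta : R) : 0 < delta -> exists2 c : R, 0 < c &
  forall B : set (mR * mR), measurable B -> B `<=` S ->
  (delta%:E <= plane_measure B)%E -> forall s g a, uniq s -> (size s <= N)%N ->
  ((c * \sum_(n <- s) a n ^+ 2)%:E <=
    \int[plane_measure]_(p in B) (mode_sum sigma s g a p ^+ 2)%:E)%E.
Proof.
move=> d0; have d20 : 0 < delta / 2 by rewrite divr_gt0.
have [c1 c10 H1] := mode_turan sigma sigma_gt0 N _ d20.
have [c2 c20 H2] := mode_turan sigma sigma_gt0 1 _ d20.
exists (c1 * c2); first exact: mulr_gt0.
move=> B mB BS dB s g a us sN.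
have [X [mX X01 dX HX]] := thick_sections B delta mB BS d0 dB.
pose phi n x := mode sigma (freq n) x.
have cphi n : continuous (phi n) by exact: continuous_mode.
have mphi n (D : set mR) : measurable_fun D (fun x : mR => (phi n x ^+ 2)%:E).
  by apply: continuous_measurable_EFin; csolve.
have phi0 n x : X x -> (0 <= (phi n x ^+ 2)%:E)%E by rewrite lee_fin sqr_ge0.
have ca n : (0 <= (c1 * a n ^+ 2)%:E)%E by rewrite lee_fin mulr_ge0 ?sqr_ge0// ltW.
apply: (@le_trans _ _ (\int[mu]_(x in X)
    \sum_(n <- s) ((c1 * a n ^+ 2)%:E * (phi (g n) x ^+ 2)%:E))%E).
  rewrite ge0_integral_sum//; last 2 first.
  - by move=> n; apply: measurable_funeM; exact: mphi.
  - by move=> n x Xx; rewrite mule_ge0// phi0.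
  rewrite mulr_sumr -sumEFin; apply: lee_sum => n _.
  rewrite (ge0_integralZl mu mX (mphi (g n) X) (phi0 (g n)) (ca n)).
  rewrite (_ : c1 * c2 * a n ^+ 2 = c1 * a n ^+ 2 * c2); last by ring.
  rewrite EFinM; apply: lee_wpmul2l => //.
  (* A single mode with coefficient 1 is the case of one term of the same inequality, now over X. *)
  have := H2 X mX X01 dX [:: g n] (fun=> 1) isT isT.
  rewrite big_seq1 expr1n mulr1 => /le_trans; apply.
  rewrite le_eqVlt; apply/orP; left; apply/eqP; apply: eq_integral => x _.
  by rewrite big_seq1 mul1r.
apply: (le_integral_sections B _ X _ mB (continuous_mode_sum sigma s g a) mX).
- by apply: emeasurable_sum => n; apply: measurable_funeM; exact: mphi.
- by move=> x Xx; apply: sume_ge0 => n _; rewrite mule_ge0// phi0.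
move=> x Xx; have x01 := X01 _ Xx.
have := H1 (xsection B x) (measurable_xsection x mB) _ (HX x Xx) s
  (fun n => a n * phi (g n) x) us sN.
move=> /(_ _)/wrap[].
  by move=> y; rewrite /xsection /= => /set_mem/BS/unit_squareP[_]; rewrite in_itv.
rewrite mulr_sumr -sumEFin.
under eq_bigr do rewrite exprMn mulrA EFinM.
move=> /le_trans; apply; rewrite le_eqVlt; apply/orP; left; apply/eqP.
apply: eq_integral => y _; congr (_ ^+ 2)%:E; rewrite /mode_sum.
by apply: eq_bigr => n _; rewrite /mode2 mulrA.
Qed.

(** Cauchy-Schwarz by induction on the number of terms. The modes are bounded uniformly in n because
    k_n >= k_0. *)
Lemma mode_sum_sqr_le (N : nat) s g a p : uniq s -> (size s <= N)%N ->
  mode_sum sigma s g a p ^+ 2 <=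
  N%:R * (1 + (sigma / freq 0) ^+ 2) ^+ 2 * \sum_(n <- s) a n ^+ 2.
Proof.
move=> us sN; set M := 1 + _.
have M0 : 0 <= M by rewrite addr_ge0// sqr_ge0.
have sum0 s' : 0 <= \sum_(n <- s') a n ^+ 2 by apply: sumr_ge0 => n _; exact: sqr_ge0.
have phiM n x : mode sigma (freq n) x ^+ 2 <= M.
  apply: le_trans (mode_sqr_le _ _ _) _; rewrite lerD2l.
  have f0 := freq_gt0 _ sigma_gt0 0; have fn := freq_gt0 _ sigma_gt0 n.
  rewrite ler_sqr ?nnegrE ?divr_ge0 ?(ltW sigma_gt0) ?(ltW f0) ?(ltW fn)//.
  by rewrite ler_pM2l// lef_pV2 ?posrE//; exact: freq_le.
apply: (@le_trans _ _ ((size s)%:R * (M ^+ 2 * \sum_(n <- s) a n ^+ 2))); last first.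
  by rewrite -mulrA ler_wpM2r ?ler_nat// mulr_ge0// sqr_ge0.
elim: s {us sN} => [|n s IH].
  by rewrite /mode_sum big_nil expr0n mul0r.
rewrite /mode_sum !big_cons -/(mode_sum sigma s g a p) /=.
have h1 : (a n * mode2 sigma (freq (g n)) (freq n) p) ^+ 2 <= M ^+ 2 * a n ^+ 2.
  rewrite exprMn mulrC ler_wpM2r ?sqr_ge0// /mode2 exprMn [leRHS]expr2.
  by rewrite ler_pM// sqr_ge0.
set A := a n * _ in h1 *; set P := mode_sum _ _ _ _ _ in IH *.
set T := \sum_(j <- s) _ in IH *.
have T0 : 0 <= M ^+ 2 * T by rewrite mulr_ge0 ?sqr_ge0// sum0.
(* The cross term is split with weights k and 1 / k, where k is the number of remaining terms, so an
   empty tail is treated apart. *)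
case: (posnP (size s)) => [s0|s0].
  have P0 : P ^+ 2 <= 0 by rewrite s0 mul0r in IH.
  have {}P0 : P = 0 by apply/eqP; rewrite -sqrf_eq0 eq_le P0 sqr_ge0.
  by rewrite P0 addr0 s0 mul1r (le_trans h1)// mulrDr lerDl.
set k : R := (size s)%:R in IH *; have k0 : 0 < k by rewrite ltr0n.
rewrite -natr1 -/k mulrDr; set U := M ^+ 2 * a n ^+ 2 in h1 *.
have AG : 2 * (A * P) <= k * A ^+ 2 + k^-1 * P ^+ 2.
  have sq := sqr_ge0 (k * A - P).
  rewrite -(ler_pM2l k0) mulrDr [k * (k^-1 * _)]mulrA divff ?gt_eqF// mul1r.
  nra.
have IH' : k^-1 * P ^+ 2 <= M ^+ 2 * T.
  by rewrite ler_pdivrMl.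
nra.
Qed.

End conclusion.

(** The integral of a nonnegative function is a supremum over simple functions below it. This serves
    to pass from a Borel set to V, which is measurable for the completion only. *)
Lemma subset_ge0_integral d (T : measurableType d) (R : realType)
    (m : {measure set T -> \bar R}) (A B : set T) (f : T -> \bar R) :
  (forall x, (0 <= f x)%E) -> A `<=` B ->
  (\int[m]_(x in A) f x <= \int[m]_(x in B) f x)%E.
Proof.
move=> f0 AB; rewrite !ge0_integralE//; apply: ereal_sup_le.
move=> _ [h hA <-]; exists h => // x; apply: le_trans (hA x) _.
rewrite !patchE; case: ifPn => [/set_mem/AB Bx|_]; first by rewrite mem_set.
by case: ifP.
Qed.

(** * The lower bound for eigenfunctions on V *)

Section observability.
Context {R : realType}.
Variable sigma : R.
Hypothesis sigma_gt0 : 0 < sigma.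
Local Notation C := R[i].
Local Notation plane := (R * R)%type.
Local Notation S := (unit_square : set plane).
Local Notation freq := (robin_freq sigma).
Local Notation mR := (measurableTypeR R).

(** A set of the completion is a Borel set together with a subset of a null set; if the Borel part
    were null, V would have outer measure 0. *)
Lemma borel_kernel (V : set plane) : lebesgue_measurable V ->
  (0 < mu_ext plane_measure V)%E ->
  exists B : set (mR * mR), [/\ measurable B, B `<=` V & (0 < plane_measure B)%E].
Proof.
move=> [B mB [N [A [mA A0 NA]] <-]] V0; exists B; split => //.
rewrite lt0e measure_ge0 andbT; apply/eqP => B0; move: V0.
rewrite ltNge => /negP; apply; rewrite -(_ : plane_measure (B `|` A) = 0%E).
  rewrite -measurable_mu_extE; last exact: measurableU.
  by apply: le_mu_ext; exact: setUS.
apply/eqP; rewrite eq_le measure_ge0 andbT.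
apply: (@le_trans _ _ (plane_measure B + plane_measure A)%E); first exact: measureU2.
by rewrite B0 A0 adde0.
Qed.

Lemma kernel_expansion (K : nat) (Lambda : R) (t : seq (nat * nat)) u :
  (size t <= K)%N ->
  (forall p, p \in t <-> (p.1 <= p.2)%N /\ square_eigenvalue sigma p.1 p.2 = Lambda) ->
  robin_kernel sigma Lambda u ->
  exists s g, [/\ uniq s, (size s <= 2 * K)%N & forall b, exists a,
    {ae plane_measure, forall p, S p -> part b (u p) = mode_sum sigma s g a p}].
Proof.
move=> tK tE ker.
(* The pairs in t are ordered, while the second factor of a product may carry either index; this
   doubles the bound on the number of terms. *)
pose s := undup ([seq p.1 | p <- t] ++ [seq p.2 | p <- t]).
(* The partner of j is unique because the frequencies are positive and distinct. The default 0 is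
   taken only at indices outside s. *)
pose g j := xget 0%N [set i | square_eigenvalue sigma i j = Lambda].
exists s, g; split; first exact: undup_uniq.
  by apply: leq_trans (size_undup _) _; rewrite size_cat !size_map addnn -mul2n leq_mul2l.
move=> b; apply: mode_expansion => //; first exact: undup_uniq.
  exact: L2_square_part (in_L2_kernel _ _ _ ker).
move=> i j nij; apply/eqP; apply: contrapT => I0; apply: nij.
have := kernel_orthogonal sigma sigma_gt0 _ _ b _ _ ker
  (robin_frequency_freq sigma sigma_gt0 i) (robin_frequency_freq sigma sigma_gt0 j).
move=> /eqP; rewrite mulf_eq0 subr_eq0 => /orP[/eqP E|//].
split.
  rewrite mem_undup mem_cat; case/orP: (leq_total i j) => ij.
    apply/orP; right; apply/mapP; exists (i, j) => //; apply/tE; split => //.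
  apply/orP; left; apply/mapP; exists (j, i) => //; apply/tE; split => //=.
  by rewrite /square_eigenvalue addrC.
have : square_eigenvalue sigma (g j) j = Lambda.
  by apply: (@xgetPex _ 0%N [set i | square_eigenvalue sigma i j = Lambda]); exists i.
rewrite E /square_eigenvalue => /addIr /eqP.
rewrite eqrXn2 ?ltW ?freq_gt0// => /eqP /(freq_inj _ sigma_gt0) ->//.
Qed.

(** Both integrals are compared with [T], the sum of the squared coefficients of the real and the
    imaginary part: the one over the square is at most M T, the one over the Borel set B at least c
    T. Since K is chosen before Lambda, neither constant depends on the eigenvalue. *)
Lemma kernel_lower_bound (V : set plane) : V `<=` S -> lebesgue_measurable V ->
  (0 < mu_ext plane_measure V)%E ->
  exists2 c : R, 0 < c & forall (Lambda : R) u, robin_kernel sigma Lambda u ->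
    (c%:E * L2sq S u <= L2sq V u)%E.
Proof.
move=> VS mV V0; have [B [mB BV B0]] := borel_kernel V mV V0.
have BS : B `<=` S := subset_trans BV VS.
have mS : measurable (S : set (mR * mR)) := measurable_unit_square.
have Blty : (plane_measure B < +oo)%E.
  apply: (@le_lt_trans _ _ (plane_measure (S : set (mR * mR)))).
    by apply: le_measure; rewrite ?inE.
  by rewrite plane_measure_unit_square ltry.
have Bfin : plane_measure B \is a fin_num by rewrite ge0_fin_numE// ltW.
have d0 : 0 < fine (plane_measure B) by rewrite fine_gt0// B0 Blty.
have dB : ((fine (plane_measure B))%:E <= plane_measure B)%E by rewrite fineK.
have [K HK] := eigenpairs_finite sigma sigma_gt0.
have [c c0 Hc] := mode_sum_lower sigma sigma_gt0 (2 * K) _ d0.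
(* The constant of [mode_sum_sqr_le] for 2 K + 1 terms rather than 2 K, so that M is positive even
   if K = 0. *)
pose M := ((2 * K).+1)%:R * (1 + (sigma / freq 0) ^+ 2) ^+ 2.
have M0 : 0 < M by rewrite mulr_gt0 ?ltr0n// exprn_gt0// ltr_pwDl// sqr_ge0.
exists (c / M); first exact: divr_gt0.
move=> Lambda u ker; have [t [_ tK tE]] := HK Lambda.
have [s [g [us sK ex]]] := kernel_expansion _ _ _ _ tK tE ker.
have [mu_ _] := in_L2_kernel _ _ _ ker.
have [a aE] := ex false; have [a' a'E] := ex true.
pose T := \sum_(n <- s) a n ^+ 2 + \sum_(n <- s) a' n ^+ 2.
have aeF := ae_filter_ringOfSetsType (@plane_measure R).
have uE : {ae plane_measure, forall p, S p ->
    sqnorm (u p) = mode_sum sigma s g a p ^+ 2 + mode_sum sigma s g a' p ^+ 2}.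
  by apply: filterS2 aE a'E => p h h' Sp; rewrite -h// -h'.
have mP D a0 : measurable_fun (D : set (mR * mR)) (fun p => (mode_sum sigma s g a0 p ^+ 2)%:E).
  apply/measurable_EFinP; apply: measurable_funX.
  exact: continuous_measurable_plane (continuous_mode_sum sigma s g a0).
have mSu : measurable_fun (S : set (mR * mR)) (fun p => (sqnorm (u p))%:E).
  by apply: measurable_sqnorm => b; exact: measurable_part.
have upper : (L2sq S u <= (M * T)%:E)%E.
  rewrite -[leRHS](_ : (\int[plane_measure]_(p in S) (M * T)%:E)%E = _); last first.
    rewrite integral_cst//.
    transitivity ((M * T)%:E * plane_measure (S : set (mR * mR)))%E => //.
    by rewrite plane_measure_unit_square mule1.
  apply: ae_ge0_le_integral => //.
  - by move=> p _; rewrite lee_fin sqnorm_ge0.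
  - move=> p _; rewrite lee_fin mulr_ge0 ?(ltW M0)// addr_ge0//.
      by apply: sumr_ge0 => n _; exact: sqr_ge0.
    by apply: sumr_ge0 => n _; exact: sqr_ge0.
  - apply: filterS uE => p h Sp; rewrite lee_fin h// mulrDr lerD//.
      by apply: mode_sum_sqr_le => //; exact: leq_trans sK _.
    by apply: mode_sum_sqr_le => //; exact: leq_trans sK _.
have lower : ((c * T)%:E <= L2sq B u)%E.
  have -> : L2sq B u = (\int[plane_measure]_(p in B)
      ((mode_sum sigma s g a p ^+ 2)%:E + (mode_sum sigma s g a' p ^+ 2)%:E))%E.
    apply: ge0_ae_eq_integral => //.
    - exact: measurable_funS mSu.
    - by apply: emeasurable_funD; exact: mP.
    - by move=> p _; rewrite lee_fin sqnorm_ge0.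
    - by move=> p _; rewrite -EFinD lee_fin addr_ge0// sqr_ge0.
    - by apply: filterS uE => p h Bp; rewrite h ?EFinD//; exact: BS.
  have P0 a0 p : B p -> (0 <= (mode_sum sigma s g a0 p ^+ 2)%:E)%E.
    by rewrite lee_fin sqr_ge0.
  rewrite (ge0_integralD plane_measure mB (P0 a) (mP B a) (P0 a') (mP B a')).
  by rewrite mulrDr EFinD; apply: leeD; exact: Hc.
apply: (@le_trans _ _ ((c * T)%:E)).
  apply: (@le_trans _ _ ((c / M)%:E * (M * T)%:E)%E).
    by apply: lee_wpmul2l => //; rewrite lee_fin ltW// divr_gt0.
  by rewrite -EFinM lee_fin mulrA divfK// gt_eqF.
apply: le_trans lower _; apply: subset_ge0_integral => // p.
by rewrite lee_fin sqnorm_ge0.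
Qed.

End observability.

Theorem theorem3p11 (R : realType) (sigma : R) (sigma_gt0 : 0 < sigma) :
  (K_square sigma < +oo)%E /\
  forall V : set (R * R),
    V `<=` unit_square -> lebesgue_measurable V ->
    (0 < mu_ext plane_measure V)%E ->
    exists2 c : R, 0 < c &
      forall (Lambda : R) (u : R * R -> R[i]),
        robin_eigenvalue sigma Lambda -> robin_kernel sigma Lambda u ->
        (c%:E * L2sq unit_square u <= L2sq V u)%E.
Proof.
split; first exact: K_square_lty.
move=> V VS mV V0; have [c c0 Hc] := kernel_lower_bound sigma sigma_gt0 V VS mV V0.
by exists c => // Lambda u _; exact: Hc.
Qed.
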